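(* For each $n$ (with $p=p_n$), let $X_1,\dots,X_n\in\mathbb{R}^p$ be independent Gaussian random vectors with mean $0$ and identical covariance $\Sigma$, let $R_1,\dots,R_n>0$ be deterministic, let $A$ be a deterministic $p\times p$ matrix with $A\succeq t\,\mathrm{Id}$, where $t>0$ is fixed, let $B$ be a deterministic positive semidefinite $p\times p$ matrix, and let $v\in\mathbb{R}^p$ be deterministic with $\|v\|=1$ (here $\Sigma$, $A$, $B$, $v$ and the $R_j$ may depend on $n$). Let $\mathcal{S}=\frac1n\sum_{j=1}^nR_j^2X_jX_j^\top$. Suppose that the ratio $p/n$ stays bounded and that, as $n\to\infty$, $$\sum_{j=1}^n\frac{R_j^2}{n}\|\Sigma\|_{op}=O(1)\qquad\text{and}\qquad\sum_{j=1}^n\left(\frac{R_j^2}{n}\wedge\frac{R_j^4}{n^{3/2}}\|\Sigma\|_{op}\right)\|B\|_{op}\|\Sigma\|_{op}=o(1).$$ Then, as $n\to\infty$, $$\mathbb{E}\left[v^\top(\mathcal{S}+A)^{-1}B(\mathcal{S}+A)^{-1}v\right]-\mathbb{E}\left[v^\top(A+\gamma(A)\Sigma)^{-1}\big(B+\xi(A,B)\Sigma\big)(A+\gamma(A)\Sigma)^{-1}v\right]\to0,$$ where $$\gamma(A)=\frac1n\sum_{i=1}^n\frac{R_i^2}{1+\frac1nR_i^2\,\mathrm{trace}\left(\Sigma(\mathcal{S}+A)^{-1}\right)}$$ and $$\xi(A,B)=\left[\frac1n\sum_{i=1}^n\frac{R_i^4}{\left(1+\frac1nR_i^2\,\ma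thrm{trace}\left(\Sigma(\mathcal{S}+A)^{-1}\right)\right)^2}\right]\frac1n\,\mathrm{trace}\left(\Sigma(\mathcal{S}+A)^{-1}B(\mathcal{S}+A)^{-1}\right).$$
   Context: $a\wedge b=\min(a,b)$; $\|\cdot\|_{op}$ is the operator norm; $\succeq$ is the Loewner order on symmetric matrices. Note that $\gamma(A)$ and $\xi(A,B)$ are random variables. *)

(* Defs.v *)
From HB Require Import structures.
From mathcomp Require Import all_boot all_order all_algebra.
From mathcomp Require Import all_classical all_reals all_analysis.

Set Implicit Arguments.
Unset Strict Implicit.
Unset Printing Implicit Defensive.

Import Order.TTheory GRing.Theory Num.Theory.
Import numFieldNormedType.Exports.

Local Open Scope classical_set_scope.
Local Open Scope ring_scope.

Section LinearAlgebra.
Context {R : realType}.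

(* The canonical norm `|_| on matrices is the max norm, hence the explicit
   Euclidean norm and its operator norm. *)
Definition l2norm p (u : 'cV[R]_p) : R := Num.sqrt (\sum_(i < p) u i 0 ^+ 2).

Definition opnorm p (M : 'M[R]_p) : R :=
  sup [set l2norm (M *m u) | u in [set u : 'cV[R]_p | l2norm u <= 1]].

Definition quad p (M : 'M[R]_p) (u : 'cV[R]_p) : R := (u^T *m M *m u) 0 0.

Definition psd p (M : 'M[R]_p) : Prop :=
  M^T = M /\ forall u : 'cV[R]_p, 0 <= quad M u.

Definition loewner_le p (M N : 'M[R]_p) : Prop :=
  [/\ M^T = M, N^T = N & psd (N - M)].

End LinearAlgebra.

Section GaussianVectors.
Context {R : realType} {d : measure_display} {T : measurableType d}.
Variable P : probability T R.

Definition borel_cV p : set (set 'cV[R]_p) := <<s @open 'cV[R]_p >>.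

Definition random_vector p (X : T -> 'cV[R]_p) : Prop :=
  forall S, borel_cV S -> measurable (X @^-1` S).

Definition independent_vectors n p (X : 'I_n -> T -> 'cV[R]_p) : Prop :=
  forall S : 'I_n -> set 'cV[R]_p, (forall j, borel_cV (S j)) ->
    P (\bigcap_(j in [set: 'I_n]) (X j @^-1` S j)) =
    (\prod_(j < n) P (X j @^-1` S j))%E.

(* The law N(m, s^2). [normal_prob m 0] is the uniform law on [0, 1] by
   convention, so the degenerate case has to be the Dirac mass at m. *)
Definition normal_law (m s : R) (S : set R) : \bar R :=
  if s == 0 then \d_m S else normal_prob m s S.

Definition gaussian_vector p (X : T -> 'cV[R]_p) : Prop :=
  random_vector X /\
  forall u : 'cV[R]_p, exists m s : R, forall S : set R, measurable S ->
    P [set w | S ((u^T *m X w) 0 0)] = normal_law m s S.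

Definition has_mean p (X : T -> 'cV[R]_p) (m : 'cV[R]_p) : Prop :=
  forall i, expectation P (fun w => X w i 0) = (m i 0)%:E.

Definition has_covariance p (X : T -> 'cV[R]_p) (Sigma : 'M[R]_p) : Prop :=
  forall i k,
    covariance P (fun w => X w i 0) (fun w => X w k 0) = (Sigma i k)%:E.

End GaussianVectors.

Section RandomMatrix.
Context {R : realType} {n p : nat}.
Implicit Types (r : 'I_n -> R) (Sigma S A B : 'M[R]_p).

Definition sample_cov r (x : 'I_n -> 'cV[R]_p) : 'M[R]_p :=
  n%:R^-1 *: \sum_(j < n) r j ^+ 2 *: (x j *m (x j)^T).

Definition gamma r Sigma S A : R :=
  n%:R^-1 * \sum_(i < n)
    r i ^+ 2 / (1 + n%:R^-1 * r i ^+ 2 * \tr (Sigma *m invmx (S + A))).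

Definition xi r Sigma S A B : R :=
  (n%:R^-1 * \sum_(i < n)
    r i ^+ 4 / (1 + n%:R^-1 * r i ^+ 2 * \tr (Sigma *m invmx (S + A))) ^+ 2) *
  (n%:R^-1 * \tr (Sigma *m invmx (S + A) *m B *m invmx (S + A))).

End RandomMatrix.

(* Main.v *)
Require Import Defs.
From HB Require Import structures.
From mathcomp Require Import all_boot all_order all_algebra.
From mathcomp Require Import all_classical all_reals all_analysis.
From mathcomp Require Import measurable_realfun.
From mathcomp Require Import ring lra.

Set Implicit Arguments.
Unset Strict Implicit.
Unset Printing Implicit Defensive.

Import Order.TTheory GRing.Theory Num.Theory.
Import numFieldNormedType.Exports.

Local Open Scope classical_set_scope.
Local Open Scope ring_scope.

(** Write [M] for the inverse of [S + A], [L] for [M *m B *m M], [tau] for the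
trace of [Sigma *m M], [eta] for the trace of [Sigma *m L], and let [G] be the
inverse of [A + gamma Sigma] and [K = G (B + xi Sigma) G].  All matrices [M]
are bounded by [1/t], since [A] dominates [t Id].

Conceptually, [L] and [K] are minus the derivatives at [u = 0] of [M] and [G]
when [A] is moved to [A + u B], because [xi] is the derivative of [gamma] at that
point.  Differentiating the resolvent identity
[M - G = M (gamma Sigma - S) G] gives the exact algebraic identity
[L - K = L (gamma Sigma - S) G - xi M Sigma G + M (gamma Sigma - S) K],
and the proof consists in showing that the right-hand side has a small mean.
Working with the identity rather than with difference quotients in [u] is what
makes every bound linear in the norm of [B], which is not assumed bounded.

The parameters [gamma] and [xi] depend on the sample only through [tau] and
[eta].  Removing one sample vector moves [tau] by at most [|Sigma| / t] and
[eta] by at most [3 |B| |Sigma| / t^2] ([rank1_tau], [rank1_eta]), so by the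
Efron-Stein inequality ([efron_stein]) both have a standard deviation of order
[sqrt n].  One may therefore replace them by their means, which makes [gamma],
[xi], [G] and [K] deterministic; write [g = G v] and [k = K v] for the resulting
constant vectors.

With deterministic parameters the right-hand side is a sum over [j] of terms in
which the sample vector [x = X_j] occurs through [M x] and [L x].  The
Sherman-Morrison formula rewrites these by the resolvent without [x], divided by
[1 + al q] where [al = R_j^2 / n] and [q] is a quadratic form in [x] with
coefficients independent of [x].  If [q] and its analogue for [L] are replaced
by the constants [E tau] and [E eta], what remains is, given the other vectors, a
combination of products of two linear forms in [x] minus their means, hence
centred ([pair_mean]), up to terms of order [al^2] due to removing [x] from the
resolvents.  The replacement costs at most [min (1, al |q - E tau|)] times the
product of two linear forms, and Wick's formula ([wick], [quadX_var]) gives that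
[q - E tau] is of order [sqrt n |Sigma|], because [p = O(n)].  With
[s_j = al |Sigma|] the [j]-th term thus has mean at most a constant times
[|B| min (s_j, sqrt n s_j^2)], and summing over [j] gives the quantity assumed
to vanish ([deterministic_equivalent]). *)

(** * Moments of the normal law *)

Section NormalMoments.
Context {R : realType}.
Local Notation mu := (@lebesgue_measure R).

(** Uniqueness of Radon-Nikodym derivatives: [normal_prob] is defined by its
    density, which therefore agrees almost everywhere with its abstract derivative. *)
Lemma ge0_integral_normal_prob (m s : R) (g : R -> R) :
  measurable_fun [set: R] g -> (forall x, 0 <= g x) ->
  (\int[normal_prob m s]_x (g x)%:E =
   \int[mu]_x (g x * normal_pdf m s x)%:E)%E.
Proof.
move=> mg' g0'; under [RHS]eq_integral do rewrite EFinM.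
have mg : measurable_fun [set: R] (fun x => (g x)%:E) by exact/measurable_EFinP.
have g0 x : (0 <= (g x)%:E)%E by rewrite lee_fin.
have dom := normal_prob_dominates m s.
rewrite -(Radon_Nikodym_SigmaFinite.change_of_variables dom)//.
have intf := @Radon_Nikodym_SigmaFinite.f_integrable _ _ _ _ _ dom.
apply: ae_eq_integral => //.
- by apply: emeasurable_funM => //; exact: measurable_int intf.
- apply: emeasurable_funM => //; apply/measurable_EFinP.
  exact: measurable_normal_pdf.
- apply: ae_eqe_mul2l; apply: integral_ae_eq => //.
  + by apply/measurable_EFinP; exact: measurable_normal_pdf.
  + by move=> E _ mE; rewrite -Radon_Nikodym_SigmaFinite.f_integral.
Qed.

(** Integration by parts on the whole line: the fundamental theorem of calculus
    on [[-a, a]] and dominated convergence. Applied to a power of [x - m] times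
    the normal density, it gives the recurrence between moments. *)
Lemma integral_derive_eq0 (F f : R -> R) :
  (forall x : R, is_derive x (1 : R) (F : R^o -> R^o) (f x)) ->
  continuous f -> mu.-integrable setT (EFin \o f) ->
  F x @[x --> +oo] --> 0 -> F x @[x --> -oo] --> 0 ->
  (\int[mu]_x (f x)%:E = 0)%E.
Proof.
move=> dF cf intf Fy FNy.
have dvF x : derivable (F : R^o -> R^o) x 1 by have := dF x => -[].
have contF : continuous F.
  by move=> x; apply/differentiable_continuous/derivable1_diffP.
pose a (k : nat) : R := k.+1%:R.
have a0 k : - a k < a k by rewrite (@lt_trans _ _ 0)// ?oppr_lt0 ltr0n.
have ftc k : (\int[mu]_(x in `[(- a k)%R, a k]) (f x)%:E
    = (F (a k))%:E - (F (- a k))%:E)%E.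
  apply: continuous_FTC2 => //.
  - exact: continuous_subspaceT.
  - split => //.
    + by apply: cvg_at_right_filter; exact: contF.
    + by apply: cvg_at_left_filter; exact: contF.
  - by move=> x _; rewrite derive1E; have := dF x => -[_ ->].
have ay : a k @[k --> \oo] --> +oo.
  apply/cvgryPge => A; near=> k.
  have : A <= k%:R by near: k; exact: nbhs_infty_ger.
  by move/le_trans; apply; rewrite ler_nat.
have lim0 : ((F (a k))%:E - (F (- a k))%:E)%E @[k --> \oo] --> 0%E.
  have -> : 0%E = (0 - 0 : R)%:E by rewrite subr0.
  apply: cvg_EFin; first by near=> k.
  apply: cvgB; first exact: (cvg_comp _ _ ay Fy).
  apply: (@cvg_comp _ _ _ (fun k => - a k) F _ _ _ _ FNy).
  exact/cvgNrNy.
pose I k := [set` `[(- a k)%R, a k]] : set R.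
pose fk k := (EFin \o f) \_ (I k).
have := @dominated_convergence _ _ _ mu setT measurableT fk (EFin \o f)
  (fun x => `|(f x)%:E|%E).
case.
- move=> k; apply/(measurable_restrictT _ _).1; first exact: measurable_itv.
  by apply: measurable_funTS; exact: measurable_int intf.
- exact: measurable_int intf.
- apply/aeW => x _; apply: cvg_near_cst; near=> k.
  rewrite /fk patchE ifT// inE /I /= in_itv /= -ler_norml.
  by near: k; exact: (cvgry_ge ay).
- exact: integrable_abse.
- apply/aeW => x k _; rewrite /fk patchE; case: ifPn => // _.
  by rewrite abse0.
move=> _ _ lim1.
apply: (cvg_unique _ lim1) => //.
have E : (fun k => \int[mu]_x fk k x)%E =
    (fun k => (F (a k))%:E - (F (- a k))%:E)%E.
  by apply/funext => k; rewrite -ftc [RHS]integral_mkcond.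
by rewrite /= E.
Unshelve. all: by end_near.
Qed.

End NormalMoments.

Section NormalMoments2.
Context {R : realType}.
Local Notation mu := (@lebesgue_measure R).
Variables (m s : R).
Hypothesis s0 : s != 0.

Lemma is_derive_pow_normal_pdf (k : nat) (x : R) :
  is_derive x (1 : R) (fun y : R^o => (y - m) ^+ k * normal_pdf m s y : R^o)
   ((k%:R * (x - m) ^+ k.-1 - (x - m) ^+ k.+1 / s ^+ 2) * normal_pdf m s x).
Proof.
rewrite normal_pdfE//.
have dE : is_derive x (1 : R) (normal_fun m s : R^o -> R^o)
    (- (x - m) / s ^+ 2 * normal_fun m s x).
  rewrite /normal_fun.
  apply: is_derive_eq.
  rewrite /GRing.scale /=; field.
  done.
have d1 : is_derive x (1 : R) (fun y : R^o => (y - m) ^+ k : R^o)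
    (k%:R * (x - m) ^+ k.-1).
  have d0 : is_derive x (1 : R) (fun y : R^o => y - m : R^o) (1 : R).
    by apply: is_derive_eq; rewrite subr0.
  have := is_deriveX k d0; rewrite exprfctE /GRing.scale /= mulr1.
  exact.
have d2 : is_derive x (1 : R) (fun y : R^o => normal_peak s * normal_fun m s y : R^o)
    (normal_peak s * (- (x - m) / s ^+ 2 * normal_fun m s x)).
  exact: is_deriveZ.
apply: (@is_derive_eq _ _ _ _ _ _ _ _ (is_deriveM d1 d2)).
rewrite /GRing.scale /= (exprS (x - m) k); move: (_ ^+ k.-1) (_ ^+ k) => a b.
by field.
Qed.

Let s2 := s * Num.sqrt 2.

(** A density with a larger variance absorbs polynomial factors, because
    [1 + z^2 / 2 <= exp z]. This single domination gives the integrability of all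
    moments up to the fourth. *)
Lemma pow4_normal_pdf_le (x : R) :
  (1 + (x - m) ^+ 4) * normal_pdf m s x <=
  (1 + 32 * s ^+ 4) * normal_peak s / normal_peak s2 * normal_pdf m s2 x.
Proof.
have s20 : s2 != 0 by rewrite /s2 mulf_neq0// gt_eqF// sqrtr_gt0.
rewrite !normal_pdfE//.
(* With this [z] the two exponentials are [exp (- 2 z)] and [exp (- z)]. *)
set z := (x - m) ^+ 2 / (4 * s ^+ 2).
have z0 : 0 <= z by rewrite divr_ge0 ?sqr_ge0// mulr_ge0// sqr_ge0.
have -> : normal_fun m s x = expR (- z) * expR (- z).
  by rewrite /normal_fun -expRD /z; congr expR; field.
have -> : normal_fun m s2 x = expR (- z).
  rewrite /normal_fun /s2 exprMn sqr_sqrtr// /z; congr expR; field; done.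
have -> : (1 + 32 * s ^+ 4) * normal_peak s / normal_peak s2 *
   (normal_peak s2 * expR (- z)) = (1 + 32 * s ^+ 4) * expR (- z) * normal_peak s.
  by field; rewrite gt_eqF// normal_peak_gt0.
have -> : (1 + (x - m) ^+ 4) * (normal_peak s * (expR (- z) * expR (- z))) =
  ((1 + (x - m) ^+ 4) * expR (- z)) * expR (- z) * normal_peak s by ring.
rewrite ler_wpM2r ?normal_peak_ge0// ler_wpM2r ?expR_ge0//.
have -> : (x - m) ^+ 4 = 16 * s ^+ 4 * z ^+ 2 by rewrite /z; field.
rewrite expRN ler_pdivrMr ?expR_gt0//.
have ez := expR_ge1Dxn 1 z0.
have s4 : 0 <= s ^+ 4 by rewrite (_ : 4%N = (2 * 2)%N)// exprM sqr_ge0.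
have z2 : 0 <= z ^+ 2 by exact: sqr_ge0.
have ez' : 1 + z ^+ 2 / 2 <= expR z by move: ez; rewrite !factS fact0.
set E := expR z in ez' *.
have -> : (1 + 32 * s ^+ 4) * E = E + 16 * s ^+ 4 * (2 * E) by ring.
apply: lerD; first by lra.
by apply: ler_wpM2l; [exact: mulr_ge0|lra].
Qed.

Lemma integrable_pow_normal_pdf (k : nat) : (k <= 4)%N ->
  mu.-integrable setT (EFin \o (fun x => (x - m) ^+ k * normal_pdf m s x)).
Proof.
move=> k4.
have i2 := integrable_normal_pdf m s2.
have := integrableZl measurableT ((1 + 32 * s ^+ 4) * normal_peak s / normal_peak s2) i2.
apply: le_integrable => //.
  apply/measurable_EFinP; apply: measurable_funM; last exact: measurable_normal_pdf.
  by apply: measurable_funX; apply: measurable_funB.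
move=> x _; rewrite -EFinM !abse_EFin lee_fin.
have := pow4_normal_pdf_le x; move=> h.
rewrite [leRHS]ger0_norm; last first.
  apply: le_trans h; rewrite mulr_ge0 ?normal_pdf_ge0// addr_ge0//.
  by rewrite (_ : 4%N = (2 * 2)%N)// exprM sqr_ge0.
apply: le_trans h; rewrite normrM [X in _ * X]ger0_norm ?normal_pdf_ge0//.
rewrite ler_wpM2r ?normal_pdf_ge0//.
set u := x - m; rewrite normrX.
have -> : u ^+ 4 = `|u| ^+ 4 by rewrite -normrX ger0_norm// (_ : 4%N = (2 * 2)%N)// exprM sqr_ge0.
have u0 : 0 <= `|u| by [].
have [u1|u1] := lerP `|u| 1.
  by rewrite (le_trans (exprn_ile1 k u0 u1))// lerDl exprn_ge0.
by rewrite (@le_trans _ _ (`|u| ^+ 4))// ?ler_wpDl// ler_weXn2l// ltW.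
Qed.

Let F (k : nat) (x : R) := (x - m) ^+ k * normal_pdf m s x.

Lemma pow_normal_pdf_decay (k : nat) : (k <= 3)%N ->
  exists2 C : R, 0 <= C & forall x, `|F k x| * `|x - m| <= C.
Proof.
move=> k3; have s20 : s2 != 0 by rewrite /s2 mulf_neq0// gt_eqF// sqrtr_gt0.
set C := (1 + 32 * s ^+ 4) * normal_peak s / normal_peak s2 * normal_peak s2.
have u4 (u : R) : 0 <= u ^+ 4 by rewrite (_ : 4%N = (2 * 2)%N)// exprM sqr_ge0.
have C0 : 0 <= C.
  by rewrite !mulr_ge0 ?invr_ge0 ?normal_peak_ge0// addr_ge0// mulr_ge0.
exists C => // x; have h := pow4_normal_pdf_le x.
apply: (@le_trans _ _ ((1 + (x - m) ^+ 4) * normal_pdf m s x)).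
  rewrite /F normrM [X in _ * X * _]ger0_norm ?normal_pdf_ge0// mulrAC.
  rewrite ler_wpM2r ?normal_pdf_ge0// normrX -exprSr.
  have -> : (x - m) ^+ 4 = `|x - m| ^+ 4 by rewrite -normrX ger0_norm.
  have u0 : 0 <= `|x - m| by [].
  have [u1|u1] := lerP `|x - m| 1.
    by rewrite (le_trans (exprn_ile1 k.+1 u0 u1))// lerDl exprn_ge0.
  by rewrite (@le_trans _ _ (`|x - m| ^+ 4))// ?ler_wpDl// ler_weXn2l// ltW.
apply: (le_trans h); rewrite /C ler_wpM2l ?normal_pdf_ub//.
by rewrite !mulr_ge0 ?invr_ge0 ?normal_peak_ge0// addr_ge0// mulr_ge0.
Qed.

Lemma cvg_pow_normal_pdf (k : nat) (G : set_system R) : Filter G -> (k <= 3)%N ->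
  (forall A : R, \forall x \near G, A <= `|x - m|) -> F k x @[x --> G] --> 0.
Proof.
move=> FG k3 Gy; have [C C0 hC] := pow_normal_pdf_decay k3.
apply/cvgrPdist_le => e e0; near=> x; rewrite sub0r normrN.
have xA : (C / e + 1) <= `|x - m| by near: x; exact: Gy.
have x0 : 0 < `|x - m|.
  by apply: lt_le_trans xA; rewrite ltr_wpDl// divr_ge0// ltW.
rewrite -(ler_pM2r x0); apply: (le_trans (hC x)).
rewrite -ler_pdivrMl// mulrC; apply: le_trans xA.
by rewrite lerDl.
Unshelve. all: by end_near. Qed.

Definition normal_moment (k : nat) : R := \int[mu]_x F k x.

(** The derivative of [(x - m)^k f(x)], with [f] the density, has integral zero. *)
Lemma normal_momentS (k : nat) : (k <= 3)%N ->
  normal_moment k.+1 = s ^+ 2 * (k%:R * normal_moment k.-1).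
Proof.
move=> k3.
have i1 : mu.-integrable setT (EFin \o F k.+1).
  exact: integrable_pow_normal_pdf.
have i2 : mu.-integrable setT (EFin \o F k.-1).
  by apply: integrable_pow_normal_pdf; rewrite (leq_trans (leq_pred _))// ltnW.
have i1' : mu.-integrable setT (EFin \o (fun x => (s ^+ 2)^-1 * F k.+1 x)).
  have := integrableZl measurableT (s ^+ 2)^-1 i1.
  by apply: eq_integrable => // x _; rewrite /= EFinM.
have i2' : mu.-integrable setT (EFin \o (fun x => k%:R * F k.-1 x)).
  have := integrableZl measurableT k%:R i2.
  by apply: eq_integrable => // x _; rewrite /= EFinM.
pose f x := k%:R * F k.-1 x - (s ^+ 2)^-1 * F k.+1 x.
have inf : mu.-integrable setT (EFin \o f).
  have := integrableB measurableT i2' i1'.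
  by apply: eq_integrable => // x _; rewrite /= EFinB.
have : (\int[mu]_x (f x)%:E = 0)%E.
  apply: (@integral_derive_eq0 _ (F k)) => //.
  - move=> x; have := is_derive_pow_normal_pdf k x.
    by rewrite (_ : _ * normal_pdf m s x = f x)// /f /F; ring.
  - have cF j : continuous (F j).
      move=> x; apply: cvgM; last exact: continuous_normal_pdf.
      apply: (@cvg_comp _ _ _ (fun x => x - m) (fun x => x ^+ j)).
        by apply: cvgB; [exact: cvg_id|exact: cvg_cst].
      exact: exprn_continuous.
    move=> x; apply: cvgB; apply: cvgM; try exact: cvg_cst; exact: cF.
  - apply: cvg_pow_normal_pdf => // A; near=> x.
    apply: le_trans (ler_norm _); rewrite lerBrDr.
    by near: x; apply: nbhs_pinfty_ge; exact: num_real.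
  - apply: cvg_pow_normal_pdf => // A; near=> x.
    rewrite distrC; apply: le_trans (ler_norm _); rewrite lerBrDr -lerBrDl.
    by near: x; apply: nbhs_ninfty_le; exact: num_real.
move=> /(congr1 fine) /=; rewrite -[LHS]/(\int[mu]_x f x).
rewrite RintegralB// !RintegralZl// -/(normal_moment k.+1) -/(normal_moment k.-1).
by move/eqP; rewrite subr_eq0 => /eqP ->; rewrite mulVKf// sqrf_eq0.
Unshelve. all: by end_near. Qed.

Lemma normal_moment0 : normal_moment 0 = 1.
Proof.
rewrite /normal_moment /F /Rintegral.
under eq_integral do rewrite expr0 mul1r.
by rewrite integral_normal_pdf.
Qed.

Lemma normal_moment1 : normal_moment 1 = 0.
Proof. by rewrite normal_momentS// mul0r mulr0. Qed.

Lemma normal_moment2 : normal_moment 2 = s ^+ 2.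
Proof. by rewrite normal_momentS//= normal_moment0 !mulr1. Qed.

Lemma normal_moment4 : normal_moment 4 = 3 * s ^+ 4.
Proof. by rewrite normal_momentS//= normal_moment2; ring. Qed.

End NormalMoments2.

Section LawMoments.
Context {R : realType} {d : measure_display} {T : measurableType d}.
Variables (P : probability T R) (Y : T -> R) (m s : R).
Hypothesis mY : measurable_fun setT Y.
Hypothesis lawY : forall S : set R, measurable S ->
  P (Y @^-1` S) = normal_law m s S.

Let ge0_law (g : R -> R) : measurable_fun [set: R] g -> (forall x, 0 <= g x) ->
  (\int[P]_w (g (Y w))%:E =
   if (s == 0)%R then (g m)%:E
   else \int[lebesgue_measure]_x (g x * normal_pdf m s x)%:E)%E.
Proof.
move=> mg g0.
(* [R] and the domain of Lebesgue measure carry the same sets under different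
   displays. *)
pose Y' : T -> measurableTypeR R := Y.
have mY' : measurable_fun setT Y' by exact: mY.
have mgE : measurable_fun [set: measurableTypeR R] (EFin \o g).
  by apply/measurable_EFinP; exact: mg.
have -> : (\int[P]_w (g (Y w))%:E = \int[pushforward P Y']_x (g x)%:E)%E.
  by rewrite ge0_integral_pushforward// => x _; rewrite lee_fin.
case: ifPn => s0.
  rewrite (eq_measure_integral (dirac (m : measurableTypeR R))); last first.
    move=> A mA _; rewrite /= /pushforward.
    by have := lawY mA; rewrite /normal_law s0.
  by rewrite integral_dirac// diracT mul1e.
rewrite -ge0_integral_normal_prob//.
apply: (eq_measure_integral (normal_prob m s)) => A mA _.
by rewrite /= /pushforward; have := lawY mA; rewrite /normal_law (negbTE s0).
Qed.

Lemma law_integrable_moment (k : nat) : (k <= 4)%N ->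
  P.-integrable setT (EFin \o (fun w => (Y w - m) ^+ k)).
Proof.
move=> k4; apply/integrableP; split.
  apply/measurable_EFinP; apply: measurable_funX; exact: measurable_funB.
have := @ge0_law (fun x => `|(x - m) ^+ k|).
move=> ->//; last first.
  apply: measurableT_comp => //; apply: measurable_funX; exact: measurable_funB.
case: ifPn => s0; first by rewrite ltry.
have /integrableP[_] := @integrable_pow_normal_pdf _ m _ s0 _ k4.
apply: le_lt_trans; rewrite le_eqVlt; apply/orP; left; apply/eqP.
apply: eq_integral => x _; rewrite abse_EFin normrM; congr (_ * _)%:E.
by rewrite ger0_norm// normal_pdf_ge0.
Qed.

(** The degenerate normal law, a Dirac mass, satisfies the same formulas with
    all central moments zero. *)
Lemma law_moment (k : nat) : (k <= 4)%N ->
  \int[P]_w ((Y w - m) ^+ k) =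
  if s == 0 then 0 ^+ k else normal_moment m s k.
Proof.
move=> k4; rewrite /normal_moment /Rintegral.
pose g (x : R) := (x - m) ^+ k.
have mg : measurable_fun [set: R] g.
  apply: measurable_funX; exact: measurable_funB.
have mP : measurable_fun [set: R] (g^\+)%R by exact: measurable_funrpos.
have mN : measurable_fun [set: R] (g^\-)%R by exact: measurable_funrneg.
have EP w : ((EFin \o (fun w => g (Y w)))^\+ w = (g^\+ (Y w))%:E)%E.
  by rewrite funeposE /funrpos /= EFin_max.
have EN w : ((EFin \o (fun w => g (Y w)))^\- w = (g^\- (Y w))%:E)%E.
  by rewrite funenegE /funrneg /= EFin_max.
have -> : (\int[P]_w ((Y w - m) ^+ k)%:E =
  \int[P]_w (g^\+ (Y w))%:E - \int[P]_w (g^\- (Y w))%:E)%E.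
  rewrite [LHS]integralE; congr (_ - _)%E; apply: eq_integral => w _.
    exact: EP.
  exact: EN.
rewrite !ge0_law//.
case: ifPn => s0.
  by rewrite -EFinB /= -[LHS]/((g^\+ - g^\-) m) funrposBneg /g subrr.
rewrite [in RHS]integralE; congr (fine (_ - _)%E); apply: eq_integral => x _.
  rewrite funeposE /funrpos -EFin_max; congr _%:E.
  by rewrite maxr_pMl ?mul0r// normal_pdf_ge0.
rewrite funenegE /funrneg -EFinN -EFin_max; congr _%:E.
by rewrite maxr_pMl ?mul0r ?mulNr// normal_pdf_ge0.
Qed.

End LawMoments.

(** * Expectations of integrable real functions *)

Section Expectation.
Context {R : realType} {d : measure_display} {T : measurableType d}.
Variable P : probability T R.
Implicit Types f g : T -> R.

Definition L1 f := P.-integrable setT (EFin \o f).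
Definition Ex f : R := \int[P]_w f w.

Lemma L1_measurable f : L1 f -> measurable_fun setT f.
Proof. by move=> /measurable_int/measurable_EFinP. Qed.

Lemma L1_le f g : measurable_fun setT f -> L1 g ->
  (forall w, `|f w| <= g w) -> L1 f.
Proof.
move=> mf ig fg; apply: (le_integrable measurableT) ig.
  exact/measurable_EFinP.
by move=> w _; rewrite !abse_EFin lee_fin (le_trans (fg w))// ler_norm.
Qed.

Lemma eq_L1 f g : f =1 g -> L1 f -> L1 g.
Proof. by move=> /funext ->. Qed.

Lemma L1_cst (c : R) : L1 (fun=> c).
Proof. exact: finite_measure_integrable_cst. Qed.

Lemma L1_bounded f (K : R) : measurable_fun setT f ->
  (forall w, `|f w| <= K) -> L1 f.
Proof. by move=> mf fK; apply: (L1_le mf (L1_cst K)). Qed.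

Lemma L1D f g : L1 f -> L1 g -> L1 (fun w => f w + g w).
Proof.
move=> If Ig; have := integrableD measurableT If Ig.
by apply: eq_integrable => // w _; rewrite /= EFinD.
Qed.

Lemma L1B f g : L1 f -> L1 g -> L1 (fun w => f w - g w).
Proof.
move=> If Ig; have := integrableB measurableT If Ig.
by apply: eq_integrable => // w _; rewrite /= EFinB.
Qed.

Lemma L1Z c f : L1 f -> L1 (fun w => c * f w).
Proof.
move=> If; have := integrableZl measurableT c If.
by apply: eq_integrable => // w _; rewrite /= EFinM.
Qed.

Lemma L1_norm f : L1 f -> L1 (fun w => `|f w|).
Proof. exact: integrable_norm. Qed.

Lemma L1_sum (I : Type) (s : seq I) (Q : pred I) (h : I -> T -> R) :
  (forall i, Q i -> L1 (h i)) -> L1 (fun w => \sum_(i <- s | Q i) h i w).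
Proof.
move=> H; elim: s => [|i s IH].
  by rewrite (_ : (fun=> _) = fun=> 0); [exact: L1_cst|apply/funext=> w; rewrite big_nil].
case: (boolP (Q i)) => Qi.
  rewrite (_ : (fun=> _) = fun w => h i w + \sum_(j <- s | Q j) h j w).
    by apply: L1D => //; exact: H.
  by apply/funext=> w; rewrite big_cons Qi.
by under eq_fun do rewrite big_cons (negbTE Qi).
Qed.

Lemma ExE f : L1 f -> (\int[P]_w (f w)%:E)%E = (Ex f)%:E.
Proof. by move=> If; rewrite /Ex fineK//; exact: integrable_fin_num. Qed.

Lemma ExD f g : L1 f -> L1 g -> Ex (fun w => f w + g w) = Ex f + Ex g.
Proof. by move=> If Ig; rewrite /Ex RintegralD. Qed.

Lemma ExB f g : L1 f -> L1 g -> Ex (fun w => f w - g w) = Ex f - Ex g.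
Proof. by move=> If Ig; rewrite /Ex RintegralB. Qed.

Lemma ExZ c f : L1 f -> Ex (fun w => c * f w) = c * Ex f.
Proof. by move=> If; rewrite /Ex RintegralZl. Qed.

Lemma Ex_cst c : Ex (fun=> c) = c.
Proof. by rewrite /Ex Rintegral_cst// [X in fine X]probability_setT mulr1. Qed.

Lemma Ex_ge0 f : (forall w, 0 <= f w) -> 0 <= Ex f.
Proof. by move=> f0; apply: Rintegral_ge0. Qed.

Lemma le_Ex f g : L1 f -> L1 g -> (forall w, f w <= g w) -> Ex f <= Ex g.
Proof. by move=> If Ig fg; apply: le_Rintegral. Qed.

Lemma Ex_norm_le f : L1 f -> `|Ex f| <= Ex (fun w => `|f w|).
Proof. by move=> If; apply: le_normr_Rintegral. Qed.

Lemma eq_Ex f g : f =1 g -> Ex f = Ex g.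
Proof. by move=> fg; congr Ex; apply/funext. Qed.

Lemma Ex_sum (I : Type) (s : seq I) (Q : pred I) (h : I -> T -> R) :
  (forall i, Q i -> L1 (h i)) ->
  Ex (fun w => \sum_(i <- s | Q i) h i w) = \sum_(i <- s | Q i) Ex (h i).
Proof.
move=> H; elim: s => [|i s IH].
  by rewrite big_nil -[RHS]Ex_cst; apply: eq_Ex => w; rewrite big_nil.
rewrite big_cons; under eq_Ex do rewrite big_cons.
case: ifPn => Qi//; rewrite ExD ?IH//; [exact: H|exact: L1_sum].
Qed.

Lemma Ex_norm_dom f g : measurable_fun setT f -> L1 g ->
  (forall w, `|f w| <= g w) -> `|Ex f| <= Ex g.
Proof.
move=> mf ig fg; have If := L1_le mf ig fg.
by apply: (le_trans (Ex_norm_le If)); apply: le_Ex => //; exact: L1_norm.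
Qed.

Lemma L1_mul f g : measurable_fun setT f -> measurable_fun setT g ->
  L1 (fun w => f w ^+ 2) -> L1 (fun w => g w ^+ 2) -> L1 (fun w => f w * g w).
Proof.
move=> mf mg If Ig; apply: (L1_le _ (L1D If Ig)); first exact: measurable_funM.
move=> w; rewrite normrM -(real_normK (num_real (f w))) -(real_normK (num_real (g w))).
by have := sqr_ge0 (`|f w| - `|g w|); have := sqr_ge0 (`|f w| + `|g w|); nra.
Qed.

(** Stated with bounds [a], [b] on the two root mean squares, which may vanish:
    the weighted inequality [|f g| <= (k / l) f^2 / 2 + (l / k) g^2 / 2] needs
    positive weights, obtained by enlarging [a] and [b] by an arbitrarily small
    amount. *)
Lemma CauchySchwarz f g (a b : R) : 0 <= a -> 0 <= b ->
  measurable_fun setT f -> measurable_fun setT g ->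
  L1 (fun w => f w ^+ 2) -> L1 (fun w => g w ^+ 2) ->
  Ex (fun w => f w ^+ 2) <= a ^+ 2 -> Ex (fun w => g w ^+ 2) <= b ^+ 2 ->
  Ex (fun w => `|f w * g w|) <= a * b.
Proof.
move=> a0 b0 mf mg If Ig Ea Eb; have Im := L1_norm (L1_mul mf mg If Ig).
have key (l k : R) : 0 < l -> 0 < k -> a <= l -> b <= k ->
    Ex (fun w => `|f w * g w|) <= l * k.
  move=> l0 k0 al bk.
  have If' := L1Z (k / (2 * l)) If; have Ig' := L1Z (l / (2 * k)) Ig.
  apply: (@le_trans _ _ (Ex (fun w => k / (2 * l) * f w ^+ 2 + l / (2 * k) * g w ^+ 2))).
    apply: le_Ex => //; first exact: L1D.
    move=> w; rewrite normrM -(real_normK (num_real (f w))) -(real_normK (num_real (g w))).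
    set x := `|f w|; set y := `|g w|.
    have -> : k / (2 * l) * x ^+ 2 + l / (2 * k) * y ^+ 2 =
        x * y + (k * x - l * y) ^+ 2 / (2 * l * k).
      by field; rewrite !gt_eqF.
    by rewrite lerDl divr_ge0 ?sqr_ge0// !mulr_ge0// ltW.
  rewrite ExD// !ExZ//.
  have -> : l * k = k / (2 * l) * l ^+ 2 + l / (2 * k) * k ^+ 2.
    by field; rewrite !gt_eqF.
  apply: lerD; apply: ler_wpM2l; try by rewrite divr_ge0 ?mulr_ge0// ltW.
  - by apply: (le_trans Ea); rewrite ler_sqr ?nnegrE// ltW.
  - by apply: (le_trans Eb); rewrite ler_sqr ?nnegrE// ltW.
apply/ler_addgt0Pr => e e0.
pose h := Num.min 1 (e / (a + b + 1)).
have h0 : 0 < h by rewrite lt_min ltr01 divr_gt0// ltr_wpDl// addr_ge0.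
have h1 : h <= 1 by rewrite ge_min lexx.
have he : h * (a + b + 1) <= e.
  by rewrite -ler_pdivlMr ?ltr_wpDl ?addr_ge0// ge_min lexx orbT.
apply: (le_trans (key (a + h) (b + h) _ _ _ _)); rewrite ?lerDl ?(ltW h0)//.
- by rewrite ltr_wpDl.
- by rewrite ltr_wpDl.
- by nra.
Qed.

Lemma Ex_norm_le_sqrt f (a : R) : 0 <= a -> measurable_fun setT f ->
  L1 (fun w => f w ^+ 2) -> Ex (fun w => f w ^+ 2) <= a ^+ 2 ->
  Ex (fun w => `|f w|) <= a.
Proof.
move=> a0 mf If Ea; rewrite -[leRHS]mulr1.
have -> : Ex (fun w => `|f w|) = Ex (fun w => `|f w * 1|).
  by apply: eq_Ex => w; rewrite mulr1.
apply: CauchySchwarz => //; last by rewrite Ex_cst !expr1n.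
exact: L1_cst.
Qed.

End Expectation.

(** * Functionals of a family of vectors and independence *)

Section Configurations.
Context {R : realType} {I : finType} {p : nat}.
Local Notation V := 'cV[R]_p.
Implicit Types (F : (I -> V) -> R) (y : I -> V).

Definition entries_measurable d (T : measurableType d) (Y : I -> T -> V) :=
  forall i a, measurable_fun [set: T] (fun w => Y i w a 0).

(** Quantifying over all measurable spaces lets one functional be evaluated on
    the sample space, on its square and on the configuration space itself
    without choosing a product sigma-algebra. *)
Definition measurable_functional F :=
  forall d (T : measurableType d) (Y : I -> T -> V),
    entries_measurable Y -> measurable_fun [set: T] (fun w => F (Y^~ w)).

Lemma random_vector_entries d (T : measurableType d) (X : T -> V) (a : 'I_p) :
  random_vector X -> measurable_fun [set: T] (fun w => X w a 0).
Proof.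
move=> rX; apply: (measurability _ (RGenOpens.measurableE R)).
move=> _ [_ [b [c ->] <-]]; rewrite setTI.
apply: (rX [set u : V | `]b, c[%classic (u a 0)]); apply: sub_sigma_algebra.
have /continuousP := @coord_continuous R p 1 a 0.
by apply; exact: interval_open.
Qed.

Definition rectangle (S : I -> set V) : set (I -> V) :=
  [set y | forall i, S i (y i)].

Definition rectangles : set (set (I -> V)) :=
  [set rectangle S | S in [set S | forall i, borel_cV (S i)]].

Lemma borel_cV_setI (A B : set V) : borel_cV A -> borel_cV B -> borel_cV (A `&` B).
Proof.
move=> mA mB; exact: (@measurableI _ (g_sigma_algebraType (@open V)) A B).
Qed.

Lemma borel_cV_setT : borel_cV (setT : set V).
Proof. exact: (@measurableT _ (g_sigma_algebraType (@open V))). Qed.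

Lemma rectangles_setI : setI_closed rectangles.
Proof.
move=> _ _ [S1 m1 <-] [S2 m2 <-]; exists (fun i => S1 i `&` S2 i).
  by move=> i; apply: borel_cV_setI; [exact: m1|exact: m2].
apply/seteqP; split => y /= H; first by split => i; case: (H i).
by case: H => H1 H2 i; split; [exact: H1|exact: H2].
Qed.

Lemma rectangle_preimage d (T : measurableType d) (Y : I -> T -> V) (S : I -> set V) :
  (fun w => Y^~ w) @^-1` rectangle S = \bigcap_(i in [set: I]) (Y i @^-1` S i).
Proof. by apply/seteqP; split => w /= H i; [move=> _; exact: H|exact: H]. Qed.

Lemma measurable_rectangle d (T : measurableType d) (Y : I -> T -> V) (S : I -> set V) :
  (forall i, random_vector (Y i)) -> (forall i, borel_cV (S i)) ->
  measurable ((fun w => Y^~ w) @^-1` rectangle S).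
Proof.
move=> rY mS; rewrite rectangle_preimage; apply: fin_bigcap_measurable.
  exact: finite_finset.
by move=> i _; apply: rY; exact: mS.
Qed.

(** Measurable rectangles generate the configuration space and are stable under
    intersection, so two families whose laws agree on them have the same law. *)
Lemma same_law_integral d1 (T1 : measurableType d1) (P1 : probability T1 R)
    d2 (T2 : measurableType d2) (P2 : probability T2 R)
    (Y1 : I -> T1 -> V) (Y2 : I -> T2 -> V) F :
  (forall i, random_vector (Y1 i)) -> (forall i, random_vector (Y2 i)) ->
  (forall S, (forall i, borel_cV (S i)) ->
    P1 ((fun w => Y1^~ w) @^-1` rectangle S) =
    P2 ((fun w => Y2^~ w) @^-1` rectangle S)) ->
  measurable_functional F ->
  (\int[P1]_w (F (Y1^~ w))%:E = \int[P2]_w (F (Y2^~ w))%:E)%E.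
Proof.
move=> r1 r2 law mF.
pose W := g_sigma_algebraType rectangles.
pose X1 : T1 -> W := fun w => Y1^~ w.
pose X2 : T2 -> W := fun w => Y2^~ w.
have mX1 : measurable_fun setT X1.
  apply: (@measurability _ _ _ W setT _ rectangles erefl) => _ [_ [S mS <-] <-].
  by rewrite setTI; exact: measurable_rectangle.
have mX2 : measurable_fun setT X2.
  apply: (@measurability _ _ _ W setT _ rectangles erefl) => _ [_ [S mS <-] <-].
  by rewrite setTI; exact: measurable_rectangle.
have rW (i : I) : random_vector (fun y : W => (y : I -> V) i).
  move=> S mS; apply: sub_sigma_algebra.
  exists (fun k => if k == i then S else setT).
    by move=> k; case: ifP => // _; exact: borel_cV_setT.
  apply/seteqP; split => y /=; first by move/(_ i); rewrite eqxx.
  by move=> Sy k; case: eqP => // ->.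
have mFW : measurable_fun [set: W] (fun y : W => F y).
  by apply: (mF _ W (fun i y => (y : I -> V) i)) => i a; exact: random_vector_entries.
have mP : measurable_fun [set: W] (fun y : W => (F y)%:E) by exact/measurable_EFinP.
have rT : rectangles setT.
  by exists (fun=> setT) => [i|]; [exact: borel_cV_setT|apply/seteqP; split].
have lawE (A : set W) : measurable A -> pushforward P1 X1 A = pushforward P2 X2 A.
  move=> mA.
  apply: (@measure_unique _ R W rectangles (fun=> setT)) => //.
  - exact: rectangles_setI.
  - by rewrite bigcup_const.
  - by move=> _ [S mS <-]; exact: law.
  - move=> k; have : (P1 setT < +oo)%E by rewrite [X in (X < _)%E]probability_setT ltry.
    exact.
have pm (g : W -> \bar R) : measurable_fun [set: W] g -> (forall y, (0 <= g y)%E) ->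
    (\int[P1]_w g (X1 w) = \int[P2]_w g (X2 w))%E.
  move=> mg g0.
  transitivity (\int[pushforward P1 X1]_y g y)%E.
    by rewrite ge0_integral_pushforward.
  transitivity (\int[pushforward P2 X2]_y g y)%E; last first.
    by rewrite ge0_integral_pushforward.
  by apply: eq_measure_integral => A mA _; exact: lawE.
rewrite [LHS]integralE [RHS]integralE; congr (_ - _)%E.
  transitivity (\int[P1]_w ((fun y : W => (F y)%:E)^\+ (X1 w)))%E.
    by apply: eq_integral => w _; rewrite !funeposE.
  rewrite pm//; last exact: measurable_funepos.
  by apply: eq_integral => w _; rewrite !funeposE.
transitivity (\int[P1]_w ((fun y : W => (F y)%:E)^\- (X1 w)))%E.
  by apply: eq_integral => w _; rewrite !funenegE.
rewrite pm//; last exact: measurable_funeneg.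
by apply: eq_integral => w _; rewrite !funenegE.
Qed.

End Configurations.

Section Independence.
Context {R : realType} {I : finType} {p : nat} {d : measure_display}
  {T : measurableType d}.
Local Notation V := 'cV[R]_p.
Variables (P : probability T R) (X : I -> T -> V).
Hypothesis rX : forall i, random_vector (X i).
Hypothesis indX : forall S : I -> set V, (forall i, borel_cV (S i)) ->
  P ((fun w => X^~ w) @^-1` rectangle S) = (\prod_i P (X i @^-1` S i))%E.
Implicit Types (F : (I -> V) -> R) (y : I -> V).

Definition upd y (j : I) (x : V) : I -> V := fun i => if i == j then x else y i.

Let PP := (P \x P)%E.

Let rX1 i : random_vector (fun w : T * T => X i w.1).
Proof.
move=> S mS; rewrite (_ : _ @^-1` _ = (X i @^-1` S) `*` setT).
  by apply: measurableX => //; exact: rX.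
by apply/seteqP; split => -[a b] //= [].
Qed.

Let rX2 i : random_vector (fun w : T * T => X i w.2).
Proof.
move=> S mS; rewrite (_ : _ @^-1` _ = setT `*` (X i @^-1` S)).
  by apply: measurableX => //; exact: rX.
by apply/seteqP; split => -[a b] //= [].
Qed.

(** The copy is the same vector evaluated at the second coordinate of the
    product space; taking [S j = setT] in the independence hypothesis splits off
    the [j]-th factor. *)
Lemma resample_law (j : I) (S : I -> set V) : (forall i, borel_cV (S i)) ->
  P ((fun w => X^~ w) @^-1` rectangle S) =
  PP ((fun w => upd (X^~ w.1) j (X j w.2)) @^-1` rectangle S).
Proof.
move=> mS; pose S' i := if i == j then setT else S i.
have mS' i : borel_cV (S' i) by rewrite /S'; case: ifP => // _; exact: borel_cV_setT.
rewrite (_ : _ @^-1` _ = ((fun w => X^~ w) @^-1` rectangle S') `*` (X j @^-1` S j)).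
  rewrite [RHS]product_measure1E; [|exact: measurable_rectangle|exact: rX].
  rewrite indX// [X in (_ = X * _)%E](indX mS') (bigD1 j)//=.
  rewrite [X in (_ = X * _)%E](bigD1 j)//= /S' eqxx preimage_setT.
  rewrite [X in (_ = X * _ * _)%E]probability_setT mul1e muleC; congr (_ * _)%E.
  by apply: eq_bigr => i /negbTE ->.
apply/seteqP; split => -[a b] /=; rewrite /rectangle /upd /S' /=.
  move=> H; split; last by have := H j; rewrite eqxx.
  by move=> i; have := H i; case: eqP.
by case=> H Hb i; have := H i; case: eqP => // ->.
Qed.

Lemma measurable_upd F j : measurable_functional F ->
  measurable_fun [set: T * T] (fun w => F (upd (X^~ w.1) j (X j w.2))).
Proof.
move=> mF; pose Y i (w : T * T) := if i == j then X j w.2 else X i w.1.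
apply: (mF _ _ Y) => i a; rewrite /Y; case: eqP => _; exact: random_vector_entries.
Qed.

Lemma measurable_on_X F : measurable_functional F ->
  measurable_fun [set: T] (fun w => F (X^~ w)).
Proof. by move=> mF; apply: (mF _ _ X) => i a; exact: random_vector_entries. Qed.

Lemma integral_resample F j : measurable_functional F ->
  (\int[P]_w (F (X^~ w))%:E = \int[PP]_w (F (upd (X^~ w.1) j (X j w.2)))%:E)%E.
Proof.
move=> mF; pose Y i (w : T * T) := if i == j then X j w.2 else X i w.1.
apply: (@same_law_integral _ _ _ _ _ P _ _ PP X Y) => //.
- by move=> i; rewrite /Y; case: eqP => _; [exact: rX2|exact: rX1].
- by move=> S mS; exact: resample_law.
Qed.

(** Fubini after resampling: the inner integral is the conditional expectation
    given all the vectors but the [j]-th one, with these vectors held at an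
    arbitrary deterministic value [y]. *)
Lemma L1_cond F j (K : R) : measurable_functional F -> (forall y, 0 <= F y) ->
  (forall y, L1 P (fun w => F (upd y j (X j w)))) ->
  (forall y, Ex P (fun w => F (upd y j (X j w))) <= K) ->
  L1 P (fun w => F (X^~ w)) /\ Ex P (fun w => F (X^~ w)) <= K.
Proof.
move=> mF F0 I1 EK.
have le : (\int[P]_w (F (X^~ w))%:E <= K%:E)%E.
  rewrite (integral_resample j mF) fubini_tonelli1; last 2 first.
  - by apply/measurable_EFinP; exact: measurable_upd.
  - by move=> w; rewrite lee_fin.
  apply: (@le_trans _ _ (\int[P]_w K%:E)%E); last first.
    by rewrite integral_cst// [X in (_ * X)%E]probability_setT mule1.
  apply: ge0_le_integral => //.
  - by move=> w _; apply: integral_ge0 => z _; rewrite lee_fin.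
  - apply: measurable_fun_fubini_tonelli_F.
      by apply/measurable_EFinP; exact: measurable_upd.
    by move=> w; rewrite lee_fin.
  - by move=> w _; rewrite /fubini_F /= ExE ?lee_fin.
have L : L1 P (fun w => F (X^~ w)).
  apply/integrableP; split; first by apply/measurable_EFinP; exact: measurable_on_X.
  apply: (@le_lt_trans _ _ K%:E); last by rewrite ltry.
  by under eq_integral do rewrite abse_EFin ger0_norm//.
by split => //; rewrite -lee_fin -ExE.
Qed.

(** The signed counterpart of [L1_cond] for conditionally centred functionals. *)
Lemma Ex_cond_eq0 F j : measurable_functional F -> L1 P (fun w => F (X^~ w)) ->
  (forall y, L1 P (fun w => F (upd y j (X j w)))) ->
  (forall y, Ex P (fun w => F (upd y j (X j w))) = 0) ->
  Ex P (fun w => F (X^~ w)) = 0.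
Proof.
move=> mF LF I1 E0.
have mabs : measurable_functional (fun y => `|F y|).
  by move=> d' T' Y mY; apply: measurableT_comp => //; exact: mF.
have LPP : PP.-integrable setT (fun w => (F (upd (X^~ w.1) j (X j w.2)))%:E).
  apply/integrableP; split; first by apply/measurable_EFinP; exact: measurable_upd.
  case/integrableP: LF => _.
  under eq_integral do rewrite abse_EFin.
  by rewrite (integral_resample j mabs).
apply: EFin_inj; rewrite -ExE// (integral_resample j mF) -integral12_prod_meas1//.
transitivity (\int[P]_w (0 : \bar R))%E; last by rewrite integral0.
by apply: eq_integral => w _; rewrite /fubini_F /= ExE// E0.
Qed.

End Independence.

(** * The Efron-Stein inequality *)

Section EfronStein.
Context {R : realType} {n p : nat} {d : measure_display}
  {T : measurableType d}.
Local Notation V := 'cV[R]_p.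
Variables (P : probability T R) (X : 'I_n -> T -> V).
Hypothesis rX : forall i, random_vector (X i).
Hypothesis indX : forall S : 'I_n -> set V, (forall i, borel_cV (S i)) ->
  P ((fun w => X^~ w) @^-1` rectangle S) = (\prod_i P (X i @^-1` S i))%E.
Implicit Types (F : ('I_n -> V) -> R) (y : 'I_n -> V).

Let PP := (P \x P)%E.

Lemma Ex_prod (f g : T -> R) (K : R) : measurable_fun setT f -> measurable_fun setT g ->
  (forall w, `|f w| <= K) -> (forall w, `|g w| <= K) ->
  Ex PP (fun w => f w.1 * g w.2) = Ex P f * Ex P g.
Proof.
move=> mf mg fK gK.
have K0 : 0 <= K.
  have [t _] : [set: T] !=set0.
    apply/set0P/negP => /eqP T0; have := probability_setT P.
    by rewrite T0 measure0 => /eqP; rewrite eqe eq_sym oner_eq0.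
  exact: le_trans (normr_ge0 _) (fK t).
have If := L1_bounded P mf fK; have Ig := L1_bounded P mg gK.
have mfg : measurable_fun [set: T * T] (fun w => f w.1 * g w.2).
  by apply: measurable_funM; apply: measurableT_comp.
have Ifg : L1 PP (fun w => f w.1 * g w.2).
  apply: (@L1_bounded _ _ _ PP _ (K * K)) => // w.
  by rewrite normrM ler_pM.
apply: EFin_inj; rewrite -ExE// -integral12_prod_meas1//.
transitivity (\int[P]_w ((Ex P g) * f w)%:E)%E.
  apply: eq_integral => w _; rewrite /fubini_F /=.
  by rewrite ExE ?ExZ ?(mulrC (f w))//; exact: L1Z.
by rewrite ExE ?ExZ 1?mulrC//; exact: L1Z.
Qed.

Definition copies (i : 'I_n * bool) (w : T * T) : V :=
  if i.2 then X i.1 w.2 else X i.1 w.1.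

Let swap (k : 'I_n) (i : 'I_n * bool) := (i.1, i.2 (+) (i.1 == k)).

Lemma copies_random i : random_vector (copies i).
Proof.
move=> S mS; rewrite /copies; case: i.2.
  rewrite (_ : _ @^-1` _ = setT `*` (X i.1 @^-1` S)).
    by apply: measurableX => //; exact: rX.
  by apply/seteqP; split => -[a b] //= [].
rewrite (_ : _ @^-1` _ = (X i.1 @^-1` S) `*` setT).
  by apply: measurableX => //; exact: rX.
by apply/seteqP; split => -[a b] //= [].
Qed.

Let copies_law (S : 'I_n * bool -> set V) : (forall i, borel_cV (S i)) ->
  PP ((fun w => copies^~ w) @^-1` rectangle S) =
  ((\prod_i P (X i @^-1` S (i, false))) * (\prod_i P (X i @^-1` S (i, true))))%E.
Proof.
move=> mS.
rewrite (_ : _ @^-1` _ =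
   ((fun w => X^~ w) @^-1` rectangle (fun i => S (i, false))) `*`
   ((fun w => X^~ w) @^-1` rectangle (fun i => S (i, true)))); last first.
  apply/seteqP; split => -[a b] /=; rewrite /rectangle /copies /=.
    by move=> H; split => i; [exact: (H (i, false))|exact: (H (i, true))].
  by move=> [H1 H2] [i []] /=.
rewrite [LHS]product_measure1E; [|exact: measurable_rectangle|exact: measurable_rectangle].
congr (_ * _)%E; exact: indX.
Qed.

Lemma swap_law (k : 'I_n) (S : 'I_n * bool -> set V) : (forall i, borel_cV (S i)) ->
  PP ((fun w => copies^~ w) @^-1` rectangle S) =
  PP ((fun w => (fun i => copies (swap k i) w)) @^-1` rectangle S).
Proof.
move=> mS.
rewrite (_ : (fun w => (fun i => copies (swap k i) w)) @^-1` rectangle S =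
   (fun w => copies^~ w) @^-1` rectangle (fun i => S (swap k i))); last first.
  apply/seteqP; split => w /= H i.
    by have := H (swap k i); rewrite /swap /= addbK; case: i.
  by have := H (swap k i); rewrite /swap /= addbK; case: i.
rewrite !copies_law// (bigD1 k)//= [X in (_ * X)%E](bigD1 k)//=.
rewrite [X in (_ = X * _)%E](bigD1 k)//= [X in (_ = _ * X)%E](bigD1 k)//=.
rewrite /swap /= eqxx /=.
under [in RHS]eq_bigr => i /negbTE -> do rewrite /=.
under [X in (_ = _ * (_ * X))%E]eq_bigr => i /negbTE -> do rewrite /=.
rewrite muleACA [RHS]muleACA; congr (_ * _)%E; exact: muleC.
Qed.

Lemma Ex_swap (k : 'I_n) (G : ('I_n * bool -> V) -> R) : measurable_functional G ->
  Ex PP (fun w => G (copies^~ w)) = Ex PP (fun w => G (fun i => copies (swap k i) w)).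
Proof.
move=> mG; congr fine.
apply: (@same_law_integral _ _ _ _ _ PP _ _ PP copies (fun i => copies (swap k i))) => //.
- exact: copies_random.
- by move=> i; exact: copies_random.
- by move=> S mS; exact: swap_law.
Qed.

Let hyb (k : nat) (z : 'I_n * bool -> V) : 'I_n -> V := fun i => z (i, (i < k)%N).

Let measurable_hyb F (h : 'I_n -> bool) : measurable_functional F ->
  measurable_functional (fun z : 'I_n * bool -> V => F (fun i => z (i, h i))).
Proof.
move=> mF d' T' Y mY; exact: (mF _ _ (fun i => Y (i, h i)) (fun i a => mY (i, h i) a)).
Qed.

(** With [F_k] the functional in which the first [k] vectors are replaced by
    their independent copies, the variance is the sum over [k] of the means of
    [F_0 (F_k - F_(k+1))].  Exchanging the [k]-th vector with its copy exchanges
    [F_k] and [F_(k+1)], so each mean is half that of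
    [(F_0 - F_0 after the exchange) (F_k - F_(k+1))], a product of two increments
    in which a single vector is changed, each at most [2 c]. *)
Lemma efron_stein F (K c : R) : measurable_functional F ->
  (forall y, `|F y| <= K) -> (forall y k, `|F y - F (upd y k 0)| <= c) ->
  Ex P (fun w => (F (X^~ w) - Ex P (fun w => F (X^~ w))) ^+ 2) <= 2 * n%:R * c ^+ 2.
Proof.
move=> mF FK Fc.
have K0 : 0 <= K by exact: le_trans (normr_ge0 _) (FK (fun=> 0)).
pose f w := F (X^~ w); pose m := Ex P f.
rewrite -[Ex P (fun w => F (X^~ w))]/m.
have mf : measurable_fun setT f by exact: measurable_on_X.
have If : L1 P f by apply: (L1_bounded _ mf (K := K)) => w; exact: FK.
have If2 : L1 P (fun w => f w ^+ 2).
  apply: (@L1_bounded _ _ _ _ _ (K ^+ 2)); first exact: measurable_funX.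
  by move=> w; rewrite normrX lerXn2r ?nnegrE//; exact: FK.
have varE : Ex P (fun w => (f w - m) ^+ 2) = Ex P (fun w => f w ^+ 2) - m * m.
  under eq_Ex do rewrite sqrrB -mulr_natl.
  rewrite ExD; [|apply: L1B => //; apply: L1Z|exact: L1_cst]; last first.
    by under eq_fun do rewrite mulrC; exact: L1Z.
  have Im : L1 P (fun w => 2 * (f w * m)).
    by apply: L1Z; under eq_fun do rewrite mulrC; exact: L1Z.
  rewrite ExB// Ex_cst ExZ; last by under eq_fun do rewrite mulrC; exact: L1Z.
  under [X in 2 * X]eq_Ex do rewrite mulrC.
  have mE : Ex P f = m by [].
  by rewrite ExZ// mE; ring.
rewrite varE.
(* The boolean selects the copy: [hyb k] uses the copies of the first [k]
   vectors. *)
pose g k (z : 'I_n * bool -> V) := F (hyb 0 z) * (F (hyb k z) - F (hyb k.+1 z)).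
have mg k : measurable_functional (g k).
  move=> d' T' Y mY; apply: measurable_funM; first exact: (measurable_hyb _ mF).
  by apply: measurable_funB; exact: (measurable_hyb _ mF).
have mcop : entries_measurable copies.
  by move=> i a; apply: random_vector_entries; exact: copies_random.
have Bg (z1 z2 z3 : 'I_n -> V) : `|F z1 * (F z2 - F z3)| <= K * (K + K).
  by rewrite normrM ler_pM// (le_trans (ler_normB _ _))// lerD.
have Ig k : L1 PP (fun w => g k (copies^~ w)).
  by apply: L1_bounded; [exact: mg|move=> w; exact: Bg].
have telescope z : \sum_(k < n) g k z = F (hyb 0 z) * (F (hyb 0 z) - F (hyb n z)).
  rewrite -mulr_sumr; congr (_ * _).
  rewrite -(big_mkord xpredT (fun k => F (hyb k z) - F (hyb k.+1 z))).
  by rewrite (@telescope_sumr_eq _ 0 n (fun k => - F (hyb k z))) ?opprK 1?addrC// => k _; rewrite opprK addrC.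
have sumE : Ex P (fun w => f w ^+ 2) - m * m =
    \sum_(k < n) Ex PP (fun w => g k (copies^~ w)).
  rewrite -Ex_sum//.
  rewrite (@eq_Ex _ _ _ PP _ (fun w => f w.1 ^+ 2 * 1 - f w.1 * f w.2)); last first.
    move=> w; have /= -> := telescope (copies^~ w).
    rewrite mulr1 mulrBr -expr2 /f /hyb /copies /=.
    congr (_ - _ * F _); apply/funext => i /=.
    by rewrite ltn_ord.
  have KK : K <= K + K ^+ 2 by rewrite lerDl sqr_ge0.
  have fKK w : `|f w| <= K + K ^+ 2 by exact: le_trans (FK _) KK.
  have f2KK w : `|f w ^+ 2| <= K + K ^+ 2 + 1.
    have h1 : `|f w ^+ 2| <= K ^+ 2 by rewrite normrX lerXn2r ?nnegrE//; exact: FK.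
    by apply: (le_trans h1); have := sqr_ge0 K; lra.
  have mf2 : measurable_fun setT (fun w => f w ^+ 2) by exact: measurable_funX.
  rewrite ExB.
  - rewrite (@Ex_prod (fun w => f w ^+ 2) (fun=> 1) (K + K ^+ 2 + 1)) ?Ex_cst ?mulr1//.
      by rewrite (Ex_prod mf mf fKK fKK).
    by move=> w; rewrite normr1 lerDr addr_ge0// sqr_ge0.
  - apply: (@L1_bounded _ _ _ PP _ (K + K ^+ 2 + 1)) => [|w].
      by apply: measurable_funM => //; exact: (measurableT_comp mf2).
    by rewrite mulr1.
  - apply: (@L1_bounded _ _ _ PP _ (K * K)) => [|w].
      by apply: measurable_funM; exact: (measurableT_comp mf).
    by rewrite normrM ler_pM//; exact: FK.
rewrite sumE.
have upd_near (k : 'I_n) y1 y2 : (forall i, i != k -> y1 i = y2 i) ->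
    `|F y1 - F y2| <= 2 * c.
  move=> y12.
  have -> : F y1 - F y2 = (F y1 - F (upd y1 k 0)) - (F y2 - F (upd y1 k 0)) by ring.
  apply: (le_trans (ler_normB _ _)).
  have e : upd y1 k 0 = upd y2 k 0.
    by apply/funext => i; rewrite /upd; case: ifPn => // /y12.
  have := Fc y1 k; have := Fc y2 k; rewrite -e; lra.
suff H (k : 'I_n) : Ex PP (fun w => g k (copies^~ w)) <= 2 * c ^+ 2.
  apply: (@le_trans _ _ (\sum_(k < n) 2 * c ^+ 2)); first exact: ler_sum.
  by rewrite sumr_const card_ord -mulr_natl; lra.
have k_n := ltn_ord k.
have E2 : 2 * Ex PP (fun w => g k (copies^~ w)) <= 4 * c ^+ 2.
  rewrite mulr_natl mulr2n {2}(Ex_swap k (mg k)) -ExD//; last first.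
    apply: (@L1_bounded _ _ _ PP _ (K * (K + K))) => [|w]; last exact: Bg.
    exact: (mg k _ _ (fun i => copies (swap k i)) (fun i a => mcop (swap k i) a)).
  apply: (@le_trans _ _ (Ex PP (fun=> 4 * c ^+ 2))); last by rewrite Ex_cst.
  apply: le_Ex => //.
  - apply: L1D => //.
    apply: (@L1_bounded _ _ _ PP _ (K * (K + K))) => [|w]; last exact: Bg.
    exact: (mg k _ _ (fun i => copies (swap k i)) (fun i a => mcop (swap k i) a)).
  - exact: L1_cst.
  move=> w; rewrite /g; set z := copies^~ w; set z' := (fun i => _).
  have ltS (i : 'I_n) : (i < k.+1)%N = (i == k :> nat) || (i < k)%N.
    by rewrite ltnS leq_eqVlt.
  have h1 : hyb k z' = hyb k.+1 z.
    apply/funext => i; rewrite /hyb /z' /z /swap /=; congr (copies (i, _) w).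
    by rewrite (ltS i) -val_eqE /=; case: ltngtP.
  have h2 : hyb k.+1 z' = hyb k z.
    apply/funext => i; rewrite /hyb /z' /z /swap /=; congr (copies (i, _) w).
    by rewrite (ltS i) -val_eqE /=; case: ltngtP.
  rewrite h1 h2.
  have -> : F (hyb 0 z) * (F (hyb k z) - F (hyb k.+1 z)) +
     F (hyb 0 z') * (F (hyb k.+1 z) - F (hyb k z)) =
     (F (hyb 0 z) - F (hyb 0 z')) * (F (hyb k z) - F (hyb k.+1 z)) by ring.
  apply: (le_trans (ler_norm _)); rewrite normrM.
  have -> : 4 * c ^+ 2 = (2 * c) * (2 * c) by ring.
  apply: ler_pM => //; apply: (upd_near k) => i ik; rewrite /hyb /z /z' /swap /=.
    by rewrite (negbTE ik).
  by congr (copies (i, _) w); rewrite ltnS [RHS]leq_eqVlt (negbTE (ik : i != k :> nat)).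
by lra.
Qed.

End EfronStein.

(** * Euclidean vectors and operator bounds *)

Section Euclid.
Context {R : realType} {p : nat}.
Local Notation V := 'cV[R]_p.
Local Notation M := 'M[R]_p.
Implicit Types (u v w x : V) (N H : M).

Definition dot u w : R := (u^T *m w) 0 0.

Lemma dotE u w : dot u w = \sum_i u i 0 * w i 0.
Proof. by rewrite /dot mxE; apply: eq_bigr => i _; rewrite mxE. Qed.

Lemma dotC u w : dot u w = dot w u.
Proof. by rewrite !dotE; apply: eq_bigr => i _; rewrite mulrC. Qed.

Lemma dotDr u v w : dot u (v + w) = dot u v + dot u w.
Proof. by rewrite /dot mulmxDr mxE. Qed.

Lemma dotZr a u w : dot u (a *: w) = a * dot u w.
Proof. by rewrite /dot -scalemxAr mxE. Qed.

Lemma dotNr u w : dot u (- w) = - dot u w.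
Proof. by rewrite -scaleN1r dotZr mulN1r. Qed.

Lemma dotBr u v w : dot u (v - w) = dot u v - dot u w.
Proof. by rewrite dotDr dotNr. Qed.

Lemma dot0r u : dot u 0 = 0.
Proof. by rewrite /dot mulmx0 mxE. Qed.

Lemma dotDl u v w : dot (u + v) w = dot u w + dot v w.
Proof. by rewrite ![dot _ w]dotC dotDr. Qed.

Lemma dotZl a u w : dot (a *: u) w = a * dot u w.
Proof. by rewrite ![dot _ w]dotC dotZr. Qed.

Lemma dotBl u v w : dot (u - v) w = dot u w - dot v w.
Proof. by rewrite ![dot _ w]dotC dotBr. Qed.

Lemma dot_sumr (I : Type) (s : seq I) (Q : pred I) u (f : I -> V) :
  dot u (\sum_(i <- s | Q i) f i) = \sum_(i <- s | Q i) dot u (f i).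
Proof. by rewrite /dot mulmx_sumr summxE. Qed.

Lemma dot_mulmx N u w : dot u (N *m w) = dot (N^T *m u) w.
Proof. by rewrite /dot trmx_mul trmxK mulmxA. Qed.

Lemma dot_sym N u w : N^T = N -> dot u (N *m w) = dot (N *m u) w.
Proof. by move=> Ns; rewrite dot_mulmx Ns. Qed.

Lemma quadE N u : quad N u = dot u (N *m u).
Proof. by rewrite /quad /dot mulmxA. Qed.

Lemma dotuu_ge0 u : 0 <= dot u u.
Proof. by rewrite dotE sumr_ge0// => i _; rewrite -expr2 sqr_ge0. Qed.

Lemma dotuu_eq0 u : dot u u <= 0 -> u = 0.
Proof.
move=> h; have /eqP : dot u u = 0 by apply/le_anti; rewrite h dotuu_ge0.
rewrite dotE psumr_eq0; last by move=> i _; rewrite -expr2 sqr_ge0.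
move/allP => H; apply/matrixP => i j; rewrite ord1 mxE.
by have := H i (mem_index_enum i); rewrite /= -expr2 sqrf_eq0 => /eqP.
Qed.

Lemma l2norm_ge0 u : 0 <= l2norm u.
Proof. exact: sqrtr_ge0. Qed.

Lemma l2norm_sqr u : l2norm u ^+ 2 = dot u u.
Proof.
rewrite /l2norm sqr_sqrtr; last by rewrite sumr_ge0// => i _; rewrite sqr_ge0.
by rewrite dotE; apply: eq_bigr => i _; rewrite expr2.
Qed.

Lemma l2norm0 : l2norm (0 : V) = 0.
Proof. by apply/eqP; rewrite -sqrf_eq0 l2norm_sqr dot0r. Qed.

Lemma dot_le u w : `|dot u w| <= l2norm u * l2norm w.
Proof.
rewrite -ler_sqr ?nnegrE ?mulr_ge0 ?l2norm_ge0// exprMn !l2norm_sqr.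
rewrite real_normK ?num_real//.
set a := dot u u; set b := dot w w; set c := dot u w.
have h (k : R) : 0 <= a - 2 * k * c + k ^+ 2 * b.
  have := dotuu_ge0 (u - k *: w).
  by rewrite dotBl !dotBr !dotZl !dotZr (dotC w u) -/a -/b -/c; lra.
have b0 : 0 <= b by exact: dotuu_ge0.
have [b_eq0|bN0] := eqVneq b 0.
  have w0 : w = 0 by apply: dotuu_eq0; rewrite -/b b_eq0.
  by rewrite /c w0 dot0r expr0n/= b_eq0 mulr0.
have := h (c / b).
have -> : a - 2 * (c / b) * c + (c / b) ^+ 2 * b = (a * b - c ^+ 2) / b by field.
rewrite pmulr_lge0 ?invr_gt0 ?lt_neqAle ?b0 1?eq_sym ?bN0//.
by rewrite subr_ge0.
Qed.

Lemma l2normZ a u : l2norm (a *: u) = `|a| * l2norm u.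
Proof.
apply/eqP; rewrite -(@eqrXn2 _ 2) ?mulr_ge0 ?l2norm_ge0//.
by rewrite exprMn !l2norm_sqr dotZl dotZr real_normK ?num_real// mulrA expr2.
Qed.

Lemma l2normD u w : l2norm (u + w) <= l2norm u + l2norm w.
Proof.
rewrite -ler_sqr ?nnegrE ?addr_ge0 ?l2norm_ge0// sqrrD !l2norm_sqr.
rewrite dotDl !dotDr (dotC w u).
have := le_trans (ler_norm _) (dot_le u w); lra.
Qed.

Lemma l2norm_le (c : R) u : 0 <= c -> dot u u <= c * l2norm u -> l2norm u <= c.
Proof.
move=> c0; rewrite -l2norm_sqr expr2.
have := l2norm_ge0 u; rewrite le_eqVlt => /predU1P[<-//|u0].
by rewrite ler_pM2r.
Qed.

Definition op_bound N (c : R) := forall u, l2norm (N *m u) <= c * l2norm u.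

Lemma op_boundM N1 N2 c1 c2 : 0 <= c1 -> op_bound N1 c1 -> op_bound N2 c2 ->
  op_bound (N1 *m N2) (c1 * c2).
Proof.
move=> c0 h1 h2 u; rewrite -mulmxA (le_trans (h1 _))// -mulrA.
by rewrite ler_wpM2l.
Qed.

Lemma op_boundD N1 N2 c1 c2 : op_bound N1 c1 -> op_bound N2 c2 ->
  op_bound (N1 + N2) (c1 + c2).
Proof.
by move=> h1 h2 u; rewrite mulmxDl (le_trans (l2normD _ _))// mulrDl lerD.
Qed.

Lemma op_boundZ N c a : op_bound N c -> op_bound (a *: N) (`|a| * c).
Proof.
by move=> h u; rewrite -scalemxAl l2normZ -mulrA ler_wpM2l.
Qed.

Lemma op_bound_dot N c u w : op_bound N c ->
  `|dot u (N *m w)| <= c * (l2norm u * l2norm w).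
Proof.
move=> h; rewrite (le_trans (dot_le _ _))// mulrCA ler_wpM2l ?l2norm_ge0//.
Qed.

Lemma op_bound_dot_le N c u w a b : 0 <= c -> op_bound N c ->
  l2norm u <= a -> l2norm w <= b -> `|dot u (N *m w)| <= c * (a * b).
Proof.
move=> c0 h ua wb; rewrite (le_trans (op_bound_dot _ _ h))// ler_wpM2l//.
by rewrite ler_pM ?l2norm_ge0.
Qed.

(** The supremum defining [opnorm] is finite: decompose a matrix into its
    columns. *)
Lemma op_bound_sup N : exists2 c : R, 0 <= c & op_bound N c.
Proof.
have h j : op_bound (\matrix_(a, b) (N a b *+ (b == j))) (l2norm (col j N)).
  move=> u.
  have -> : (\matrix_(a, b) (N a b *+ (b == j))) *m u = u j 0 *: col j N.
    apply/matrixP => a b; rewrite ord1 !mxE (bigD1 j)//= mxE eqxx mulr1n big1 ?addr0 1?mulrC//.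
    by move=> i /negbTE ij; rewrite mxE ij mulr0n mul0r.
  rewrite l2normZ mulrC ler_wpM2l ?l2norm_ge0//.
  rewrite -ler_sqr ?nnegrE ?l2norm_ge0// l2norm_sqr real_normK ?num_real//.
  by rewrite dotE (bigD1 j)//= -expr2 lerDl sumr_ge0// => i _; rewrite -expr2 sqr_ge0.
exists (\sum_j l2norm (col j N)); first by rewrite sumr_ge0// => j _; exact: l2norm_ge0.
have E : N = \sum_j \matrix_(a, b) (N a b *+ (b == j)).
  apply/matrixP => a b; rewrite summxE (bigD1 b)//= mxE eqxx mulr1n big1 ?addr0//.
  by move=> i ib; rewrite mxE eq_sym (negbTE ib) mulr0n.
rewrite {1}E; apply: (big_ind2 op_bound) => //; last first.
  by move=> N1 c1 N2 c2; exact: op_boundD.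
by move=> u; rewrite mul0mx l2norm0 mul0r.
Qed.

Lemma opnorm_has_sup N :
  has_sup [set l2norm (N *m u) | u in [set u : V | l2norm u <= 1]].
Proof.
split; first by exists (l2norm (N *m 0)), 0 => //=; rewrite l2norm0.
have [c c0 h] := op_bound_sup N; exists c => _ [u /= u1 <-].
by rewrite (le_trans (h u))// ler_piMr.
Qed.

Lemma opnorm_ge0 N : 0 <= opnorm N.
Proof.
have -> : 0 = l2norm (N *m 0) by rewrite mulmx0 l2norm0.
apply: (ub_le_sup (opnorm_has_sup N).2); exists 0 => //=.
by rewrite l2norm0.
Qed.

Lemma op_bound_opnorm N : op_bound N (opnorm N).
Proof.
move=> u; have := l2norm_ge0 u; rewrite le_eqVlt => /predU1P[u0|u0].
  have -> : u = 0 by apply: dotuu_eq0; rewrite -l2norm_sqr -u0 expr0n.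
  by rewrite mulmx0 l2norm0 mulr0.
rewrite -ler_pdivrMr//.
have -> : l2norm (N *m u) / l2norm u = l2norm (N *m ((l2norm u)^-1 *: u)).
  by rewrite -scalemxAr l2normZ ger0_norm ?invr_ge0 ?ltW// mulrC.
apply: (ub_le_sup (opnorm_has_sup N).2); exists ((l2norm u)^-1 *: u) => //=.
by rewrite l2normZ ger0_norm ?invr_ge0 ?(ltW u0)// mulVf// gt_eqF.
Qed.

Lemma rank1_mul x u : (x *m x^T) *m u = dot x u *: x.
Proof.
apply/matrixP => i j; rewrite -mulmxA ord1 mxE big_ord1 -/(dot x u).
by rewrite [RHS]mxE mulrC.
Qed.

Lemma mulmx_ext N1 N2 : (forall u, N1 *m u = N2 *m u) -> N1 = N2.
Proof.
move=> e; apply/matrixP => i j.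
by have := congr1 (fun z : V => z i 0) (e (delta_mx j 0)); rewrite -!colE !mxE.
Qed.

Lemma mxtrace_rank1 N u w : \tr (N *m (u *m w^T)) = dot w (N *m u).
Proof. by rewrite mulmxA mxtrace_mulC /mxtrace big_ord1. Qed.

Lemma mxtrace_le N c : op_bound N c -> 0 <= c -> `|\tr N| <= p%:R * c.
Proof.
move=> h c0; rewrite /mxtrace (le_trans (ler_norm_sum _ _ _))//.
apply: (@le_trans _ _ (\sum_(i < p) c)); last first.
  by rewrite sumr_const card_ord mulr_natl.
apply: ler_sum => i _; have := op_bound_dot (delta_mx i 0) (delta_mx i 0) h.
have e1 : l2norm (delta_mx i 0 : V) = 1.
  apply/eqP; rewrite -(@eqrXn2 _ 2) ?l2norm_ge0// l2norm_sqr dotE (bigD1 i)//=.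
  rewrite mxE !eqxx mulr1 big1 ?addr0 ?expr1n// => j ji.
  by rewrite mxE (negbTE ji) mulr0.
rewrite e1 !mulr1; congr (`|_| <= _).
rewrite /dot trmx_delta -rowE -colE.
by rewrite !mxE.
Qed.

Definition pos_ge (t : R) H := H^T = H /\ forall u, t * dot u u <= dot u (H *m u).

Section PosGe.
Variables (t : R) (H : M).
Hypotheses (t0 : 0 < t) (Ht : pos_ge t H).

Lemma pos_ge_unit : H \in unitmx.
Proof.
case: Ht => Hs Hp; rewrite -row_free_unit -kermx_eq0; apply/eqP/row_matrixP => i.
rewrite row0; set k := row i _.
have kH : k *m H = 0 by apply/sub_kermxP; exact: row_sub.
have : k^T = 0.
  apply: dotuu_eq0; have := Hp k^T.
  have -> : H *m k^T = 0 by rewrite -[H in LHS]Hs -trmx_mul kH trmx0.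
  by rewrite dot0r pmulr_rle0.
by move=> /(congr1 trmx); rewrite trmxK trmx0.
Qed.

Lemma pos_ge_inv_sym : (invmx H)^T = invmx H.
Proof. by rewrite trmx_inv Ht.1. Qed.

Lemma pos_ge_mulV : H *m invmx H = 1%:M. Proof. exact: mulmxV pos_ge_unit. Qed.
Lemma pos_ge_mulK : invmx H *m H = 1%:M. Proof. exact: mulVmx pos_ge_unit. Qed.

(** With [y] the image of [x] by the inverse, this is [t |y|^2 <= y^T H y]. It is
    the source of all the resolvent bounds. *)
Lemma pos_ge_inv_quad x : t * dot (invmx H *m x) (invmx H *m x) <= dot x (invmx H *m x).
Proof.
apply: (le_trans (Ht.2 _)); rewrite (mulmxA H) pos_ge_mulV mul1mx.
by rewrite (dotC _ x).
Qed.

Lemma pos_ge_inv_ge0 x : 0 <= dot x (invmx H *m x).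
Proof.
by apply: le_trans (pos_ge_inv_quad x); rewrite mulr_ge0 ?dotuu_ge0// ltW.
Qed.

Lemma pos_ge_inv_bound : op_bound (invmx H) t^-1.
Proof.
move=> x; apply: l2norm_le; first by rewrite mulr_ge0 ?l2norm_ge0// invr_ge0 ltW.
have h := le_trans (pos_ge_inv_quad x) (le_trans (ler_norm _) (dot_le _ _)).
by rewrite -mulrA ler_pdivlMl.
Qed.

End PosGe.
End Euclid.

(** * Rank-one perturbations of a resolvent *)

Section RankOne.
Context {R : realType} {p : nat}.
Local Notation V := 'cV[R]_p.
Local Notation M := 'M[R]_p.
Variables (t : R) (H0 : M) (al : R) (x : V).
Hypotheses (t0 : 0 < t) (Ht : pos_ge t H0) (al0 : 0 <= al).
Implicit Types (u h w : V).

Definition rank1_upd : M := H0 + al *: (x *m x^T).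
Let H := rank1_upd.
Let M0 := invmx H0.
Let M1 := invmx H.
Let q := dot x (M0 *m x).
Let d := (1 + al * q)^-1.

Lemma rank1_pos : pos_ge t H.
Proof.
split.
  by rewrite /H /rank1_upd linearD /= linearZ /= trmx_mul trmxK Ht.1.
move=> u; rewrite /H /rank1_upd mulmxDl dotDr -scalemxAl rank1_mul !dotZr.
by rewrite (dotC u x) ler_wpDr ?Ht.2// mulr_ge0// -expr2 sqr_ge0.
Qed.

Lemma rank1_q_ge0 : 0 <= q. Proof. exact: pos_ge_inv_ge0 t0 Ht x. Qed.

Lemma rank1_den_gt0 : 0 < 1 + al * q.
Proof. by rewrite ltr_wpDr// mulr_ge0// rank1_q_ge0. Qed.

Lemma rank1_d_ge0 : 0 <= d.
Proof. by rewrite invr_ge0 ltW// rank1_den_gt0. Qed.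

Lemma rank1_alqd_le1 : al * d * q <= 1.
Proof. by rewrite mulrAC /d ler_pdivrMr ?rank1_den_gt0// mul1r lerDr. Qed.

(** The two bounds [|M0 x|^2 <= q / t] and [al d q <= 1] combine so that a
    rank-one correction is bounded independently of the size of [x]. *)
Lemma rank1_w_le : dot (M0 *m x) (M0 *m x) <= q / t.
Proof. by rewrite ler_pdivlMr// mulrC; exact: pos_ge_inv_quad. Qed.

Lemma rank1_invx : M1 *m x = d *: (M0 *m x).
Proof.
have e : H *m (M0 *m x) = (1 + al * q) *: x.
  rewrite /H /rank1_upd mulmxDl mulmxA (pos_ge_mulV t0 Ht) mul1mx.
  by rewrite -scalemxAl rank1_mul scalerA scalerDl scale1r.
have : M1 *m (H *m (M0 *m x)) = M1 *m ((1 + al * q) *: x) by rewrite e.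
rewrite mulmxA (pos_ge_mulK t0 rank1_pos) mul1mx -scalemxAr => ->.
by rewrite scalerA mulVf ?scale1r// gt_eqF// rank1_den_gt0.
Qed.

(** The Sherman-Morrison formula, applied to a vector. *)
Lemma rank1_inv u : M1 *m u = M0 *m u - (al * d * dot x (M0 *m u)) *: (M0 *m x).
Proof.
have e : M0 *m u = M1 *m (H *m (M0 *m u)).
  by rewrite [RHS]mulmxA (pos_ge_mulK t0 rank1_pos) mul1mx.
rewrite [X in _ = X - _]e {1}/H /rank1_upd mulmxDl (mulmxA H0) (pos_ge_mulV t0 Ht) mul1mx.
rewrite mulmxDr -[al *: (x *m x^T) *m _]scalemxAl rank1_mul -!scalemxAr rank1_invx.
rewrite -/M0 -/M1 !scalerA -addrA -[LHS]addr0; congr (_ + _).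
by rewrite -scalerBl (_ : _ - _ = 0) ?scale0r//; ring.
Qed.

Lemma rank1_dot_inv u h : dot u (M1 *m h) - dot u (M0 *m h) =
  - (al * d) * (dot (M0 *m u) x * dot x (M0 *m h)).
Proof.
rewrite rank1_inv dotBr dotZr (dot_sym u x (pos_ge_inv_sym Ht)) -/M0; ring.
Qed.

Variables (B : M) (b : R).
Hypotheses (Bpsd : psd B) (b0 : 0 <= b) (Bb : op_bound B b).
Let N0 := M0 *m B *m M0.
Let N1 := M1 *m B *m M1.
Let lam := dot x (N0 *m x).

Lemma rank1_lamE : lam = dot (M0 *m x) (B *m (M0 *m x)).
Proof. by rewrite /lam /N0 -!mulmxA (dot_sym x _ (pos_ge_inv_sym Ht)). Qed.

Lemma rank1_lam_ge0 : 0 <= lam.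
Proof. by rewrite rank1_lamE -quadE; exact: Bpsd.2. Qed.

Lemma rank1_lam_le : lam <= b / t * q.
Proof.
rewrite rank1_lamE; apply: (le_trans (ler_norm _)).
apply: (le_trans (op_bound_dot _ _ Bb)); rewrite -expr2 l2norm_sqr mulrAC -mulrA.
by rewrite ler_wpM2l// rank1_w_le.
Qed.

Lemma rank1_allamd : al * d * lam <= b / t.
Proof.
have h := ler_wpM2l (mulr_ge0 al0 rank1_d_ge0) rank1_lam_le.
apply: (le_trans h); rewrite mulrCA ler_piMr ?rank1_alqd_le1//.
by rewrite divr_ge0// ltW.
Qed.

Lemma rank1_Lx : N1 *m x = d *: (N0 *m x) - (al * d ^+ 2 * lam) *: (M0 *m x).
Proof.
rewrite /N1 -!mulmxA rank1_invx -!scalemxAr rank1_inv scalerBr scalerA.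
congr (_ - _ *: _).
rewrite /lam /N0 -!mulmxA; ring.
Qed.

Lemma rank1_dot_L u h : dot u (N1 *m h) - dot u (N0 *m h) =
  - (al * d) * (dot (M0 *m u) x * dot x (N0 *m h) + dot (N0 *m u) x * dot x (M0 *m h))
  + (al * d) * (al * d * lam) * (dot (M0 *m u) x * dot x (M0 *m h)).
Proof.
have M0s := pos_ge_inv_sym Ht; rewrite -/M0 in M0s.
have N0s : N0^T = N0 by rewrite /N0 !trmx_mul M0s Bpsd.1 mulmxA.
have z (v : V) : dot v (M0 *m (B *m (M1 *m h))) =
    dot v (N0 *m h) - al * d * dot x (M0 *m h) * dot v (N0 *m x).
  by rewrite rank1_inv !(mulmxBr, dotBr) -!scalemxAr dotZr /N0 -!mulmxA.
have := rank1_dot_inv u (B *m (M1 *m h)).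
rewrite !z => e.
have -> : N1 *m h = M1 *m (B *m (M1 *m h)) by rewrite /N1 -!mulmxA.
rewrite -(dot_sym u x N0s); move/eqP: e; rewrite subr_eq => /eqP ->.
rewrite -/lam; ring.
Qed.

Variables (Sg : M) (sg : R).
Hypotheses (Sgpsd : psd Sg) (sg0 : 0 <= sg) (Sgb : op_bound Sg sg).

Lemma rank1_invE : M1 = M0 - (al * d) *: ((M0 *m x) *m (M0 *m x)^T).
Proof.
have M0s := pos_ge_inv_sym Ht; rewrite -/M0 in M0s.
apply: mulmx_ext => u; rewrite rank1_inv mulmxBl -scalemxAl rank1_mul scalerA.
by rewrite (dot_sym x u M0s).
Qed.

Lemma rank1_tr N : \tr (N *m M1) = \tr (N *m M0) - al * d * dot (M0 *m x) (N *m (M0 *m x)).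
Proof.
by rewrite rank1_invE mulmxBr -scalemxAr linearB linearZ /= mxtrace_rank1.
Qed.

(** Only one rank-one term separates the two traces, hence a bound free of the
    dimension. *)
Lemma rank1_tau : 0 <= \tr (Sg *m M0) - \tr (Sg *m M1) <= sg / t.
Proof.
rewrite rank1_tr opprB addrCA subrr addr0.
have w0 : 0 <= dot (M0 *m x) (Sg *m (M0 *m x)) by rewrite -quadE; exact: Sgpsd.2.
rewrite mulr_ge0 ?mulr_ge0 ?rank1_d_ge0//=.
have h : dot (M0 *m x) (Sg *m (M0 *m x)) <= sg / t * q.
  apply: (le_trans (ler_norm _)); apply: (le_trans (op_bound_dot _ _ Sgb)).
  by rewrite -expr2 l2norm_sqr mulrAC -mulrA ler_wpM2l// rank1_w_le.
apply: (le_trans (ler_wpM2l (mulr_ge0 al0 rank1_d_ge0) h)).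
by rewrite mulrCA ler_piMr ?rank1_alqd_le1// divr_ge0// ltW.
Qed.

(** Expanding both resolvents by Sherman-Morrison leaves three rank-one terms,
    each at most [b sg / t^2]. *)
Lemma rank1_eta :
  `|\tr (Sg *m M1 *m B *m M1) - \tr (Sg *m M0 *m B *m M0)| <= 3 * (b * sg / t ^+ 2).
Proof.
have M0s := pos_ge_inv_sym Ht; rewrite -/M0 in M0s.
set w := M0 *m x.
have e1 : \tr (Sg *m M1 *m B *m M1) =
    \tr (M0 *m Sg *m M1 *m B) - al * d * dot w (Sg *m M1 *m B *m w).
  by rewrite rank1_tr mxtrace_mulC !mulmxA.
have e2 : \tr (M0 *m Sg *m M1 *m B) = \tr (Sg *m M0 *m B *m M0) -
    al * d * dot w (B *m M0 *m Sg *m w).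
  rewrite mxtrace_mulC !mulmxA rank1_tr; congr (_ - _); last by rewrite !mulmxA.
  by rewrite -(mulmxA (B *m M0)) mxtrace_mulC !mulmxA.
have e3 : dot w (Sg *m M1 *m B *m w) = dot w (Sg *m M0 *m B *m w) -
    al * d * (dot w (Sg *m w) * lam).
  rewrite -!mulmxA rank1_inv mulmxBr dotBr -!scalemxAr dotZr; congr (_ - _).
  by rewrite /lam /N0 -/w -!mulmxA -/w; ring.
have kd0 : 0 <= al * d by rewrite mulr_ge0// rank1_d_ge0.
have ww : l2norm w * l2norm w <= q / t by rewrite -expr2 l2norm_sqr rank1_w_le.
have bst : 0 <= b * sg / t ^+ 2 by apply: divr_ge0; [exact: mulr_ge0|exact: sqr_ge0].
have M0b : op_bound M0 t^-1 := pos_ge_inv_bound t0 Ht.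
have ti : 0 <= t^-1 by rewrite invr_ge0 ltW.
have bound (N : M) : op_bound N (b * sg / t) -> al * d * `|dot w (N *m w)| <= b * sg / t ^+ 2.
  move=> hN; have := op_bound_dot w w hN => h.
  apply: (le_trans (ler_wpM2l kd0 h)).
  apply: (@le_trans _ _ (al * d * (b * sg / t * (q / t)))).
    by rewrite ler_wpM2l// ler_wpM2l// ?divr_ge0 ?mulr_ge0// ltW.
  have -> : al * d * (b * sg / t * (q / t)) = b * sg / t ^+ 2 * (al * d * q).
    by field; rewrite gt_eqF.
  by rewrite ler_piMr// rank1_alqd_le1.
have b1 : al * d * `|dot w (Sg *m M0 *m B *m w)| <= b * sg / t ^+ 2.
  apply: bound; rewrite (_ : b * sg / t = sg * t^-1 * b); last by ring.
  by apply: op_boundM => //; [exact: mulr_ge0|exact: op_boundM].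
have b2 : al * d * `|dot w (B *m M0 *m Sg *m w)| <= b * sg / t ^+ 2.
  apply: bound; rewrite (_ : b * sg / t = b * t^-1 * sg); last by ring.
  by apply: op_boundM => //; [exact: mulr_ge0|exact: op_boundM].
have Sw0 : 0 <= dot w (Sg *m w) by rewrite -quadE; exact: Sgpsd.2.
have b3 : al * d * (al * d * (dot w (Sg *m w) * lam)) <= b * sg / t ^+ 2.
  have h1 : al * d * dot w (Sg *m w) <= sg / t.
    have /andP[_] := rank1_tau; rewrite rank1_tr opprB addrCA subrr addr0; exact.
  have h2 := rank1_allamd.
  have -> : al * d * (al * d * (dot w (Sg *m w) * lam)) =
    (al * d * dot w (Sg *m w)) * (al * d * lam) by ring.
  have -> : b * sg / t ^+ 2 = (sg / t) * (b / t) by field; rewrite gt_eqF.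
  by apply: ler_pM => //; apply: mulr_ge0; rewrite ?rank1_lam_ge0.
have b30 : 0 <= al * d * (al * d * (dot w (Sg *m w) * lam)).
  by apply: mulr_ge0 => //; apply: mulr_ge0 => //; apply: mulr_ge0; rewrite ?rank1_lam_ge0.
rewrite e1 e2 e3.
set z1 := dot w (Sg *m M0 *m B *m w) in b1 *; set z2 := dot w (B *m M0 *m Sg *m w) in b2 *.
set z3 := dot w (Sg *m w) * lam in b3 b30 *; set tr0 := \tr _.
have -> : tr0 - al * d * z2 - al * d * (z1 - al * d * z3) - tr0 =
  - (al * d * z2) - (al * d * z1) + al * d * (al * d * z3) by ring.
have n1 : `|al * d * z1| <= b * sg / t ^+ 2 by rewrite normrM (ger0_norm kd0).
have n2 : `|al * d * z2| <= b * sg / t ^+ 2 by rewrite normrM (ger0_norm kd0).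
rewrite (le_trans (ler_normD _ _))// (le_trans (lerD (ler_normB _ _) (lexx _)))//.
rewrite normrN (ger0_norm b30); lra.
Qed.

End RankOne.

(** * Perturbation of the deterministic parameters *)

Section Scalar.
Context {R : realType}.
Implicit Types (al tau eta beta : R).

(** The factor by which Sherman-Morrison damps a rank-one term of weight [al];
    [gamma] is the sum of the [al * shrink al tau]. *)
Definition shrink al tau : R := (1 + al * tau)^-1.

Lemma shrink_bounds al tau : 0 <= al -> 0 <= tau -> 0 <= shrink al tau <= 1.
Proof.
move=> a0 t0; have h : 1 <= 1 + al * tau by rewrite lerDl mulr_ge0.
have h0 : 0 < 1 + al * tau by exact: lt_le_trans h.
by rewrite invr_ge0 (ltW h0) invf_le1.
Qed.

(** The two bounds together are what produces the minimum in the rate of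
    convergence; likewise for [shrink2_diff]. *)
Lemma shrink_diff al tau1 tau2 : 0 <= al -> 0 <= tau1 -> 0 <= tau2 ->
  `|shrink al tau1 - shrink al tau2| <= 1 /\
  `|shrink al tau1 - shrink al tau2| <= al * `|tau1 - tau2|.
Proof.
move=> a0 t10 t20.
have /andP[c0 c1] := shrink_bounds a0 t10; have /andP[d0 d1] := shrink_bounds a0 t20.
split; first by rewrite ler_norml; lra.
have n1 : 1 + al * tau1 != 0 by rewrite gt_eqF// ltr_wpDr// mulr_ge0.
have n2 : 1 + al * tau2 != 0 by rewrite gt_eqF// ltr_wpDr// mulr_ge0.
have -> : shrink al tau1 - shrink al tau2 =
    shrink al tau1 * shrink al tau2 * (al * (tau2 - tau1)).
  by rewrite /shrink; field; rewrite n1 n2.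
rewrite normrM [X in X * _]ger0_norm ?mulr_ge0// normrM (ger0_norm a0) distrC.
by rewrite ler_piMl ?mulr_ge0//; apply: mulr_ile1.
Qed.

(** [xi] is the sum of the [al * shrink2 al tau eta]. *)
Definition shrink2 al tau eta : R := al * eta * shrink al tau ^+ 2.

Lemma shrink2_bounds al tau eta beta : 0 <= al -> 0 <= eta -> eta <= beta * tau ->
  0 <= tau -> 0 <= beta -> 0 <= shrink2 al tau eta <= beta.
Proof.
move=> a0 e0 eb t0 b0; have /andP[c0 c1] := shrink_bounds a0 t0.
rewrite /shrink2 mulr_ge0 ?mulr_ge0 ?sqr_ge0//=.
have h : al * tau * shrink al tau <= 1.
  have h0 : 0 < 1 + al * tau by rewrite ltr_wpDr// mulr_ge0.
  by rewrite /shrink ler_pdivrMr// mul1r lerDr.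
have s0 : 0 <= shrink al tau ^+ 2 by exact: sqr_ge0.
have h1 : al * eta * shrink al tau ^+ 2 <= al * (beta * tau) * shrink al tau ^+ 2.
  by rewrite ler_wpM2r// ler_wpM2l.
apply: (le_trans h1); have -> : al * (beta * tau) * shrink al tau ^+ 2 =
  beta * ((al * tau * shrink al tau) * shrink al tau) by ring.
rewrite ler_piMr//; apply: mulr_ile1 => //; first by rewrite !mulr_ge0.
Qed.

Lemma shrink2_diff al tau1 tau2 eta1 eta2 beta :
  0 <= al -> 0 <= tau1 -> 0 <= tau2 -> 0 <= beta ->
  0 <= eta1 -> eta1 <= beta * tau1 -> 0 <= eta2 -> eta2 <= beta * tau2 ->
  `|shrink2 al tau1 eta1 - shrink2 al tau2 eta2| <= beta /\
  `|shrink2 al tau1 eta1 - shrink2 al tau2 eta2| <=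
    al * `|eta1 - eta2| + 2 * beta * (al * `|tau1 - tau2|).
Proof.
move=> a0 t10 t20 b0 e10 e1b e20 e2b.
have /andP[x0 x1] := shrink2_bounds a0 e10 e1b t10 b0.
have /andP[z0 z1] := shrink2_bounds a0 e20 e2b t20 b0.
split; first by rewrite ler_norml; lra.
have /andP[c0 c1] := shrink_bounds a0 t10; have /andP[d0 d1] := shrink_bounds a0 t20.
have n1 : 1 + al * tau1 != 0 by rewrite gt_eqF// ltr_wpDr// mulr_ge0.
have n2 : 1 + al * tau2 != 0 by rewrite gt_eqF// ltr_wpDr// mulr_ge0.
rewrite /shrink2; set c := shrink al tau1 in c0 c1 *; set d := shrink al tau2 in d0 d1 *.
have cd : c - d = c * d * (al * (tau2 - tau1)).
  by rewrite /c /d /shrink; field; rewrite n1 n2.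
have -> : al * eta1 * c ^+ 2 - al * eta2 * d ^+ 2 =
   al * (eta1 - eta2) * c ^+ 2 + (al * (tau2 - tau1)) * (al * eta2 * d) * (c * (c + d)).
  have -> : al * (tau2 - tau1) * (al * eta2 * d) * (c * (c + d)) =
      al * eta2 * ((c * d * (al * (tau2 - tau1))) * (c + d)) by ring.
  by rewrite -cd; ring.
apply: (le_trans (ler_normD _ _)); apply: lerD.
  rewrite normrM (ger0_norm (sqr_ge0 c)) normrM (ger0_norm a0).
  by apply: ler_piMr; [exact: mulr_ge0|exact: exprn_ile1].
have h : al * tau2 * d <= 1.
  have h0 : 0 < 1 + al * tau2 by rewrite ltr_wpDr// mulr_ge0.
  by rewrite /d /shrink ler_pdivrMr// mul1r lerDr.
have h2 : al * eta2 * d <= beta.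
  apply: (@le_trans _ _ (beta * (al * tau2 * d))); last by rewrite ler_piMr.
  have -> : beta * (al * tau2 * d) = al * (beta * tau2) * d by ring.
  by rewrite ler_wpM2r// ler_wpM2l.
have h20 : 0 <= al * eta2 * d by rewrite !mulr_ge0.
have cc : 0 <= c * (c + d) <= 2 by rewrite mulr_ge0 ?addr_ge0//=; nra.
case/andP: cc => cc0 cc2.
rewrite normrM [X in _ * X]ger0_norm// normrM [X in _ * X * _]ger0_norm//.
rewrite normrM (ger0_norm a0) (distrC tau2).
have D0 : 0 <= al * `|tau1 - tau2| by rewrite mulr_ge0.
rewrite (_ : 2 * beta * _ = al * `|tau1 - tau2| * beta * 2); last by ring.
by apply: ler_pM => //; [exact: mulr_ge0|exact: ler_wpM2l].
Qed.
End Scalar.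

Section Equivalent.
Context {R : realType} {p : nat}.
Local Notation V := 'cV[R]_p.
Local Notation M := 'M[R]_p.
Variables (t b sg : R) (A B Sg : M).
Hypotheses (t0 : 0 < t) (b0 : 0 <= b) (sg0 : 0 <= sg).
Hypotheses (At : pos_ge t A) (Bb : op_bound B b) (Sgpsd : psd Sg) (Sgb : op_bound Sg sg).

Definition detG (g : R) : M := invmx (A + g *: Sg).
Definition detK (g x : R) : M := detG g *m (B + x *: Sg) *m detG g.

Lemma pos_ge_shift g : 0 <= g -> pos_ge t (A + g *: Sg).
Proof.
move=> g0; split; first by rewrite linearD /= linearZ /= At.1 Sgpsd.1.
move=> u; rewrite mulmxDl dotDr -scalemxAl dotZr ler_wpDr ?At.2//.
by rewrite mulr_ge0// -quadE; exact: Sgpsd.2.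
Qed.

Lemma detG_bound g : 0 <= g -> op_bound (detG g) t^-1.
Proof. by move=> g0; apply: pos_ge_inv_bound => //; exact: pos_ge_shift. Qed.

Let ti : 0 <= t^-1. Proof. by rewrite invr_ge0 ltW. Qed.

Lemma detK_bound g x : 0 <= g -> 0 <= x -> op_bound (detK g x) ((b + x * sg) / t ^+ 2).
Proof.
move=> g0 x0; have hG := detG_bound g0.
rewrite (_ : _ / _ = t^-1 * (b + x * sg) * t^-1); last by field; rewrite gt_eqF.
have h0 : 0 <= b + x * sg by rewrite addr_ge0// mulr_ge0.
apply: op_boundM => //; first by rewrite mulr_ge0.
apply: op_boundM => //; apply: op_boundD => //.
by rewrite -{2}(ger0_norm x0); exact: op_boundZ.
Qed.

Lemma detG_diff g1 g2 : 0 <= g1 -> 0 <= g2 ->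
  detG g1 - detG g2 = (g2 - g1) *: (detG g1 *m Sg *m detG g2).
Proof.
move=> g10 g20; have h1 := pos_ge_shift g10; have h2 := pos_ge_shift g20.
have e : (g2 - g1) *: Sg = (A + g2 *: Sg) - (A + g1 *: Sg).
  by rewrite opprD addrACA subrr add0r scalerBl.
rewrite scalemxAl scalemxAr e mulmxBr mulmxBl -mulmxA (pos_ge_mulV t0 h2) mulmx1.
by rewrite (pos_ge_mulK t0 h1) mul1mx.
Qed.

Lemma detG_diff_bound g1 g2 : 0 <= g1 -> 0 <= g2 ->
  op_bound (detG g1 - detG g2) (sg * `|g1 - g2| / t ^+ 2).
Proof.
move=> g10 g20; rewrite detG_diff// (_ : _ / _ = `|g2 - g1| * (t^-1 * sg * t^-1)); last first.
  by rewrite (distrC g2); field; rewrite gt_eqF.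
apply: op_boundZ; apply: op_boundM; [exact: mulr_ge0| |exact: detG_bound].
by apply: op_boundM => //; exact: detG_bound.
Qed.

(** Changing the resolvent at fixed [x2] first, and [x] afterwards, makes only the
    norm of [B + x2 *: Sg] appear next to the increments. *)
Lemma detK_diff_bound g1 g2 x1 x2 (v : V) : 0 <= g1 -> 0 <= g2 -> 0 <= x1 -> 0 <= x2 ->
  l2norm v = 1 ->
  `|dot v (detK g1 x1 *m v) - dot v (detK g2 x2 *m v)| <=
   2 * (b + x2 * sg) / t ^+ 3 * (sg * `|g1 - g2|) + sg * `|x1 - x2| / t ^+ 2.
Proof.
move=> g10 g20 x10 x20 v1.
set G1 := detG g1; set G2 := detG g2; set W := B + x2 *: Sg.
have h0 : 0 <= b + x2 * sg by rewrite addr_ge0// mulr_ge0.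
have hW : op_bound W (b + x2 * sg).
  by apply: op_boundD => //; rewrite -{2}(ger0_norm x20); exact: op_boundZ.
have hG1 : op_bound G1 t^-1 := detG_bound g10.
have hG2 : op_bound G2 t^-1 := detG_bound g20.
have hD := detG_diff_bound g10 g20.
have D0 : 0 <= sg * `|g1 - g2| / t ^+ 2 by apply: divr_ge0; [exact: mulr_ge0|exact: sqr_ge0].
have -> : dot v (detK g1 x1 *m v) - dot v (detK g2 x2 *m v) =
    dot v (((G1 - G2) *m W *m G1 + G2 *m W *m (G1 - G2) +
     (x1 - x2) *: (G1 *m Sg *m G1)) *m v).
  rewrite -dotBr -mulmxBl; congr (dot _ (_ *m _)).
  rewrite /detK -/G1 -/G2 !(mulmxBl, mulmxBr).
  have -> : B + x1 *: Sg = W + (x1 - x2) *: Sg.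
    by rewrite /W scalerBl -addrA [x2 *: Sg + _]addrC subrK.
  rewrite mulmxDr mulmxDl -scalemxAr -scalemxAl.
  by rewrite [G1 *m W *m G1 - _ + _]addrA subrK addrAC.
have hb : op_bound ((G1 - G2) *m W *m G1 + G2 *m W *m (G1 - G2) +
     (x1 - x2) *: (G1 *m Sg *m G1)) ((sg * `|g1 - g2| / t ^+ 2) * (b + x2 * sg) * t^-1 +
     t^-1 * (b + x2 * sg) * (sg * `|g1 - g2| / t ^+ 2) + `|x1 - x2| * (t^-1 * sg * t^-1)).
  apply: op_boundD; first apply: op_boundD.
  - apply: op_boundM => //; [exact: mulr_ge0|exact: op_boundM].
  - apply: op_boundM => //; [exact: mulr_ge0|exact: op_boundM].
  - apply: op_boundZ; apply: op_boundM => //; [exact: mulr_ge0|exact: op_boundM].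
apply: (le_trans (op_bound_dot v v hb)); rewrite v1 !mulr1 le_eqVlt; apply/orP; left.
by apply/eqP; field; rewrite gt_eqF.
Qed.
End Equivalent.

(** * Moments of Gaussian vectors *)

Section GaussianMoments.
Context {R : realType} {p : nat} {d : measure_display} {T : measurableType d}.
Local Notation V := 'cV[R]_p.
Variables (P : probability T R) (X : T -> V) (Sg : 'M[R]_p).
Hypotheses (XG : gaussian_vector P X) (Xm : has_mean P X 0).
Hypothesis Xc : has_covariance P X Sg.

Let Y (u : V) (w : T) : R := dot u (X w).

Lemma measurable_dotX u : measurable_fun setT (Y u).
Proof.
rewrite /Y; under eq_fun do rewrite dotE.
apply: measurable_sum => i; apply: measurable_funM => //.
by apply: random_vector_entries; case: XG.
Qed.

Let law u : exists m s : R,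
  (forall k, (k <= 4)%N -> L1 P (fun w => (Y u w - m) ^+ k)) /\
  [/\ Ex P (fun w => (Y u w - m) ^+ 1) = 0,
      Ex P (fun w => (Y u w - m) ^+ 2) = s ^+ 2 &
      Ex P (fun w => (Y u w - m) ^+ 4) = 3 * s ^+ 4].
Proof.
have [m [s hl]] := XG.2 u; exists m, s.
have mY := measurable_dotX u.
have lawY (S : set R) : measurable S -> P (Y u @^-1` S) = normal_law m s S.
  exact: hl.
split; first by move=> k k4; exact: (law_integrable_moment mY lawY).
rewrite /Ex !(law_moment mY lawY)//; case: eqVneq => [->|s0].
  by rewrite !expr0n /= mulr0.
by rewrite normal_moment1// normal_moment2// normal_moment4.
Qed.

Let e (i : 'I_p) : V := delta_mx i 0.

Let Ye i w : Y (e i) w = X w i 0.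
Proof.
rewrite /Y dotE (bigD1 i)//= mxE !eqxx mul1r big1 ?addr0// => j ji.
by rewrite mxE (negbTE ji) mul0r.
Qed.

Let L1e i : L1 P (fun w => X w i 0).
Proof.
have [m [s [hL _]]] := law (e i).
apply: eq_L1 (L1D (hL 1%N isT) (L1_cst P m)) => w.
by rewrite expr1 subrK Ye.
Qed.

Let Exe i : Ex P (fun w => X w i 0) = 0.
Proof. by have := Xm i; rewrite unlock mxE ExE// => -[]. Qed.

Let YE u w : Y u w = \sum_i u i 0 * X w i 0.
Proof. exact: dotE. Qed.

Let L1Y u : L1 P (Y u).
Proof.
apply: (@eq_L1 _ _ _ _ (fun w => \sum_i u i 0 * X w i 0)) => [w|].
  by rewrite YE.
by apply: L1_sum => i _; exact: L1Z.
Qed.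

Let ExY u : Ex P (Y u) = 0.
Proof.
under eq_Ex do rewrite YE.
by rewrite Ex_sum => [|i _]; [rewrite big1// => i _; rewrite ExZ// Exe mulr0|exact: L1Z].
Qed.

(** The definition of a Gaussian vector leaves the mean of each projection free;
    it vanishes because the coordinates are centred. *)
Let moments u : exists s : R,
  (forall k, (k <= 4)%N -> L1 P (fun w => Y u w ^+ k)) /\
  Ex P (fun w => Y u w ^+ 2) = s ^+ 2 /\ Ex P (fun w => Y u w ^+ 4) = 3 * s ^+ 4.
Proof.
have [m [s [hL [e1 e2 e4]]]] := law u; exists s.
have m0 : m = 0.
  move: e1; rewrite (@eq_Ex _ _ _ P _ (fun w => Y u w - m)); last by move=> w; rewrite expr1.
  by rewrite ExB ?ExY ?Ex_cst ?sub0r//; [move/eqP; rewrite oppr_eq0 => /eqP|exact: L1_cst].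
subst m; split.
  by move=> k /hL; apply: eq_L1 => w; rewrite subr0.
rewrite -e2 -e4; split; apply: eq_Ex => w; by rewrite subr0.
Qed.

Lemma L1_dotX4 u : L1 P (fun w => Y u w ^+ 4).
Proof. by have [s [h _]] := moments u; exact: h. Qed.

Lemma L1_dotX2 u w : L1 P (fun z => Y u z * Y w z).
Proof.
have [s1 [h1 _]] := moments u; have [s2 [h2 _]] := moments w.
by apply: L1_mul; [exact: measurable_dotX|exact: measurable_dotX|exact: h1|exact: h2].
Qed.

Let Ex_coord i k : Ex P (fun w => X w i 0 * X w k 0) = Sg i k.
Proof.
have := Xc i k; rewrite unlock.
have m0 j : fine 'E_P[(fun w => X w j 0)] = 0 by rewrite (Xm j) mxE.
rewrite !m0 unlock.
have -> : ((fun w => X w i 0) \- cst 0) * ((fun w => X w k 0) \- cst 0) =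
    (fun w => X w i 0 * X w k 0) :> (T -> R).
  by apply/funext => w; rewrite !fctE /= !subr0.
rewrite ExE; first by case.
by apply: eq_L1 (L1_dotX2 (e i) (e k)) => w; rewrite !Ye.
Qed.

Lemma covE u w : dot u (Sg *m w) = \sum_i \sum_k u i 0 * (w k 0 * Sg i k).
Proof.
rewrite dotE; apply: eq_bigr => i _; rewrite mxE big_distrr /=.
by apply: eq_bigr => k _; rewrite (mulrC (w k 0)).
Qed.

Lemma Ex_dotX2 u w : Ex P (fun z => Y u z * Y w z) = dot u (Sg *m w).
Proof.
have L1e2 i k : L1 P (fun z => X z i 0 * X z k 0).
  by apply: eq_L1 (L1_dotX2 (e i) (e k)) => z; rewrite !Ye.
rewrite (@eq_Ex _ _ _ P _ (fun z => \sum_i \sum_k (u i 0 * w k 0) * (X z i 0 * X z k 0))).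
  rewrite Ex_sum => [|i _]; last by apply: L1_sum => k _; exact: L1Z.
  rewrite covE; apply: eq_bigr => i _; rewrite Ex_sum => [|k _]; last exact: L1Z.
  by apply: eq_bigr => k _; rewrite ExZ// Ex_coord mulrA.
move=> z; rewrite !YE big_distrl /=; apply: eq_bigr => i _.
by rewrite big_distrr /=; apply: eq_bigr => k _; rewrite mulrACA.
Qed.

Lemma cov_sym : Sg^T = Sg.
Proof.
apply/matrixP => i k; rewrite mxE -!Ex_coord.
by apply: eq_Ex => z; rewrite mulrC.
Qed.

Lemma cov_psd : psd Sg.
Proof.
split; first exact: cov_sym.
move=> u; rewrite quadE -Ex_dotX2; apply: Ex_ge0 => z.
by rewrite -expr2 sqr_ge0.
Qed.

Lemma Ex_dotX4 u : Ex P (fun w => Y u w ^+ 4) = 3 * dot u (Sg *m u) ^+ 2.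
Proof.
have [s [_ [e2 ->]]] := moments u.
rewrite -Ex_dotX2 (_ : Ex P _ = s ^+ 2); first by ring.
by rewrite -e2; apply: eq_Ex => w; rewrite expr2.
Qed.

Lemma L1_dotX1111 a b c f : L1 P (fun w => Y a w * Y b w * Y c w * Y f w).
Proof.
apply: (L1_le _ (L1D (L1D (L1_dotX4 a) (L1_dotX4 b)) (L1D (L1_dotX4 c) (L1_dotX4 f)))).
  by do 3 (apply: measurable_funM; last exact: measurable_dotX); exact: measurable_dotX.
move=> w; rewrite !normrM.
set x := Y a w; set y := Y b w; set z := Y c w; set u := Y f w.
have p4 (v : R) : v ^+ 4 = `|v| ^+ 2 ^+ 2 by rewrite real_normK ?num_real// -exprM.
rewrite !p4.
have h1 (s r : R) : s * r <= s ^+ 2 / 2 + r ^+ 2 / 2 by have := sqr_ge0 (s - r); nra.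
have := h1 (`|x| * `|y|) (`|z| * `|u|).
have := h1 (`|x| ^+ 2) (`|y| ^+ 2); have := h1 (`|z| ^+ 2) (`|u| ^+ 2).
rewrite !exprMn; set X2 := `|x| ^+ 2; set Y2 := `|y| ^+ 2; set Z2 := `|z| ^+ 2; set U2 := `|u| ^+ 2.
have := sqr_ge0 X2; have := sqr_ge0 Y2; have := sqr_ge0 Z2; have := sqr_ge0 U2.
rewrite -mulrA => *; lra.
Qed.

Let pol (w : T) (a b c f : V) (s1 s2 s3 : R) :=
  Y (a + s1 *: b + s2 *: c + s3 *: f) w ^+ 4.

(** Wick's formula. The product of four linear forms is the alternating sum over
    three signs of the fourth powers of [a +- b +- c +- f], divided by
    [2^3 4! = 192]; each fourth moment is three times a squared variance. *)
Lemma wick a b c f : Ex P (fun w => Y a w * Y b w * Y c w * Y f w) =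
  dot a (Sg *m b) * dot c (Sg *m f) + dot a (Sg *m c) * dot b (Sg *m f) +
  dot a (Sg *m f) * dot b (Sg *m c).
Proof.
have L s1 s2 s3 := L1_dotX4 (a + s1 *: b + s2 *: c + s3 *: f).
pose g s1 s2 s3 w := (s1 * s2 * s3) * pol w a b c f s1 s2 s3.
have Lg s1 s2 s3 : L1 P (g s1 s2 s3) by apply: L1Z; exact: L.
have Eg s1 s2 s3 : Ex P (g s1 s2 s3) = s1 * s2 * s3 *
   (3 * dot (a + s1 *: b + s2 *: c + s3 *: f) (Sg *m (a + s1 *: b + s2 *: c + s3 *: f)) ^+ 2).
  by rewrite -Ex_dotX4 -ExZ.
have -> : Ex P (fun w => Y a w * Y b w * Y c w * Y f w) =
  192%:R^-1 * Ex P (fun w => (((g 1 1 1 w + g 1 1 (-1) w) + (g 1 (-1) 1 w + g 1 (-1) (-1) w))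
   + ((g (-1) 1 1 w + g (-1) 1 (-1) w) + (g (-1) (-1) 1 w + g (-1) (-1) (-1) w)))).
  rewrite -ExZ; last by do ! apply: L1D.
  apply: eq_Ex => w; rewrite /g /pol /Y !dotDl !dotZl.
  by field.
rewrite !ExD//; try by do ! apply: L1D.
rewrite !Eg !(mulmxDr, dotDl, dotDr) -!scalemxAr !(dotZl, dotZr).
have sy u v : dot u (Sg *m v) = dot v (Sg *m u) by rewrite (dot_sym _ _ cov_sym) dotC.
rewrite (sy b a) (sy c a) (sy c b) (sy f a) (sy f b) (sy f c).
by field.
Qed.

Variable sg : R.
Hypotheses (sg0 : 0 <= sg) (Sgb : op_bound Sg sg).

Lemma L1_dotX22 u w : L1 P (fun z => (Y u z * Y w z) ^+ 2).
Proof. by apply: eq_L1 (L1_dotX1111 u w u w) => z; ring. Qed.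

Lemma Ex_dotX22_le u w U W : l2norm u <= U -> l2norm w <= W ->
  Ex P (fun z => (Y u z * Y w z) ^+ 2) <= (2 * sg * U * W) ^+ 2.
Proof.
move=> uU wW; have U0 := le_trans (l2norm_ge0 u) uU; have W0 := le_trans (l2norm_ge0 w) wW.
rewrite (@eq_Ex _ _ _ P _ (fun z => Y u z * Y u z * Y w z * Y w z)); last by move=> z; ring.
rewrite wick.
have h1 := op_bound_dot_le sg0 Sgb uU uU; have h2 := op_bound_dot_le sg0 Sgb wW wW.
have h3 := op_bound_dot_le sg0 Sgb uU wW.
have p1 : dot u (Sg *m u) * dot w (Sg *m w) <= (sg * (U * U)) * (sg * (W * W)).
  by apply: (le_trans (ler_norm _)); rewrite normrM ler_pM.
have p2 : dot u (Sg *m w) * dot u (Sg *m w) <= (sg * (U * W)) * (sg * (U * W)).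
  by apply: (le_trans (ler_norm _)); rewrite normrM ler_pM.
have := sqr_ge0 (sg * U * W); rewrite !expr2 => p0; nra.
Qed.

Lemma mxtrace_dot (N : 'M[R]_p) : \tr N = \sum_i dot (e i) (N *m e i).
Proof.
apply: eq_bigr => i _; rewrite /dot /e trmx_delta -rowE -colE.
by rewrite !mxE.
Qed.

Lemma dot_entry (N : 'M[R]_p) i j : dot (e i) (N *m e j) = N i j.
Proof. by rewrite /dot /e trmx_delta -rowE -colE !mxE. Qed.

Lemma quadXE Q w : Q^T = Q -> dot (X w) (Q *m X w) = \sum_i Y (e i) w * Y (Q *m e i) w.
Proof.
move=> Qs; rewrite dotE; apply: eq_bigr => i _; rewrite Ye; congr (_ * _).
rewrite /Y -dot_sym// /dot /e trmx_delta -rowE; by rewrite !mxE.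
Qed.

Lemma L1_quadX Q : Q^T = Q -> L1 P (fun w => dot (X w) (Q *m X w)).
Proof.
move=> Qs; apply: (@eq_L1 _ _ _ _ (fun w => \sum_i Y (e i) w * Y (Q *m e i) w)).
  by move=> w; rewrite quadXE.
by apply: L1_sum => i _; exact: L1_dotX2.
Qed.

Lemma Ex_quadX Q : Q^T = Q -> Ex P (fun w => dot (X w) (Q *m X w)) = \tr (Sg *m Q).
Proof.
move=> Qs; rewrite (@eq_Ex _ _ _ P _ (fun w => \sum_i Y (e i) w * Y (Q *m e i) w)).
  rewrite Ex_sum => [|i _]; last exact: L1_dotX2.
  by rewrite mxtrace_dot; apply: eq_bigr => i _; rewrite Ex_dotX2 mulmxA.
by move=> w; rewrite quadXE.
Qed.

(** The trace is the mean of the quadratic form of [N] at the Gaussian vector,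
    which replaces a square root of the covariance matrix. *)
Lemma cov_trace_ge0 N : psd N -> 0 <= \tr (Sg *m N).
Proof.
move=> [Ns Np]; rewrite -Ex_quadX//; apply: Ex_ge0 => w.
by rewrite -quadE.
Qed.

Let quad2E Q w : Q^T = Q -> dot (X w) (Q *m X w) ^+ 2 =
  \sum_i \sum_j Y (e i) w * Y (Q *m e i) w * Y (e j) w * Y (Q *m e j) w.
Proof.
move=> Qs; rewrite quadXE// expr2 big_distrl /=; apply: eq_bigr => i _.
by rewrite big_distrr /=; apply: eq_bigr => j _; rewrite mulrA.
Qed.

Lemma L1_quadX2 Q : Q^T = Q -> L1 P (fun w => dot (X w) (Q *m X w) ^+ 2).
Proof.
move=> Qs; apply: (@eq_L1 _ _ _ _ (fun w => \sum_i \sum_j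
    Y (e i) w * Y (Q *m e i) w * Y (e j) w * Y (Q *m e j) w)).
  by move=> w; rewrite quad2E.
by apply: L1_sum => i _; apply: L1_sum => j _; exact: L1_dotX1111.
Qed.

Lemma Ex_quadX2 Q : Q^T = Q -> Ex P (fun w => dot (X w) (Q *m X w) ^+ 2) =
  \tr (Sg *m Q) ^+ 2 + 2 * \tr (Sg *m Q *m Sg *m Q).
Proof.
move=> Qs; rewrite (@eq_Ex _ _ _ P _ (fun w => \sum_i \sum_j
    Y (e i) w * Y (Q *m e i) w * Y (e j) w * Y (Q *m e j) w)); last first.
  by move=> w; rewrite quad2E.
rewrite Ex_sum => [|i _]; last by apply: L1_sum => j _; exact: L1_dotX1111.
have -> : 2 * \tr (Sg *m Q *m Sg *m Q) =
   \sum_i \sum_j (Sg i j * (Q *m Sg *m Q) j i + (Sg *m Q) i j * (Sg *m Q) j i).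
  rewrite mulr_natl mulr2n {1}(_ : Sg *m Q *m Sg *m Q = Sg *m (Q *m Sg *m Q)); last by rewrite !mulmxA.
  rewrite -(mulmxA (Sg *m Q)) /mxtrace -big_split; apply: eq_bigr => i _ /=.
  by rewrite !mxE -big_split.
rewrite expr2 mxtrace_dot big_distrl -big_split /=; apply: eq_bigr => i _.
rewrite big_distrr -big_split /= Ex_sum => [|j _]; last exact: L1_dotX1111.
apply: eq_bigr => j _; rewrite wick -addrA; congr (_ + (_ + _)).
- by rewrite !mulmxA.
- rewrite dot_entry; congr (_ * _); rewrite -(dot_sym _ _ Qs) !mulmxA dot_entry.
  have QSQ : (Q *m Sg *m Q)^T = Q *m Sg *m Q by rewrite !trmx_mul Qs cov_sym mulmxA.
  by rewrite -{1}QSQ mxE.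
- rewrite mulmxA dot_entry; congr (_ * _).
  rewrite -(dot_sym _ _ Qs) mulmxA dot_entry.
  have SQ : (Sg *m Q)^T = Q *m Sg by rewrite trmx_mul Qs cov_sym.
  by rewrite -SQ mxE.
Qed.

(** Wick gives the exact variance [2 tr (Sg Q Sg Q)]; the trace is at most [p]
    times an operator norm. The exact constant 3 of the fourth moment makes the
    squared mean cancel. *)
Lemma quadX_var Q (k : R) : Q^T = Q -> 0 <= k -> op_bound Q k ->
  L1 P (fun w => (dot (X w) (Q *m X w) - \tr (Sg *m Q)) ^+ 2) /\
  Ex P (fun w => (dot (X w) (Q *m X w) - \tr (Sg *m Q)) ^+ 2) <=
    2 * p%:R * (sg * k) ^+ 2.
Proof.
move=> Qs k0 Qk; set m := \tr _.
have L2 := L1_quadX2 Qs; have L1' := L1_quadX Qs.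
have E : (fun w => (dot (X w) (Q *m X w) - m) ^+ 2) =1
    (fun w => dot (X w) (Q *m X w) ^+ 2 - (2 * m) * dot (X w) (Q *m X w) + m ^+ 2).
  by move=> w; ring.
have LL : L1 P (fun w => dot (X w) (Q *m X w) ^+ 2 - (2 * m) * dot (X w) (Q *m X w)).
  by apply: L1B => //; exact: L1Z.
split.
  by apply: (eq_L1 (fun w => esym (E w))); apply: L1D => //; exact: L1_cst.
rewrite (eq_Ex P E) ExD ?Ex_cst//; last exact: L1_cst.
rewrite ExB ?ExZ//; last exact: L1Z.
rewrite Ex_quadX// Ex_quadX2// -/m.
have h : op_bound (Sg *m Q *m Sg *m Q) (sg * k * sg * k).
  apply: op_boundM => //; first by rewrite !mulr_ge0.
  apply: op_boundM => //; first by rewrite !mulr_ge0.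
  exact: op_boundM.
have := le_trans (ler_norm _) (mxtrace_le h _); rewrite !mulr_ge0// => /(_ isT).
rewrite (_ : sg * k * sg * k = (sg * k) ^+ 2); last by ring.
lra.
Qed.

End GaussianMoments.

(** * Measurability of matrix functionals *)

Section MeasurableInv.
Context {R : realType} {d : measure_display} {T : measurableType d}.

(** [x^-1] is [x] times a real power of [x ^+ 2]. *)
Lemma measurable_funV (f : T -> R) : measurable_fun setT f ->
  measurable_fun setT (fun w => (f w)^-1).
Proof.
move=> mf.
rewrite (_ : (fun w => (f w)^-1) = fun w => f w * (f w ^+ 2) `^ (-1)).
  apply: measurable_funM => //.
  by apply: (measurableT_comp (measurable_powR (-1))); exact: measurable_funX.
apply/funext => w; rewrite powR_inv1 ?sqr_ge0// expr2 invfM mulrA.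
by have [->|f0] := eqVneq (f w) 0; rewrite ?invr0 ?mulr0// divff// mul1r.
Qed.
End MeasurableInv.

Section MatrixFunctional.
Context {R : realType} {I : finType} {p : nat}.
Local Notation V := 'cV[R]_p.
Local Notation conf := (I -> V).
Implicit Types (F G : conf -> R).

Definition measurable_matrix m k (N : conf -> 'M[R]_(m, k)) :=
  forall a b, measurable_functional (fun y => N y a b).

Lemma mfD F G : measurable_functional F -> measurable_functional G ->
  measurable_functional (fun y => F y + G y).
Proof. by move=> mF mG d T Y mY; apply: measurable_funD; [exact: mF|exact: mG]. Qed.

Lemma mfB F G : measurable_functional F -> measurable_functional G ->
  measurable_functional (fun y => F y - G y).
Proof. by move=> mF mG d T Y mY; apply: measurable_funB; [exact: mF|exact: mG]. Qed.

Lemma mfM F G : measurable_functional F -> measurable_functional G ->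
  measurable_functional (fun y => F y * G y).
Proof. by move=> mF mG d T Y mY; apply: measurable_funM; [exact: mF|exact: mG]. Qed.

Lemma mfX F k : measurable_functional F -> measurable_functional (fun y => F y ^+ k).
Proof. by move=> mF d T Y mY; apply: measurable_funX; exact: mF. Qed.

Lemma mf_cst c : measurable_functional (fun _ : conf => c).
Proof. by move=> d T Y mY; exact: measurable_cst. Qed.

Lemma mfV F : measurable_functional F -> measurable_functional (fun y => (F y)^-1).
Proof. by move=> mF d T Y mY; apply: measurable_funV; exact: mF. Qed.

Lemma mf_norm F : measurable_functional F -> measurable_functional (fun y => `|F y|).
Proof. by move=> mF d T Y mY; apply: measurableT_comp => //; exact: mF. Qed.

Lemma mf_sum (J : Type) (s : seq J) (h : J -> conf -> R) :
  (forall j, measurable_functional (h j)) ->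
  measurable_functional (fun y => \sum_(j <- s) h j y).
Proof. by move=> mh d T Y mY; apply: measurable_sum => j; exact: mh. Qed.

Lemma mf_prod (J : eqType) (s : seq J) (h : J -> conf -> R) :
  (forall j, measurable_functional (h j)) ->
  measurable_functional (fun y => \prod_(j <- s) h j y).
Proof. by move=> mh d T Y mY; apply: measurable_prod => j _; exact: mh. Qed.

Lemma mx_coord j : measurable_matrix (fun y : conf => y j).
Proof. by move=> a b d T Y mY; rewrite ord1; exact: mY. Qed.

Lemma mx_cst m k (N : 'M[R]_(m, k)) : measurable_matrix (fun _ : conf => N).
Proof. by move=> a b; exact: mf_cst. Qed.

Lemma mx_tr m k (N : conf -> 'M[R]_(m, k)) : measurable_matrix N ->
  measurable_matrix (fun y => (N y)^T).
Proof. by move=> mN a b d T Y mY; under eq_fun do rewrite mxE; exact: mN. Qed.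

Lemma mxD m k (N1 N2 : conf -> 'M[R]_(m, k)) : measurable_matrix N1 ->
  measurable_matrix N2 -> measurable_matrix (fun y => N1 y + N2 y).
Proof.
move=> m1 m2 a b d T Y mY; under eq_fun do rewrite mxE.
exact: (mfD (m1 a b) (m2 a b)).
Qed.

Lemma mxZ m k F (N : conf -> 'M[R]_(m, k)) : measurable_functional F ->
  measurable_matrix N -> measurable_matrix (fun y => F y *: N y).
Proof.
move=> mF mN a b d T Y mY; under eq_fun do rewrite mxE.
exact: (mfM mF (mN a b)).
Qed.

Lemma mxM m k l (N1 : conf -> 'M[R]_(m, k)) (N2 : conf -> 'M[R]_(k, l)) :
  measurable_matrix N1 -> measurable_matrix N2 ->
  measurable_matrix (fun y => N1 y *m N2 y).
Proof.
move=> m1 m2 a b d T Y mY; under eq_fun do rewrite mxE.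
by apply: (@mf_sum _ _ (fun i y => N1 y a i * N2 y i b)) => // i; exact: mfM.
Qed.

Lemma mx_sum m k (J : Type) (s : seq J) (h : J -> conf -> 'M[R]_(m, k)) :
  (forall j, measurable_matrix (h j)) ->
  measurable_matrix (fun y => \sum_(j <- s) h j y).
Proof.
move=> mh a b d T Y mY; under eq_fun do rewrite summxE.
by apply: (@mf_sum _ _ (fun i y => h i y a b)) => // i; exact: mh.
Qed.

Lemma mf_tr k (N : conf -> 'M[R]_k) : measurable_matrix N ->
  measurable_functional (fun y => \tr (N y)).
Proof. by move=> mN; apply: mf_sum => i; exact: mN. Qed.

Lemma mf_det k (N : conf -> 'M[R]_k) : measurable_matrix N ->
  measurable_functional (fun y => \det (N y)).
Proof.
move=> mN; apply: mf_sum => s; apply: mfM; first exact: mf_cst.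
by apply: mf_prod => i; exact: mN.
Qed.

Lemma mx_inv k (N : conf -> 'M[R]_k) : (forall y, N y \in unitmx) ->
  measurable_matrix N -> measurable_matrix (fun y => invmx (N y)).
Proof.
move=> uN mN a b d T Y mY; rewrite /invmx; under eq_fun do rewrite uN !mxE.
apply: (@mfM (fun y => (\det (N y))^-1) (fun y => cofactor (N y) b a)) => //.
  by apply: mfV; exact: mf_det.
apply: mfM; first exact: mf_cst.
by apply: mf_det => i j d' T' Y' mY'; under eq_fun do rewrite !mxE; exact: mN.
Qed.

Lemma mf_dot (u w : conf -> V) : measurable_matrix u -> measurable_matrix w ->
  measurable_functional (fun y => dot (u y) (w y)).
Proof. by move=> mu mw; apply: mxM => //; exact: mx_tr. Qed.

Lemma mx_upd m k (N : conf -> 'M[R]_(m, k)) j : measurable_matrix N ->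
  measurable_matrix (fun y => N (upd y j 0)).
Proof.
move=> mN a b d T Y mY.
apply: (mN a b _ _ (fun i w => if i == j then 0 else Y i w)) => i c.
case: eqP => _; [exact: measurable_cst|exact: mY].
Qed.

Lemma mf_upd F j : measurable_functional F -> measurable_functional (fun y => F (upd y j 0)).
Proof.
move=> mF d T Y mY.
apply: (mF _ _ (fun i w => if i == j then 0 else Y i w)) => i c.
case: eqP => _; [exact: measurable_cst|exact: mY].
Qed.
End MatrixFunctional.

(** * The quantitative deterministic equivalent *)

Section Constant.
Context {R : realType}.
Variables (t C1 C2 : R).

(** An explicit constant, since the limit needs a bound uniform in [n]. *)
Definition equiv_const : R :=
  let kap := (1 + C1 / t) / t ^+ 2 in
  let Lam := Num.sqrt (16 + 6 * C2) in
  2 * (4 / t ^+ 4 + kap / t ^+ 2) * (1 + C1) + 2 * (2 / t ^+ 3 + kap / t) +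
  Lam * (12 / t ^+ 4 + 2 * (kap / t ^+ 2)) +
  (2 * kap / t + 1 / t ^+ 3 + (4 * kap / t ^+ 2 + 10 / t ^+ 4)).
End Constant.

Section Model.
Context {R : realType} {n p : nat} {d : measure_display} {T : measurableType d}.
Local Notation V := 'cV[R]_p.
Local Notation conf := ('I_n -> V).
Variables (P : probability T R) (X : 'I_n -> T -> V) (Sg : 'M[R]_p).
Variables (r : 'I_n -> R) (t : R) (A B : 'M[R]_p) (v : V) (C1 C2 : R).
Hypotheses (n0 : (0 < n)%N) (XG : forall j, gaussian_vector P (X j)).
Hypotheses (Xm : forall j, has_mean P (X j) 0).
Hypotheses (Xc : forall j, has_covariance P (X j) Sg).
Hypothesis Xind : independent_vectors P X.
Hypotheses (t0 : 0 < t) (At : pos_ge t A) (Bpsd : psd B) (v1 : l2norm v = 1).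
Local Notation sg := (opnorm Sg).
Local Notation b := (opnorm B).
Hypothesis sumC1 : \sum_(j < n) r j ^+ 2 / n%:R * sg <= C1.
Hypothesis pC2 : p%:R <= C2 * n%:R.

Let j0 : 'I_n := Ordinal n0.
Let rX j : random_vector (X j). Proof. by case: (XG j). Qed.

Let indX (S : 'I_n -> set V) : (forall i, borel_cV (S i)) ->
  P ((fun w => X^~ w) @^-1` rectangle S) = (\prod_i P (X i @^-1` S i))%E.
Proof. by move=> mS; rewrite rectangle_preimage; exact: Xind. Qed.

Let sg0 : 0 <= sg. Proof. exact: opnorm_ge0. Qed.
Let b0 : 0 <= b. Proof. exact: opnorm_ge0. Qed.
Let Sgb : op_bound Sg sg. Proof. exact: op_bound_opnorm. Qed.
Let Bb : op_bound B b. Proof. exact: op_bound_opnorm. Qed.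
Let Sgpsd : psd Sg. Proof. exact: cov_psd (XG j0) (Xm j0) (Xc j0). Qed.
Let ti0 : 0 <= t^-1. Proof. by rewrite invr_ge0 ltW. Qed.
Let beta0 : 0 <= b / t. Proof. by rewrite mulr_ge0. Qed.

Let al j : R := n%:R^-1 * r j ^+ 2.
Let al0 j : 0 <= al j. Proof. by rewrite mulr_ge0 ?sqr_ge0// invr_ge0. Qed.

Let H (y : conf) := sample_cov r y + A.
Let M y := invmx (H y).
Let L y := M y *m B *m M y.
Let tau y := \tr (Sg *m M y).
Let eta y := \tr (Sg *m M y *m B *m M y).

Let sample_covE (y : conf) : sample_cov r y = \sum_j al j *: (y j *m (y j)^T).
Proof. by rewrite /sample_cov scaler_sumr; apply: eq_bigr => j _; rewrite scalerA. Qed.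

Let Hpos y : pos_ge t (H y).
Proof.
split.
  rewrite /H linearD /= At.1 sample_covE linear_sum /=; congr (_ + _).
  by apply: eq_bigr => j _; rewrite linearZ /= trmx_mul trmxK.
move=> u; rewrite /H mulmxDl dotDr ler_wpDl ?At.2// sample_covE mulmx_suml dot_sumr.
rewrite sumr_ge0// => j _; rewrite -scalemxAl rank1_mul !dotZr (dotC u).
by rewrite mulr_ge0// -expr2 sqr_ge0.
Qed.

(** The resolvent that does not see the [j]-th vector is the one at the
    configuration where this vector is zero. *)
Let HE (y : conf) j : H y = rank1_upd (H (upd y j 0)) (al j) (y j).
Proof.
rewrite /H /rank1_upd !sample_covE (bigD1 j)//= [in RHS](bigD1 j)//= /upd eqxx.
rewrite mul0mx scaler0 add0r [in RHS]addrAC; congr (_ + _); rewrite addrC; congr (_ + _).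
by apply: eq_bigr => i /negbTE ->.
Qed.

Let updupd (y : conf) j x : upd (upd y j x) j 0 = upd y j 0.
Proof. by apply/funext => i; rewrite /upd; case: eqP. Qed.

Let Mb y : op_bound (M y) t^-1. Proof. exact: pos_ge_inv_bound. Qed.
Let Ms y : (M y)^T = M y. Proof. exact: (pos_ge_inv_sym (Hpos y)). Qed.
Let Ls y : (L y)^T = L y.
Proof. by rewrite /L !trmx_mul Ms Bpsd.1 mulmxA. Qed.
Let Lb y : op_bound (L y) (b / t ^+ 2).
Proof.
rewrite (_ : b / t ^+ 2 = t^-1 * b * t^-1); last by field; rewrite gt_eqF.
by apply: op_boundM => //; [exact: mulr_ge0|exact: op_boundM].
Qed.

Let tau_ge0 y : 0 <= tau y.
Proof.
apply: (cov_trace_ge0 (XG j0) (Xm j0) (Xc j0)); split; first exact: Ms.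
by move=> u; rewrite quadE; exact: (pos_ge_inv_ge0 t0).
Qed.

Let eta_ge0 y : 0 <= eta y.
Proof.
rewrite /eta -!mulmxA [M y *m _]mulmxA.
apply: (cov_trace_ge0 (XG j0) (Xm j0) (Xc j0)); split; first exact: Ls.
move=> u; rewrite quadE /L -!mulmxA (dot_sym _ _ (Ms y)) -quadE; exact: Bpsd.2.
Qed.

(** This control of [eta] by [tau] is what keeps [xi] bounded with no assumption
    on the dimension. *)
Let eta_le y : eta y <= b / t * tau y.
Proof.
have : 0 <= \tr (Sg *m (b / t *: M y - L y)).
  apply: (cov_trace_ge0 (XG j0) (Xm j0) (Xc j0)); split.
    by rewrite linearB linearZ /= Ms Ls.
  move=> u; rewrite quadE mulmxBl dotBr -scalemxAl dotZr subr_ge0.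
  rewrite /L -!mulmxA (dot_sym _ _ (Ms y)).
  apply: (le_trans (ler_norm _)); apply: (le_trans (op_bound_dot _ _ Bb)).
  rewrite -expr2 l2norm_sqr mulrAC -mulrA ler_wpM2l//.
  by rewrite ler_pdivlMr// mulrC; exact: pos_ge_inv_quad.
by rewrite mulmxBr linearB /= -scalemxAr linearZ /= subr_ge0 /L !mulmxA.
Qed.

Let tau_loo y j : 0 <= tau (upd y j 0) - tau y <= sg / t.
Proof.
by rewrite /tau /M (HE y j); apply: rank1_tau.
Qed.

Let eta_loo y j : `|eta y - eta (upd y j 0)| <= 3 * (b * sg / t ^+ 2).
Proof.
by rewrite /eta /M (HE y j); apply: rank1_eta.
Qed.

Let mxH : measurable_matrix H.
Proof.
apply: mxD; last exact: mx_cst.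
have h : measurable_matrix (fun y : conf => \sum_j al j *: (y j *m (y j)^T)).
  apply: mx_sum => j; apply: mxZ; first exact: mf_cst.
  by apply: mxM; [exact: mx_coord|apply: mx_tr; exact: mx_coord].
by move=> a c d' T' Y mY; under eq_fun do rewrite sample_covE; exact: h.
Qed.

Let mxM' : measurable_matrix M.
Proof. by apply: mx_inv => // y; exact: (pos_ge_unit t0 (Hpos y)). Qed.

Let mxL : measurable_matrix L.
Proof. by apply: mxM => //; apply: mxM => //; exact: mx_cst. Qed.

Let mf_tau : measurable_functional tau.
Proof. by apply: mf_tr; apply: mxM => //; exact: mx_cst. Qed.

Let mf_eta : measurable_functional eta.
Proof. by apply: mf_tr; do 2 apply: mxM => //; [apply: mxM => //|]; exact: mx_cst. Qed.

Local Notation E F := (Ex P (fun w => F (X^~ w))).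
Local Notation LX F := (L1 P (fun w => F (X^~ w))).

Let LX_bounded F K : measurable_functional F -> (forall y, `|F y| <= K) -> LX F.
Proof. by move=> mF FK; apply: (@L1_bounded _ _ _ P _ K) => //; exact: measurable_on_X. Qed.

Let tau_bounded y : `|tau y| <= p%:R * (sg / t).
Proof. by apply: mxtrace_le; [exact: op_boundM|exact: mulr_ge0]. Qed.

Let eta_bounded y : `|eta y| <= b / t * (p%:R * (sg / t)).
Proof.
rewrite ger0_norm//; apply: (le_trans (eta_le y)); rewrite ler_wpM2l//.
exact: le_trans (ler_norm _) (tau_bounded y).
Qed.

Let taub := E tau.
Let etab := E eta.
Let LXtau : LX tau. Proof. exact: LX_bounded tau_bounded. Qed.
Let LXeta : LX eta. Proof. exact: LX_bounded eta_bounded. Qed.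
Let taub0 : 0 <= taub. Proof. by apply: Ex_ge0. Qed.
Let etab0 : 0 <= etab. Proof. by apply: Ex_ge0. Qed.
Let etab_le : etab <= b / t * taub.
Proof. by rewrite -ExZ//; apply: le_Ex => //; exact: L1Z. Qed.

Let rn : R := Num.sqrt n%:R.
Let rn2 : rn ^+ 2 = n%:R. Proof. by rewrite sqr_sqrtr. Qed.
Let rn1 : 1 <= rn.
Proof.
have : 1 <= rn ^+ 2 by rewrite rn2 ler1n.
have r0 : 0 <= rn by exact: sqrtr_ge0.
by move=> h; rewrite leNgt; apply/negP => h'; nra.
Qed.

(** The factor 2 leaves room over the constant [2] of Efron-Stein, so that no
    square root of 2 appears; likewise for [eta] with [6] and [18]. *)
Let conc_tau : LX (fun y => (tau y - taub) ^+ 2) /\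
  E (fun y => (tau y - taub) ^+ 2) <= (2 * rn * sg / t) ^+ 2.
Proof.
split.
  apply: (@LX_bounded (fun y => (tau y - taub) ^+ 2) ((p%:R * (sg / t) + `|taub|) ^+ 2)).
    by apply: mfX; apply: mfB => //; exact: mf_cst.
  move=> y; rewrite normrX lerXn2r// ?nnegrE ?addr_ge0//.
    by rewrite mulr_ge0// mulr_ge0.
  by apply: (le_trans (ler_normB _ _)); rewrite lerD2r.
have loo y k : `|tau y - tau (upd y k 0)| <= sg / t.
  by rewrite distrC ger0_norm; case/andP: (tau_loo y k).
apply: (le_trans (efron_stein rX indX mf_tau tau_bounded loo)).
have h0 : 0 <= rn ^+ 2 * (sg / t) ^+ 2 by rewrite mulr_ge0// sqr_ge0.
rewrite -rn2 (_ : (2 * rn * sg / t) ^+ 2 = 4 * (rn ^+ 2 * (sg / t) ^+ 2)); last by ring.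
lra.
Qed.

Let conc_eta : LX (fun y => (eta y - etab) ^+ 2) /\
  E (fun y => (eta y - etab) ^+ 2) <= (6 * rn * (b * sg / t ^+ 2)) ^+ 2.
Proof.
split.
  apply: (@LX_bounded (fun y => (eta y - etab) ^+ 2) ((b / t * (p%:R * (sg / t)) + `|etab|) ^+ 2)).
    by apply: mfX; apply: mfB => //; exact: mf_cst.
  move=> y; rewrite normrX lerXn2r// ?nnegrE ?addr_ge0//.
    by rewrite mulr_ge0// mulr_ge0// mulr_ge0.
  by apply: (le_trans (ler_normB _ _)); rewrite lerD2r.
apply: (le_trans (efron_stein rX indX mf_eta eta_bounded eta_loo)).
set z := b * sg / t ^+ 2.
have h0 : 0 <= rn ^+ 2 * z ^+ 2 by rewrite mulr_ge0// sqr_ge0.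
rewrite -rn2 (_ : (6 * rn * z) ^+ 2 = 36 * (rn ^+ 2 * z ^+ 2)); last by ring.
rewrite (_ : 2 * rn ^+ 2 * (3 * z) ^+ 2 = 18 * (rn ^+ 2 * z ^+ 2)); last by ring.
lra.
Qed.

Let updj (y : conf) j x : upd y j x j = x. Proof. by rewrite /upd eqxx. Qed.

(** ** Moments of one vector, conditionally on the others *)

Let mf_dotj j (u : conf -> V) : measurable_matrix u ->
  measurable_functional (fun y => dot (u (upd y j 0)) (y j)).
Proof. by move=> mu; apply: mf_dot; [exact: mx_upd|exact: mx_coord]. Qed.

(** The coefficients are taken at the configuration without the [j]-th vector, so
    that they are constants for the conditional expectation. *)
Let pairF (u w : conf -> V) j (y : conf) : R :=
  dot (u (upd y j 0)) (y j) * dot (w (upd y j 0)) (y j).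

Let mf_pair u w j : measurable_matrix u -> measurable_matrix w ->
  measurable_functional (pairF u w j).
Proof. by move=> mu mw; apply: mfM; exact: mf_dotj. Qed.

Let pair_sqr u w j U W : measurable_matrix u -> measurable_matrix w ->
  (forall y, l2norm (u y) <= U) -> (forall y, l2norm (w y) <= W) ->
  LX (fun y => pairF u w j y ^+ 2) /\
  E (fun y => pairF u w j y ^+ 2) <= (2 * sg * U * W) ^+ 2.
Proof.
move=> mu mw uU wW.
apply: (@L1_cond _ _ _ _ _ P X rX indX (fun y => pairF u w j y ^+ 2) j).
- by apply: mfX; exact: mf_pair.
- by move=> y; exact: sqr_ge0.
- move=> y; rewrite /pairF; under eq_fun do rewrite updupd updj.
    exact: (L1_dotX22 (XG j) (Xm j)).
- move=> y; rewrite /pairF; under eq_Ex do rewrite updupd updj.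
  exact: (Ex_dotX22_le (XG j) (Xm j) (Xc j) sg0 Sgb).
Qed.

Let pair_abs u w j U W : measurable_matrix u -> measurable_matrix w ->
  (forall y, l2norm (u y) <= U) -> (forall y, l2norm (w y) <= W) ->
  LX (fun y => `|pairF u w j y|) /\ E (fun y => `|pairF u w j y|) <= 2 * sg * U * W.
Proof.
move=> mu mw uU wW; have [I2 E2] := pair_sqr j mu mw uU wW.
have U0 := le_trans (l2norm_ge0 _) (uU (fun=> 0)).
have W0 := le_trans (l2norm_ge0 _) (wW (fun=> 0)).
have mp := measurable_on_X rX (mf_pair j mu mw).
have I1 : LX (pairF u w j).
  pose f z := pairF u w j (X^~ z).
  apply: (@eq_L1 _ _ _ P (fun z => f z * 1)) => [z|]; first by rewrite mulr1.
  apply: (@L1_mul _ _ _ P f (fun=> 1)) => //.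
  exact: L1_cst.
split; first exact: L1_norm.
by apply: Ex_norm_le_sqrt => //; rewrite !mulr_ge0.
Qed.

Let pair_L1 u w j U W : measurable_matrix u -> measurable_matrix w ->
  (forall y, l2norm (u y) <= U) -> (forall y, l2norm (w y) <= W) -> LX (pairF u w j).
Proof.
move=> mu mw uU wW; have [I1 _] := pair_abs j mu mw uU wW.
apply: (L1_le _ I1) => //; exact: (measurable_on_X rX (mf_pair j mu mw)).
Qed.

(** The cancellation behind the theorem. *)
Let pair_mean u w j U W : measurable_matrix u -> measurable_matrix w ->
  (forall y, l2norm (u y) <= U) -> (forall y, l2norm (w y) <= W) ->
  LX (fun y => dot (u (upd y j 0)) (Sg *m w (upd y j 0)) - pairF u w j y) /\
  E (fun y => dot (u (upd y j 0)) (Sg *m w (upd y j 0)) - pairF u w j y) = 0.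
Proof.
move=> mu mw uU wW.
have W0 := le_trans (l2norm_ge0 _) (wW (fun=> 0)).
have U0 := le_trans (l2norm_ge0 _) (uU (fun=> 0)).
have mD : measurable_functional (fun y => dot (u (upd y j 0)) (Sg *m w (upd y j 0))).
  apply: mf_dot; first exact: mx_upd.
  by apply: mxM; [exact: mx_cst|exact: mx_upd].
have I1 : LX (fun y => dot (u (upd y j 0)) (Sg *m w (upd y j 0)) - pairF u w j y).
  apply: L1B; last exact: pair_L1 uU wW.
  apply: (@LX_bounded (fun y => dot (u (upd y j 0)) (Sg *m w (upd y j 0))) (sg * (U * W))) => // y.
  exact: op_bound_dot_le.
split=> //.
apply: (@Ex_cond_eq0 _ _ _ _ _ P X rX indX
  (fun y => dot (u (upd y j 0)) (Sg *m w (upd y j 0)) - pairF u w j y) j) => //.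
- by apply: mfB => //; exact: mf_pair.
- move=> y; rewrite /pairF; under eq_fun do rewrite updupd updj.
  apply: L1B; first exact: L1_cst.
  exact: (L1_dotX2 (XG j) (Xm j)).
- move=> y; rewrite /pairF; under eq_Ex do rewrite updupd updj.
  rewrite ExB; [|exact: L1_cst|exact: (L1_dotX2 (XG j) (Xm j))].
  by rewrite Ex_cst (Ex_dotX2 (XG j) (Xm j) (Xc j)) subrr.
Qed.

Let quadF (Q : conf -> 'M[R]_p) j (y : conf) : R := dot (y j) (Q (upd y j 0) *m y j).

Let mf_quad Q j : measurable_matrix Q -> measurable_functional (quadF Q j).
Proof.
move=> mQ; apply: mf_dot; first exact: mx_coord.
by apply: mxM; [exact: mx_upd|exact: mx_coord].
Qed.

Let quad_dev Q j k : measurable_matrix Q -> (forall y, (Q y)^T = Q y) -> 0 <= k ->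
  (forall y, op_bound (Q y) k) ->
  LX (fun y => (quadF Q j y - \tr (Sg *m Q (upd y j 0))) ^+ 2) /\
  E (fun y => (quadF Q j y - \tr (Sg *m Q (upd y j 0))) ^+ 2) <= 2 * p%:R * (sg * k) ^+ 2.
Proof.
move=> mQ Qs k0 Qk.
apply: (@L1_cond _ _ _ _ _ P X rX indX
   (fun y => (quadF Q j y - \tr (Sg *m Q (upd y j 0))) ^+ 2) j).
- apply: mfX; apply: mfB; first exact: mf_quad.
  by apply: mf_tr; apply: mxM; [exact: mx_cst|exact: mx_upd].
- by move=> y; exact: sqr_ge0.
- move=> y; rewrite /quadF; under eq_fun do rewrite updupd updj.
  by have [] := quadX_var (XG j) (Xm j) (Xc j) sg0 Sgb (Qs (upd y j 0)) k0 (Qk _).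
- move=> y; rewrite /quadF; under eq_Ex do rewrite updupd updj.
  by have [] := quadX_var (XG j) (Xm j) (Xc j) sg0 Sgb (Qs (upd y j 0)) k0 (Qk _).
Qed.

Let C20 : 0 <= C2.
Proof.
have h : 0 <= C2 * n%:R by apply: le_trans pC2.
by move: h; rewrite pmulr_lge0// ltr0n.
Qed.

Let Lam : R := Num.sqrt (16 + 6 * C2).
Let Lam0 : 0 <= Lam. Proof. exact: sqrtr_ge0. Qed.
Let Lam2 : Lam ^+ 2 = 16 + 6 * C2.
Proof. by rewrite sqr_sqrtr// addr_ge0// mulr_ge0. Qed.

Let three_sq (a1 a2 a3 a4 : R) :
  (a1 - a4) ^+ 2 <= 3 * ((a1 - a2) ^+ 2 + (a2 - a3) ^+ 2 + (a3 - a4) ^+ 2).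
Proof.
have := sqr_ge0 ((a1 - a2) - (a2 - a3)); have := sqr_ge0 ((a2 - a3) - (a3 - a4)).
by have := sqr_ge0 ((a1 - a2) - (a3 - a4)); lra.
Qed.

(** The quadratic form is close to a trace at the configuration without the
    [j]-th vector, which is close to the trace at the full configuration, which is
    close to its mean. *)
Let quad_conc Q F j k c K1 (m : R) : measurable_matrix Q -> (forall y, (Q y)^T = Q y) ->
  0 <= k -> (forall y, op_bound (Q y) k) -> measurable_functional F ->
  (forall y, F y = \tr (Sg *m Q y)) ->
  (forall y, `|F (upd y j 0) - F y| <= c) ->
  LX (fun y => (F y - m) ^+ 2) -> E (fun y => (F y - m) ^+ 2) <= K1 ->
  LX (fun y => (quadF Q j y - m) ^+ 2) /\
  E (fun y => (quadF Q j y - m) ^+ 2) <= 3 * (2 * p%:R * (sg * k) ^+ 2 + c ^+ 2 + K1).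
Proof.
move=> mQ Qs k0 Qk mF FQ Fc I1 E1.
have [I2 E2] := quad_dev j mQ Qs k0 Qk.
have c0 : 0 <= c by exact: le_trans (normr_ge0 _) (Fc (fun=> 0)).
have mFd : measurable_functional (fun y => (F (upd y j 0) - F y) ^+ 2).
  by apply: mfX; apply: mfB => //; exact: mf_upd.
have I3 : LX (fun y => (F (upd y j 0) - F y) ^+ 2).
  apply: (@LX_bounded (fun y => (F (upd y j 0) - F y) ^+ 2) (c ^+ 2)) => // y.
  by rewrite normrX lerXn2r// nnegrE.
have E3 : E (fun y => (F (upd y j 0) - F y) ^+ 2) <= c ^+ 2.
  rewrite -[leRHS](Ex_cst P); apply: le_Ex => //; first exact: L1_cst.
  by move=> w; rewrite -real_normK ?num_real// lerXn2r// nnegrE.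
have IS := L1Z 3 (L1D (L1D I2 I3) I1).
have dom y : `|(quadF Q j y - m) ^+ 2| <= 3 * ((quadF Q j y - \tr (Sg *m Q (upd y j 0))) ^+ 2
    + (F (upd y j 0) - F y) ^+ 2 + (F y - m) ^+ 2).
  by rewrite ger0_norm ?sqr_ge0// -FQ; exact: three_sq.
have IQ : LX (fun y => (quadF Q j y - m) ^+ 2).
  apply: (L1_le _ IS) => //.
  have : measurable_functional (fun y => (quadF Q j y - m) ^+ 2).
    by apply: mfX; apply: mfB; [exact: mf_quad|exact: mf_cst].
  exact: measurable_on_X.
split=> //; apply: (@le_trans _ _ _ _ _ (le_Ex IQ IS _)).
  by move=> w; apply: le_trans (dom _); exact: ler_norm.
rewrite ExZ; last by do 2 apply: L1D => //.
rewrite ExD//; last exact: L1D.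
by rewrite ExD// ler_wpM2l// lerD// lerD.
Qed.

Let q j := quadF M j.
Let lam j := quadF L j.

Let conc_q j : LX (fun y => (q j y - taub) ^+ 2) /\
  E (fun y => (q j y - taub) ^+ 2) <= (Lam * rn * (sg / t)) ^+ 2.
Proof.
have [I1 E1] := conc_tau.
have loo y : `|tau (upd y j 0) - tau y| <= sg / t.
  by rewrite ger0_norm; case/andP: (tau_loo y j).
have [I2 E2] := @quad_conc M tau j _ _ _ taub mxM' Ms ti0 Mb mf_tau (fun=> erefl) loo I1 E1.
split=> //; apply: (le_trans E2).
set z := (sg / t) ^+ 2; have z0 : 0 <= z by exact: sqr_ge0.
have n1 : 1 <= n%:R :> R by rewrite ler1n.
have -> : (2 * rn * sg / t) ^+ 2 = 4 * (rn ^+ 2 * z) by rewrite /z; ring.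
have -> : (Lam * rn * (sg / t)) ^+ 2 = Lam ^+ 2 * (rn ^+ 2 * z) by rewrite /z; ring.
rewrite Lam2 rn2.
have pz : p%:R * z <= C2 * n%:R * z by rewrite ler_wpM2r.
have nz : z <= n%:R * z by rewrite ler_peMl.
lra.
Qed.

Let conc_lam j : LX (fun y => (lam j y - etab) ^+ 2) /\
  E (fun y => (lam j y - etab) ^+ 2) <= (3 * Lam * rn * (b * sg / t ^+ 2)) ^+ 2.
Proof.
have [I1 E1] := conc_eta.
have loo y : `|eta (upd y j 0) - eta y| <= 3 * (b * sg / t ^+ 2).
  by rewrite distrC; exact: eta_loo.
have etaL y : eta y = \tr (Sg *m L y) by rewrite /eta /L !mulmxA.
have k0 : 0 <= b / t ^+ 2 by apply: mulr_ge0 => //; rewrite invr_ge0; exact: sqr_ge0.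
have [I2 E2] := @quad_conc L eta j _ _ _ etab mxL Ls k0 Lb mf_eta etaL loo I1 E1.
split=> //; apply: (le_trans E2).
set z := (b * sg / t ^+ 2) ^+ 2; have z0 : 0 <= z by exact: sqr_ge0.
have n1 : 1 <= n%:R :> R by rewrite ler1n.
have -> : (sg * (b / t ^+ 2)) ^+ 2 = z by rewrite /z; congr (_ ^+ 2); ring.
have -> : (6 * rn * (b * sg / t ^+ 2)) ^+ 2 = 36 * (rn ^+ 2 * z) by rewrite /z; ring.
have -> : (3 * Lam * rn * (b * sg / t ^+ 2)) ^+ 2 = 9 * Lam ^+ 2 * (rn ^+ 2 * z).
  by rewrite /z; ring.
have -> : (3 * (b * sg / t ^+ 2)) ^+ 2 = 9 * z by rewrite /z; ring.
rewrite Lam2 rn2.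
have pz : p%:R * z <= C2 * n%:R * z by rewrite ler_wpM2r.
have nz : z <= n%:R * z by rewrite ler_peMl.
have : 0 <= C2 * n%:R * z by do 2 apply: mulr_ge0 => //.
lra.
Qed.

(** ** The equivalent with constant parameters *)

Let s j : R := al j * sg.
Let s0 j : 0 <= s j. Proof. exact: mulr_ge0. Qed.
Let sumS : \sum_j s j <= C1.
Proof.
apply: le_trans sumC1; rewrite le_eqVlt; apply/orP; left; apply/eqP.
by apply: eq_bigr => j _; rewrite /s /al mulrC [_^-1 * _]mulrC mulrC.
Qed.
Let C10 : 0 <= C1. Proof. by apply: le_trans sumS; rewrite sumr_ge0. Qed.
Let s_le j : s j <= C1.
Proof. by apply: le_trans sumS; rewrite (bigD1 j)//= lerDl sumr_ge0. Qed.

Let c j := shrink (al j) taub.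
Let phib j := shrink2 (al j) taub etab.
Let cb j : 0 <= c j <= 1. Proof. exact: shrink_bounds. Qed.
Let phibb j : 0 <= phib j <= b / t. Proof. exact: shrink2_bounds. Qed.

Let gamb := \sum_j al j * c j.
Let xib := \sum_j al j * phib j.
Let gamb0 : 0 <= gamb.
Proof. by rewrite sumr_ge0// => j _; rewrite mulr_ge0//; case/andP: (cb j). Qed.
Let xib0 : 0 <= xib.
Proof. by rewrite sumr_ge0// => j _; rewrite mulr_ge0//; case/andP: (phibb j). Qed.
Let xib_le : xib * sg <= b / t * C1.
Proof.
apply: (@le_trans _ _ (b / t * \sum_j s j)); last by rewrite ler_wpM2l.
rewrite mulr_suml mulr_sumr; apply: ler_sum => j _; rewrite mulrAC -/(s j) mulrC.
by rewrite ler_wpM2r//; case/andP: (phibb j).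
Qed.

Let kap : R := (1 + C1 / t) / t ^+ 2.
Let kap0 : 0 <= kap.
Proof.
apply: mulr_ge0; last by rewrite invr_ge0; exact: sqr_ge0.
by apply: addr_ge0 => //; exact: mulr_ge0.
Qed.

Let g := detG A Sg gamb *m v.
Let k := detK A B Sg gamb xib *m v.
Let g_le : l2norm g <= t^-1.
Proof.
by have := detG_bound t0 At Sgpsd gamb0 v; rewrite v1 mulr1.
Qed.
Let k_le : l2norm k <= kap * b.
Proof.
have := detK_bound t0 b0 sg0 At Bb Sgpsd Sgb gamb0 xib0 v; rewrite v1 mulr1.
move/le_trans; apply; rewrite /kap mulrAC ler_wpM2r//.
  by rewrite invr_ge0; exact: sqr_ge0.
by rewrite mulrDl mul1r lerD2l (_ : C1 / t * b = b / t * C1)//; ring.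
Qed.

Let h := Sg *m g.
Let kk := Sg *m k.
Let h_le : l2norm h <= sg / t.
Proof. by apply: (le_trans (Sgb _)); rewrite ler_wpM2l. Qed.
Let kk_le : l2norm kk <= sg * (kap * b).
Proof. by apply: (le_trans (Sgb _)); rewrite ler_wpM2l. Qed.

(** The contribution of the [j]-th vector to the differentiated resolvent
    identity. *)
Let Tj j (y : conf) : R := al j * (c j * dot v (L y *m h) + c j * dot v (M y *m kk)
  - phib j * dot v (M y *m h)
  - (dot v (L y *m y j) * dot (y j) g + dot v (M y *m y j) * dot (y j) k)).

(** The identity [L - K = L (gamma Sigma - S) G - xi M Sigma G +
    M (gamma Sigma - S) K], obtained from [gamma Sigma - S = G^-1 - M^-1]. *)
Let sumT y : \sum_j Tj j y = dot v (L y *m v) - dot v (detK A B Sg gamb xib *m v).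
Proof.
have Hb : pos_ge t (A + gamb *: Sg) := pos_ge_shift At Sgpsd gamb0.
have Hg : (A + gamb *: Sg) *m g = v by rewrite mulmxA (pos_ge_mulV t0 Hb) mul1mx.
have Hk : (A + gamb *: Sg) *m k = B *m g + xib *: h.
  by rewrite /k /detK -!mulmxA mulmxA (pos_ge_mulV t0 Hb) mul1mx -/g mulmxDl -scalemxAl.
have Hsub (u w : V) : (A + gamb *: Sg) *m u = w ->
    gamb *: (Sg *m u) - sample_cov r y *m u = w - H y *m u.
  by move=> <-; rewrite /H !mulmxDl -scalemxAl [A *m u + _]addrC opprD addrACA subrr addr0.
have e1 := Hsub _ _ Hg; have e2 := Hsub _ _ Hk.
rewrite -/h in e1; rewrite -/kk in e2.
have -> : \sum_j Tj j y = dot v (L y *m (gamb *: h - sample_cov r y *m g))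
   + dot v (M y *m (gamb *: kk - sample_cov r y *m k)) - xib * dot v (M y *m h).
  rewrite !(mulmxBr, dotBr) -!scalemxAr !dotZr.
  have ES (N : 'M[R]_p) u : dot v (N *m (sample_cov r y *m u)) =
      \sum_j al j * (dot v (N *m y j) * dot (y j) u).
    rewrite sample_covE mulmx_suml mulmx_sumr dot_sumr; apply: eq_bigr => j _.
    by rewrite -scalemxAl rank1_mul -!scalemxAr !dotZr; ring.
  rewrite !ES /gamb /xib !mulr_suml -!sumrB -big_split -sumrB; apply: eq_bigr => j _ /=.
  by rewrite /Tj; ring.
rewrite e1 e2 !(mulmxBr, mulmxDr, dotBr, dotDr).
have LH u : L y *m (H y *m u) = M y *m (B *m u).
  by rewrite /L -!mulmxA (mulmxA (M y) (H y)) (pos_ge_mulK t0 (Hpos y)) mul1mx.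
have MH u : M y *m (H y *m u) = u.
  by rewrite mulmxA (pos_ge_mulK t0 (Hpos y)) mul1mx.
rewrite LH MH -!scalemxAr !dotZr -/k; ring.
Qed.

Let cF (u : V) (y : conf) := u.
Let MF (u : V) (y : conf) := M y *m u.
Let LF (u : V) (y : conf) := L y *m u.

Let mx_MF u : measurable_matrix (MF u). Proof. by apply: mxM => //; exact: mx_cst. Qed.
Let mx_LF u : measurable_matrix (LF u). Proof. by apply: mxM => //; exact: mx_cst. Qed.
Let mx_cF u : measurable_matrix (cF u). Proof. exact: mx_cst. Qed.
Let MF_le u U : l2norm u <= U -> forall y, l2norm (MF u y) <= t^-1 * U.
Proof. by move=> uU y; apply: (le_trans (Mb y _)); rewrite ler_wpM2l. Qed.
Let bt20 : 0 <= b / t ^+ 2.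
Proof. by apply: mulr_ge0 => //; rewrite invr_ge0; exact: sqr_ge0. Qed.
Let LF_le u U : l2norm u <= U -> forall y, l2norm (LF u y) <= b / t ^+ 2 * U.
Proof. by move=> uU y; apply: (le_trans (Lb y _)); rewrite ler_wpM2l. Qed.

(** The centred part of [Tj]: resolvents without the [j]-th vector, and damping
    factors replaced by constants. *)
Let Zj j (y : conf) : R := al j * (
   c j * (dot (LF v (upd y j 0)) (Sg *m cF g (upd y j 0)) - pairF (LF v) (cF g) j y)
   + c j * (dot (MF v (upd y j 0)) (Sg *m cF k (upd y j 0)) - pairF (MF v) (cF k) j y)
   - phib j * (dot (MF v (upd y j 0)) (Sg *m cF g (upd y j 0)) - pairF (MF v) (cF g) j y)).

Let dj j y := shrink (al j) (q j y).
Let phij j y := shrink2 (al j) (q j y) (lam j y).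

(** Sherman-Morrison for [M] and [L]. The first three summands come from removing
    the [j]-th vector from the resolvents, the last two from replacing the
    damping factors by constants. *)
Let TZ j y : Tj j y - Zj j y = al j * (
   c j * (- (al j * dj j y) * (pairF (MF v) (LF h) j y + pairF (LF v) (MF h) j y) +
     (al j * dj j y) * (al j * dj j y * lam j y) * pairF (MF v) (MF h) j y)
   + c j * (- (al j * dj j y) * pairF (MF v) (MF kk) j y)
   + phib j * (al j * dj j y * pairF (MF v) (MF h) j y)
   + (c j - dj j y) * (pairF (LF v) (cF g) j y + pairF (MF v) (cF k) j y)
   - (phib j - phij j y) * pairF (MF v) (cF g) j y).
Proof.
pose y0 := upd y j 0; pose x := y j.
have M0s := Ms y0; have L0s := Ls y0.
have My : M y = invmx (rank1_upd (H y0) (al j) x) by rewrite /M (HE y j).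
have E1 u w : dot u (M y *m w) = dot u (M y0 *m w) -
    (al j * dj j y) * (dot (M y0 *m u) x * dot (M y0 *m w) x).
  have := rank1_dot_inv x t0 (Hpos y0) (al0 j) u w; rewrite -My -/(M y0).
  by move/eqP; rewrite subr_eq => /eqP ->; rewrite /dj /q /quadF -/y0 -/x /shrink !(dotC x); ring.
have E2 u w : dot u (L y *m w) = dot u (L y0 *m w) +
   (- (al j * dj j y) * (dot (M y0 *m u) x * dot (L y0 *m w) x + dot (L y0 *m u) x * dot (M y0 *m w) x)
    + (al j * dj j y) * (al j * dj j y * lam j y) * (dot (M y0 *m u) x * dot (M y0 *m w) x)).
  have := rank1_dot_L x t0 (Hpos y0) (al0 j) Bpsd u w; rewrite -My -/(M y0) -/(L y0) -/(L y).
  by move/eqP; rewrite subr_eq => /eqP ->; rewrite /dj /lam /q /quadF -/y0 -/x /shrink !(dotC x); ring.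
have E3 : dot v (M y *m x) = dj j y * dot (M y0 *m v) x.
  by have := rank1_invx x t0 (Hpos y0) (al0 j); rewrite -My => ->; rewrite dotZr (dot_sym v x M0s).
have E4 : dot v (L y *m x) = dj j y * dot (L y0 *m v) x - phij j y * dot (M y0 *m v) x.
  have := rank1_Lx x t0 (Hpos y0) (al0 j) B; rewrite -My -/(M y0) -/(L y0) -/(L y) => ->.
  rewrite dotBr !dotZr (dot_sym v x M0s) (dot_sym v x L0s) /phij /shrink2 /dj /q /lam /quadF -/y0 -/x /shrink.
  by ring.
rewrite /Tj /Zj /pairF /cF /MF /LF -/y0 -/x -/h -/kk (E2 v h) E3 E4.
rewrite (E1 v kk) (E1 v h) (dotC x g) (dotC x k).
rewrite -(dot_sym v h M0s) -(dot_sym v kk M0s) -(dot_sym v h L0s).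
ring.
Qed.

Let bd (F : conf -> R) (e : R) := LX F /\ E F <= e.

Let bdD F1 F2 e1 e2 : bd F1 e1 -> bd F2 e2 -> bd (fun y => F1 y + F2 y) (e1 + e2).
Proof. by move=> [I1 h1] [I2 h2]; split; [exact: L1D|rewrite ExD// lerD]. Qed.

Let bdZ F1 e1 a : 0 <= a -> bd F1 e1 -> bd (fun y => a * F1 y) (a * e1).
Proof. by move=> a0 [I1 h1]; split; [exact: L1Z|rewrite ExZ// ler_wpM2l]. Qed.

Let q_ge0 j y : 0 <= q j y.
Proof. exact: (pos_ge_inv_ge0 t0 (Hpos _)). Qed.

Let lam_bounds j y : 0 <= lam j y <= b / t * q j y.
Proof.
rewrite (rank1_lam_ge0 (y j) (Hpos (upd y j 0)) Bpsd).
exact: (rank1_lam_le (y j) t0 (Hpos (upd y j 0)) b0 Bb).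
Qed.

Let bd_pair u w j U W : measurable_matrix u -> measurable_matrix w ->
  (forall y, l2norm (u y) <= U) -> (forall y, l2norm (w y) <= W) ->
  bd (fun y => `|pairF u w j y|) (2 * sg * U * W).
Proof. by move=> mu mw uU wW; exact: pair_abs. Qed.

Let bd_mix F (K : R) u w j U W : measurable_functional F -> 0 <= K ->
  LX (fun y => F y ^+ 2) -> E (fun y => F y ^+ 2) <= K ^+ 2 ->
  measurable_matrix u -> measurable_matrix w ->
  (forall y, l2norm (u y) <= U) -> (forall y, l2norm (w y) <= W) ->
  bd (fun y => `|F y * pairF u w j y|) (K * (2 * sg * U * W)).
Proof.
move=> mF K0 I1 E1 mu mw uU wW; have [I2 E2] := pair_sqr j mu mw uU wW.
have U0 := le_trans (l2norm_ge0 _) (uU (fun=> 0)).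
have W0 := le_trans (l2norm_ge0 _) (wW (fun=> 0)).
have mF' := measurable_on_X rX mF; have mp := measurable_on_X rX (mf_pair j mu mw).
split; first by apply: L1_norm; exact: L1_mul.
by apply: CauchySchwarz => //; rewrite !mulr_ge0.
Qed.

Let MFv y : l2norm (MF v y) <= t^-1 * 1. Proof. by apply: MF_le; rewrite v1. Qed.
Let LFv y : l2norm (LF v y) <= b / t ^+ 2 * 1. Proof. by apply: LF_le; rewrite v1. Qed.
Let cFg y : l2norm (cF g y) <= t^-1. Proof. exact: g_le. Qed.
Let cFk y : l2norm (cF k y) <= kap * b. Proof. exact: k_le. Qed.

Let base j y := al j ^+ 2 * (`|pairF (MF v) (LF h) j y| + `|pairF (LF v) (MF h) j y|
  + 2 * (b / t) * `|pairF (MF v) (MF h) j y| + `|pairF (MF v) (MF kk) j y|).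
(** [crude] bounds the replacement errors of the damping factors by constants,
    [sharp] by the fluctuations of [q] and [lam]. *)
Let crude j y := base j y + al j * (`|pairF (LF v) (cF g) j y| +
  `|pairF (MF v) (cF k) j y| + b / t * `|pairF (MF v) (cF g) j y|).
Let sharp j y := base j y + al j ^+ 2 * (`|(q j y - taub) * pairF (LF v) (cF g) j y|
  + `|(q j y - taub) * pairF (MF v) (cF k) j y| + `|(lam j y - etab) * pairF (MF v) (cF g) j y|
  + 2 * (b / t) * `|(q j y - taub) * pairF (MF v) (cF g) j y|).

Let TZ_le j y : `|Tj j y - Zj j y| <= crude j y /\ `|Tj j y - Zj j y| <= sharp j y.
Proof.
have /andP[l0 l1] := lam_bounds j y.
have /andP[d0 d1] : 0 <= dj j y <= 1 by exact: shrink_bounds.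
have /andP[c0 c1] := cb j; have /andP[ph0 ph1] := phibb j.
have adl0 : 0 <= al j * dj j y * lam j y by apply: mulr_ge0 => //; exact: mulr_ge0.
have adl1 : al j * dj j y * lam j y <= b / t.
  exact: (rank1_allamd (y j) t0 (Hpos (upd y j 0)) (al0 j) b0 Bb).
have [cd1 cd2] := shrink_diff (al0 j) taub0 (q_ge0 j y).
have [ph1' ph2'] := shrink2_diff (al0 j) taub0 (q_ge0 j y) beta0 etab0 etab_le l0 l1.
rewrite -/(c j) -/(dj j y) in cd1 cd2; rewrite -/(phib j) -/(phij j y) in ph1' ph2'.
rewrite (distrC taub) in cd2; rewrite (distrC etab) (distrC taub) in ph2'.
rewrite TZ /crude /sharp /base.
set p1 := pairF (MF v) (LF h) j y; set p2 := pairF (LF v) (MF h) j y.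
set p3 := pairF (MF v) (MF h) j y; set p4 := pairF (MF v) (MF kk) j y.
set p5 := pairF (LF v) (cF g) j y; set p6 := pairF (MF v) (cF k) j y.
set p7 := pairF (MF v) (cF g) j y.
set cc := c j in c0 c1 cd1 cd2 *; set dd := dj j y in d0 d1 adl0 adl1 cd1 cd2 *.
set f1 := phib j in ph0 ph1 ph1' ph2' *; set f2 := phij j y in ph1' ph2' *.
set a := al j in adl0 adl1 cd2 ph2' *; have a0 : 0 <= a := al0 j.
set qq := q j y - taub in cd2 ph2' *; set ll := lam j y - etab in ph2' *.
set be := b / t in ph1 ph1' ph2' adl1 *.
have ad0 : 0 <= a * dd by exact: mulr_ge0.
have ada : a * dd <= a by rewrite ler_piMr.
have main (x z : R) : `|cc - dd| <= x -> `|f1 - f2| <= z ->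
  `|a * (cc * (- (a * dd) * (p1 + p2) + a * dd * (a * dd * lam j y) * p3) +
      cc * (- (a * dd) * p4) + f1 * (a * dd * p3) +
     (cc - dd) * (p5 + p6) - (f1 - f2) * p7)| <=
  a ^+ 2 * (`|p1| + `|p2| + 2 * be * `|p3| + `|p4|) + a * (x * (`|p5| + `|p6|) + z * `|p7|).
Proof.
  move=> cx fz; rewrite (normrM a) (ger0_norm a0).
  have -> : a ^+ 2 * (`|p1| + `|p2| + 2 * be * `|p3| + `|p4|) + a * (x * (`|p5| + `|p6|) + z * `|p7|)
    = a * ((a * (`|p1| + `|p2|) + a * be * `|p3|) + a * `|p4| + be * (a * `|p3|) +
      x * (`|p5| + `|p6|) + z * `|p7|) by ring.
  rewrite ler_wpM2l//.
  have pr (u1 u2 w1 w2 : R) : `|u1| <= u2 -> `|w1| <= w2 -> `|u1 * w1| <= u2 * w2.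
    by move=> h1 h2; rewrite normrM ler_pM.
  have pc (w1 w2 : R) : `|w1| <= w2 -> `|cc * w1| <= w2.
    by move=> h1; rewrite -[leRHS]mul1r; apply: (pr) => //; rewrite ger0_norm.
  have nad : `|a * dd| <= a by rewrite ger0_norm.
  apply: (le_trans (ler_normB _ _)); apply: lerD; last exact: pr.
  apply: (le_trans (ler_normD _ _)); apply: lerD; last first.
    by apply: (pr) => //; exact: ler_normD.
  apply: (le_trans (ler_normD _ _)); apply: lerD; last first.
    by apply: (pr); [by rewrite ger0_norm|exact: (pr)].
  apply: (le_trans (ler_normD _ _)); apply: lerD; last first.
    by apply: pc; apply: (pr) => //; rewrite normrN.
  apply: pc; apply: (le_trans (ler_normD _ _)); apply: lerD.
    by apply: (pr); [by rewrite normrN|exact: ler_normD].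
  apply: (pr) => //; apply: (pr) => //; by rewrite ger0_norm.
split.
  apply: (le_trans (main 1 be cd1 ph1')); rewrite le_eqVlt; apply/orP; left; apply/eqP; ring.
rewrite !(normrM qq) !(normrM ll).
apply: (le_trans (main _ _ cd2 ph2')); rewrite le_eqVlt; apply/orP; left; apply/eqP; ring.
Qed.

Let K1 : R := 2 * (4 / t ^+ 4 + kap / t ^+ 2).
Let K2 : R := 2 * (2 / t ^+ 3 + kap / t).
Let K3 : R := Lam * (12 / t ^+ 4 + 2 * (kap / t ^+ 2)).
Let tiX0 m0 : 0 <= t^-1 ^+ m0. Proof. by rewrite exprn_ge0. Qed.

Let bd_eq F e1 e2 : e1 = e2 -> bd F e1 -> bd F e2. Proof. by move=> ->. Qed.
Let bt02 : 0 <= 2 * (b / t). Proof. exact: mulr_ge0. Qed.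
Let al2 j : 0 <= al j ^+ 2. Proof. exact: sqr_ge0. Qed.

Let bd_base j : bd (base j) (b * K1 * s j ^+ 2).
Proof.
have Mh := MF_le h_le; have Lh := LF_le h_le; have Mk := MF_le kk_le.
have B1 := bd_pair j (mx_MF v) (mx_LF h) MFv Lh.
have B2 := bd_pair j (mx_LF v) (mx_MF h) LFv Mh.
have B3 := bd_pair j (mx_MF v) (mx_MF h) MFv Mh.
have B4 := bd_pair j (mx_MF v) (mx_MF kk) MFv Mk.
have := bdZ (al2 j) (bdD (bdD (bdD B1 B2) (bdZ bt02 B3)) B4).
apply: bd_eq; rewrite /K1 /s; field; by rewrite gt_eqF.
Qed.

Let bd_crude j : bd (crude j) (b * (K1 * s j ^+ 2 + K2 * s j)).
Proof.
have B5 := bd_pair j (mx_LF v) (mx_cF g) LFv cFg.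
have B6 := bd_pair j (mx_MF v) (mx_cF k) MFv cFk.
have B7 := bd_pair j (mx_MF v) (mx_cF g) MFv cFg.
have := bdD (bd_base j) (bdZ (al0 j) (bdD (bdD B5 B6) (bdZ beta0 B7))).
apply: bd_eq; rewrite /K2 /s; field; by rewrite gt_eqF.
Qed.

Let rn0 : 0 <= rn. Proof. exact: le_trans rn1. Qed.
Let mf_q j : measurable_functional (q j). Proof. exact: mf_quad. Qed.
Let mf_lam j : measurable_functional (lam j). Proof. exact: mf_quad. Qed.
Let mf_qb j : measurable_functional (fun y => q j y - taub).
Proof. by apply: mfB => //; exact: mf_cst. Qed.
Let mf_lamb j : measurable_functional (fun y => lam j y - etab).
Proof. by apply: mfB => //; exact: mf_cst. Qed.

Let bd_sharp j : bd (sharp j) (b * (K1 * s j ^+ 2 + K3 * (rn * s j ^+ 2))).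
Proof.
have [Iq Eq] := conc_q j; have [Il El] := conc_lam j.
have kq0 : 0 <= Lam * rn * (sg / t) by do ! apply: mulr_ge0.
have kl0 : 0 <= 3 * Lam * rn * (b * sg / t ^+ 2).
  apply: mulr_ge0; first by do ! apply: mulr_ge0.
  by apply: mulr_ge0; [exact: mulr_ge0|rewrite invr_ge0; exact: sqr_ge0].
have B5 := bd_mix j (mf_qb j) kq0 Iq Eq (mx_LF v) (mx_cF g) LFv cFg.
have B6 := bd_mix j (mf_qb j) kq0 Iq Eq (mx_MF v) (mx_cF k) MFv cFk.
have B7 := bd_mix j (mf_lamb j) kl0 Il El (mx_MF v) (mx_cF g) MFv cFg.
have B8 := bd_mix j (mf_qb j) kq0 Iq Eq (mx_MF v) (mx_cF g) MFv cFg.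
have := bdD (bd_base j) (bdZ (al2 j) (bdD (bdD (bdD B5 B6) B7) (bdZ bt02 B8))).
apply: bd_eq; rewrite /K3 /s; field; by rewrite gt_eqF.
Qed.

Let mf_Tj j : measurable_functional (Tj j).
Proof.
have mv : measurable_matrix (fun _ : conf => v) by exact: mx_cst.
have mfl u : measurable_functional (fun y => dot v (L y *m u)).
  by apply: mf_dot => //; apply: mxM => //; exact: mx_cst.
have mfm u : measurable_functional (fun y => dot v (M y *m u)).
  by apply: mf_dot => //; apply: mxM => //; exact: mx_cst.
have mfc u : measurable_functional (fun y : conf => dot (y j) u).
  by apply: mf_dot; [exact: mx_coord|exact: mx_cst].
have mfly : measurable_functional (fun y => dot v (L y *m y j)).
  by apply: mf_dot => //; apply: mxM => //; exact: mx_coord.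
have mfmy : measurable_functional (fun y => dot v (M y *m y j)).
  by apply: mf_dot => //; apply: mxM => //; exact: mx_coord.
rewrite /Tj; apply: mfM; first exact: mf_cst.
apply: mfB; last by apply: mfD; apply: mfM.
apply: mfB; last by apply: mfM => //; exact: mf_cst.
by apply: mfD; apply: mfM => //; exact: mf_cst.
Qed.

Let Z_mean j : LX (Zj j) /\ E (Zj j) = 0.
Proof.
have [I1 E1] := pair_mean j (mx_LF v) (mx_cF g) LFv cFg.
have [I2 E2] := pair_mean j (mx_MF v) (mx_cF k) MFv cFk.
have [I3 E3] := pair_mean j (mx_MF v) (mx_cF g) MFv cFg.
have J1 := L1Z (c j) I1; have J2 := L1Z (c j) I2; have J3 := L1Z (phib j) I3.
split; first by apply: L1Z; apply: L1B => //; exact: L1D.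
rewrite /Zj ExZ; last by apply: L1B => //; exact: L1D.
rewrite ExB//; last exact: L1D.
by rewrite ExD// !ExZ// E1 E2 E3 !mulr0 addr0 subr0 mulr0.
Qed.

Let CB : R := K1 * (1 + C1) + K2 + K3.
Let msmall j : R := Num.min (s j) (rn * s j ^+ 2).
Let K10 : 0 <= K1.
Proof.
apply: mulr_ge0 => //; apply: addr_ge0; apply: mulr_ge0 => //.
  by rewrite -exprVn.
by rewrite -exprVn.
Qed.
Let K20 : 0 <= K2.
Proof.
apply: mulr_ge0 => //; apply: addr_ge0; apply: mulr_ge0 => //.
by rewrite -exprVn.
Qed.
Let K30 : 0 <= K3.
Proof.
apply: mulr_ge0 => //; apply: addr_ge0; first by apply: mulr_ge0 => //; rewrite -exprVn.
by apply: mulr_ge0 => //; apply: mulr_ge0 => //; rewrite -exprVn.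
Qed.

Let ssq j : s j ^+ 2 <= C1 * s j. Proof. by rewrite expr2 ler_wpM2r. Qed.
Let ssq' j : s j ^+ 2 <= rn * s j ^+ 2. Proof. by rewrite ler_peMl// sqr_ge0. Qed.

Let ExTj j : LX (Tj j) /\ `|E (Tj j)| <= b * CB * msmall j.
Proof.
have [IZ EZ] := Z_mean j; have [Ic Ec] := bd_crude j; have [If_ Ef] := bd_sharp j.
have mT := measurable_on_X rX (mf_Tj j).
have mZ : measurable_fun setT (fun w => Zj j (X^~ w)) := L1_measurable IZ.
have mTZ : measurable_fun setT (fun w => Tj j (X^~ w) - Zj j (X^~ w)).
  exact: measurable_funB.
have ITZ : L1 P (fun w => Tj j (X^~ w) - Zj j (X^~ w)).
  by apply: (L1_le mTZ Ic) => w; case: (TZ_le j (X^~ w)).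
have IT : LX (Tj j).
  by apply: eq_L1 (L1D ITZ IZ) => w; rewrite subrK.
split=> //.
have -> : E (Tj j) = Ex P (fun w => Tj j (X^~ w) - Zj j (X^~ w)).
  by rewrite ExB// EZ subr0.
have H1 : `|Ex P (fun w => Tj j (X^~ w) - Zj j (X^~ w))| <= b * (K1 * s j ^+ 2 + K2 * s j).
  apply: le_trans Ec; apply: Ex_norm_dom => // w.
  by case: (TZ_le j (X^~ w)).
have H2 : `|Ex P (fun w => Tj j (X^~ w) - Zj j (X^~ w))| <=
    b * (K1 * s j ^+ 2 + K3 * (rn * s j ^+ 2)).
  apply: le_trans Ef; apply: Ex_norm_dom => // w.
  by case: (TZ_le j (X^~ w)).
rewrite -(mulrA b) /msmall /CB; case: (leP (s j) (rn * s j ^+ 2)) => _.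
  apply: (le_trans H1); rewrite ler_wpM2l//.
  have := ler_wpM2l K10 (ssq j); have := mulr_ge0 K10 (s0 j); have := mulr_ge0 K30 (s0 j); lra.
apply: (le_trans H2); rewrite ler_wpM2l//.
have r0 : 0 <= rn * s j ^+ 2 by apply: mulr_ge0 => //; exact: sqr_ge0.
have := ler_wpM2l K10 (ssq' j); have := mulr_ge0 K20 r0; have := mulr_ge0 (mulr_ge0 K10 C10) r0; lra.
Qed.

Let stepB : LX (fun y => dot v (L y *m v)) /\
  `|E (fun y => dot v (L y *m v)) - dot v (detK A B Sg gamb xib *m v)| <=
  b * CB * \sum_j msmall j.
Proof.
have LT j := (ExTj j).1.
have I1 : LX (fun y => dot v (L y *m v)).
  apply: (@LX_bounded (fun y => dot v (L y *m v)) (b / t ^+ 2 * (1 * 1))).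
    by apply: mf_dot; [exact: mx_cst|apply: mxM => //; exact: mx_cst].
  by move=> y; apply: op_bound_dot_le => //; rewrite v1.
split=> //.
have -> : E (fun y => dot v (L y *m v)) - dot v (detK A B Sg gamb xib *m v) =
    \sum_j E (Tj j).
  rewrite -Ex_sum// -[X in _ - X](Ex_cst P) -ExB//; last exact: L1_cst.
  by apply: eq_Ex => w; rewrite -sumT.
apply: (le_trans (ler_norm_sum _ _ _)); rewrite mulr_sumr; apply: ler_sum => j _.
exact: (ExTj j).2.
Qed.

(** ** Replacing the random parameters by constants *)

Let gam y := \sum_j al j * shrink (al j) (tau y).
Let xi_ y := \sum_j al j * shrink2 (al j) (tau y) (eta y).
Let shr0 j y : 0 <= shrink (al j) (tau y).
Proof. by case/andP: (shrink_bounds (al0 j) (tau_ge0 y)). Qed.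
Let shr20 j y : 0 <= shrink2 (al j) (tau y) (eta y).
Proof. by case/andP: (shrink2_bounds (al0 j) (eta_ge0 y) (eta_le y) (tau_ge0 y) beta0). Qed.
Let gam0 y : 0 <= gam y. Proof. by rewrite sumr_ge0// => j _; rewrite mulr_ge0. Qed.
Let xi0 y : 0 <= xi_ y. Proof. by rewrite sumr_ge0// => j _; rewrite mulr_ge0. Qed.

Let Kv y := dot v (detK A B Sg (gam y) (xi_ y) *m v).

Let mf_shr j : measurable_functional (fun y => shrink (al j) (tau y)).
Proof.
apply: mfV; apply: mfD; first exact: mf_cst.
by apply: mfM => //; exact: mf_cst.
Qed.

Let mf_shr2 j : measurable_functional (fun y => shrink2 (al j) (tau y) (eta y)).
Proof.
apply: mfM; last by apply: mfX; exact: mf_shr.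
by apply: mfM => //; exact: mf_cst.
Qed.

Let mf_Kv : measurable_functional Kv.
Proof.
have mg : measurable_functional gam.
  by apply: mf_sum => j; apply: mfM => //; exact: mf_cst.
have mx : measurable_functional xi_.
  by apply: mf_sum => j; apply: mfM => //; exact: mf_cst.
have mG : measurable_matrix (fun y => detG A Sg (gam y)).
  apply: mx_inv => [y|].
    by apply: (pos_ge_unit t0); exact: pos_ge_shift.
  by apply: mxD; [exact: mx_cst|apply: mxZ => //; exact: mx_cst].
apply: mf_dot; first exact: mx_cst.
apply: mxM; last exact: mx_cst.
apply: mxM => //; apply: mxM => //.
by apply: mxD; [exact: mx_cst|apply: mxZ => //; exact: mx_cst].
Qed.

Let Kv_b : R := dot v (detK A B Sg gamb xib *m v).
Let dev j y := s j * (2 * (b * kap / t) * `|shrink (al j) (tau y) - c j| +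
   `|shrink2 (al j) (tau y) (eta y) - phib j| / t ^+ 2).

(** [K] depends on the sample through [gam] and [xi_] only, and these are sums
    of damping factors. *)
Let Kv_le y : `|Kv y - Kv_b| <= \sum_j dev j y.
Proof.
apply: (le_trans (detK_diff_bound t0 b0 sg0 At Bb Sgpsd Sgb (gam0 y) gamb0 (xi0 y) xib0 v1)).
have D1 : sg * `|gam y - gamb| <= \sum_j s j * `|shrink (al j) (tau y) - c j|.
  rewrite /gam /gamb -sumrB.
  apply: (le_trans (ler_wpM2l sg0 (ler_norm_sum _ _ _))).
  rewrite mulr_sumr; apply: ler_sum => j _.
  by rewrite -mulrBr (normrM (al j)) (ger0_norm (al0 j)) mulrA (mulrC sg).
have D2 : sg * `|xi_ y - xib| <= \sum_j s j * `|shrink2 (al j) (tau y) (eta y) - phib j|.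
  rewrite /xi_ /xib -sumrB.
  apply: (le_trans (ler_wpM2l sg0 (ler_norm_sum _ _ _))).
  rewrite mulr_sumr; apply: ler_sum => j _.
  by rewrite -mulrBr (normrM (al j)) (ger0_norm (al0 j)) mulrA (mulrC sg).
have -> : \sum_j dev j y = 2 * (b * kap / t) * \sum_j s j * `|shrink (al j) (tau y) - c j| +
   (\sum_j s j * `|shrink2 (al j) (tau y) (eta y) - phib j|) / t ^+ 2.
  rewrite mulr_sumr mulr_suml -big_split; apply: eq_bigr => j _ /=.
  by rewrite /dev; ring.
have tt0 : 0 <= (t ^+ 2)^-1 by rewrite invr_ge0; exact: sqr_ge0.
apply: lerD; last by rewrite ler_wpM2r.
apply: ler_pM => //.
  apply: mulr_ge0; last by rewrite -exprVn.
  by apply: mulr_ge0 => //; apply: addr_ge0 => //; exact: mulr_ge0.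
  exact: mulr_ge0.
have -> : 2 * (b * kap / t) = 2 * (b + b / t * C1) / t ^+ 3.
  by rewrite /kap; field; rewrite gt_eqF.
rewrite ler_wpM2r//; first by rewrite -exprVn.
by rewrite ler_wpM2l// lerD2l.
Qed.

Let bd_le F G e : measurable_functional F -> (forall y, 0 <= F y <= G y) ->
  bd G e -> bd F e.
Proof.
move=> mF FG [IG EG].
have IF : LX F.
  apply: (L1_le _ IG); first exact: measurable_on_X.
  by move=> w; case/andP: (FG (X^~ w)) => F0 FG'; rewrite ger0_norm.
by split=> //; apply: le_trans EG; apply: le_Ex => // w; case/andP: (FG (X^~ w)).
Qed.

Let CA : R := 2 * kap / t + 1 / t ^+ 3 + (4 * kap / t ^+ 2 + 10 / t ^+ 4).

Let bd_dev : bd (fun y => `|tau y - taub|) (2 * rn * sg / t) /\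
  bd (fun y => `|eta y - etab|) (6 * rn * (b * sg / t ^+ 2)).
Proof.
have [I1 E1] := conc_tau; have [I2 E2] := conc_eta.
have m1 : measurable_functional (fun y => tau y - taub) by apply: mfB => //; exact: mf_cst.
have m2 : measurable_functional (fun y => eta y - etab) by apply: mfB => //; exact: mf_cst.
have c1 : 0 <= 2 * rn * sg / t by do ! apply: mulr_ge0.
have c2 : 0 <= 6 * rn * (b * sg / t ^+ 2).
  apply: mulr_ge0; first exact: mulr_ge0.
  by apply: mulr_ge0; [exact: mulr_ge0|rewrite -exprVn].
split; split.
- apply: L1_norm; apply: L1B; [exact: LXtau|exact: L1_cst].
- by apply: Ex_norm_le_sqrt => //; exact: (measurable_on_X rX m1).
- apply: L1_norm; apply: L1B; [exact: LXeta|exact: L1_cst].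
- by apply: Ex_norm_le_sqrt => //; exact: (measurable_on_X rX m2).
Qed.

Let bd_dev1 j : bd (dev j) (b * CA * msmall j).
Proof.
have [T1 T2] := bd_dev.
have me : measurable_functional (dev j).
  apply: mfM; first exact: mf_cst.
  apply: mfD; apply: mfM; try exact: mf_cst; apply: mf_norm; apply: mfB; try exact: mf_cst.
    exact: mf_shr.
  exact: mf_shr2.
have tt0 : 0 <= (t ^+ 2)^-1 by rewrite -exprVn.
have bk0 : 0 <= 2 * (b * kap / t) by apply: mulr_ge0 => //; apply: mulr_ge0 => //; exact: mulr_ge0.
have e0 y : 0 <= dev j y.
  by apply: mulr_ge0 => //; apply: addr_ge0; apply: mulr_ge0.
have dd y := shrink_diff (al0 j) (tau_ge0 y) taub0.
have dd2 y := shrink2_diff (al0 j) (tau_ge0 y) taub0 beta0 (eta_ge0 y) (eta_le y) etab0 etab_le.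
have crudeE : bd (dev j) (b * (2 * kap / t + 1 / t ^+ 3) * s j).
  apply: (bd_le (G := fun=> b * (2 * kap / t + 1 / t ^+ 3) * s j)) => //; last first.
    by split; [exact: L1_cst|rewrite Ex_cst].
  move=> y; rewrite e0 /=.
  have -> : b * (2 * kap / t + 1 / t ^+ 3) * s j =
     s j * (2 * (b * kap / t) * 1 + b / t / t ^+ 2) by field; rewrite gt_eqF.
  rewrite ler_wpM2l//; apply: lerD.
    by rewrite ler_wpM2l//; case: (dd y).
  by rewrite ler_wpM2r//; case: (dd2 y).
have fineE : bd (dev j) (b * (4 * kap / t ^+ 2 + 10 / t ^+ 4) * (rn * s j ^+ 2)).
  have G1 := bdZ (mulr_ge0 (s0 j) (al0 j)) (bdD (bdZ bk0 T1) (bdZ tt0 (bdD T2 (bdZ bt02 T1)))).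
  have := bd_le me _ G1; rewrite (_ : s j * al j * _ = b * (4 * kap / t ^+ 2 + 10 / t ^+ 4) * (rn * s j ^+ 2)); last first.
    by rewrite /s; field; rewrite gt_eqF.
  apply => y; rewrite e0 /=.
  have -> : s j * al j * (2 * (b * kap / t) * `|tau y - taub| +
     (t ^+ 2)^-1 * (`|eta y - etab| + 2 * (b / t) * `|tau y - taub|)) =
   s j * (2 * (b * kap / t) * (al j * `|tau y - taub|) +
    (al j * `|eta y - etab| + 2 * (b / t) * (al j * `|tau y - taub|)) / t ^+ 2) by ring.
  rewrite ler_wpM2l//; apply: lerD.
    by rewrite ler_wpM2l//; case: (dd y).
  by rewrite ler_wpM2r//; case: (dd2 y).
split; first by case: crudeE.
have x1 : 0 <= 4 * kap / t ^+ 2 + 10 / t ^+ 4.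
  by apply: addr_ge0; apply: mulr_ge0 => //; (exact: mulr_ge0 || rewrite -exprVn).
have x2 : 0 <= 2 * kap / t + 1 / t ^+ 3.
  by apply: addr_ge0; apply: mulr_ge0 => //; (exact: mulr_ge0 || rewrite -exprVn).
rewrite -(mulrA b) /msmall /CA; case: (leP (s j) (rn * s j ^+ 2)) => _.
  apply: (le_trans crudeE.2); rewrite -mulrA ler_wpM2l//.
  by rewrite ler_wpM2r// lerDl.
apply: (le_trans fineE.2); rewrite -mulrA ler_wpM2l//.
by rewrite ler_wpM2r ?lerDr//; apply: mulr_ge0 => //; exact: sqr_ge0.
Qed.

Let stepA : LX Kv /\ `|E Kv - Kv_b| <= b * CA * \sum_j msmall j.
Proof.
have Ie j : LX (dev j) := (bd_dev1 j).1.
have Is : LX (fun y => \sum_j dev j y) by apply: L1_sum.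
have mD : measurable_functional (fun y => Kv y - Kv_b) by apply: mfB => //; exact: mf_cst.
have ID : LX (fun y => Kv y - Kv_b).
  by apply: (L1_le _ Is) => //; exact: (measurable_on_X rX mD).
have IK : LX Kv by apply: eq_L1 (L1D ID (L1_cst P Kv_b)) => w; rewrite subrK.
split=> //.
have -> : E Kv - Kv_b = E (fun y => Kv y - Kv_b).
  by rewrite ExB ?Ex_cst//; exact: L1_cst.
apply: (@le_trans _ _ (E (fun y => \sum_j dev j y))).
  by apply: Ex_norm_dom => //; exact: (measurable_on_X rX mD).
by rewrite Ex_sum// mulr_sumr; apply: ler_sum => j _; exact: (bd_dev1 j).2.
Qed.

(** The two steps add up: constant parameters against the true resolvents, and
    random against constant parameters. The minimum of the two rates is
    [min (s_j, sqrt n s_j^2)] up to the norm of [B], rewritten with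
    [n ^ (3/2) = n sqrt n]. *)
Theorem deterministic_equivalent :
  exists D : R,
   ('E_P[(fun w => quad (invmx (sample_cov r (fun j => X j w) + A) *m B *m invmx (sample_cov r (fun j => X j w) + A)) v)%R] -
    'E_P[(fun w =>
       let g := gamma r Sg (sample_cov r (fun j => X j w)) A in
       let x := xi r Sg (sample_cov r (fun j => X j w)) A B in
       quad (invmx (A + g *: Sg) *m (B + x *: Sg) *m invmx (A + g *: Sg)) v)%R])%E = D%:E /\
   `|D| <= equiv_const t C1 C2 * \sum_(j < n)
      Num.min (r j ^+ 2 / n%:R)
        (r j ^+ 4 / (n%:R `^ (3 / 2)) * opnorm Sg) * opnorm B * opnorm Sg.
Proof.
have [IL EL] := stepB; have [IK EK] := stepA.
exists (E (fun y => dot v (L y *m v)) - E Kv); split.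
  rewrite unlock EFinB; congr (_ - _)%E; rewrite -ExE//; apply: eq_integral => w _.
    by rewrite quadE.
  rewrite /= quadE /Kv /detK /detG; congr (dot v (_ *m v))%:E.
  have -> : gamma r Sg (sample_cov r (fun j => X j w)) A = gam (X^~ w).
    by rewrite /gamma /gam mulr_sumr; apply: eq_bigr => j _; rewrite mulrA.
  have -> // : xi r Sg (sample_cov r (fun j => X j w)) A B = xi_ (X^~ w).
  rewrite /xi /xi_ -mulrA mulr_suml mulr_sumr; apply: eq_bigr => j _.
  rewrite /shrink2 /shrink /al exprVn -/(tau (X^~ w)) -/(eta (X^~ w)); ring.
have -> : E (fun y => dot v (L y *m v)) - E Kv =
  (E (fun y => dot v (L y *m v)) - Kv_b) - (E Kv - Kv_b) by ring.
apply: (le_trans (ler_normB _ _)); apply: (le_trans (lerD EL EK)).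
rewrite le_eqVlt; apply/orP; left; apply/eqP.
have cE : equiv_const t C1 C2 = CB + CA by [].
rewrite (_ : _ + _ = equiv_const t C1 C2 * (b * \sum_j msmall j)); last first.
  by rewrite cE; ring.
congr (_ * _).
rewrite mulr_sumr; apply: eq_bigr => j _.
have nn0 : 0 < n%:R :> R by rewrite ltr0n.
have rnN0 : rn != 0 by rewrite gt_eqF// (lt_le_trans ltr01 rn1).
have n32 : n%:R `^ (3 / 2) = n%:R * rn :> R.
  have -> : 3 / 2 = 1 + 2^-1 :> R by field.
  by rewrite powRD ?powRr1 ?ler0n// ?powR12_sqrt ?ler0n// (gt_eqF nn0) implybT.
rewrite n32 [RHS]mulrAC [RHS]mulrC; congr (b * _).
rewrite /msmall minr_pMl//; congr (Num.min _ _); first by rewrite /s /al; ring.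
rewrite /s /al -rn2; field; exact: rnN0.
Qed.

End Model.

(** * The limit *)

Lemma loewner_pos_ge (R : realType) p (t : R) (A : 'M[R]_p) :
  loewner_le t%:M A -> pos_ge t A.
Proof.
case=> _ As [_ Ap]; split=> // u.
have := Ap u; rewrite quadE mulmxBl dotBr mul_scalar_mx dotZr subr_ge0.
by [].
Qed.

Theorem proposition3p2 (R : realType)
  (d : nat -> measure_display) (T : forall n, measurableType (d n))
  (P : forall n, probability (T n) R)
  (p : nat -> nat)
  (X : forall n, 'I_n -> T n -> 'cV[R]_(p n))
  (Sigma : forall n, 'M[R]_(p n))
  (r : forall n, 'I_n -> R)
  (t : R)
  (A B : forall n, 'M[R]_(p n))
  (v : forall n, 'cV[R]_(p n))
  (XG : forall n (j : 'I_n), gaussian_vector (P n) (X n j))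
  (Xmean : forall n (j : 'I_n), has_mean (P n) (X n j) 0)
  (Xcov : forall n (j : 'I_n), has_covariance (P n) (X n j) (Sigma n))
  (Xind : forall n, independent_vectors (P n) (X n))
  (r_gt0 : forall n (j : 'I_n), 0 < r n j)
  (t_gt0 : 0 < t)
  (At : forall n, (0 < n)%N -> loewner_le t%:M (A n))
  (Bpsd : forall n, (0 < n)%N -> psd (B n))
  (v1 : forall n, (0 < n)%N -> l2norm (v n) = 1)
  (p_n : (fun n => (p n)%:R / n%:R : R^o) =O_\oo (fun=> 1 : R^o))
  (trO : (fun n => \sum_(j < n) r n j ^+ 2 / n%:R * opnorm (Sigma n) : R^o)
     =O_\oo (fun=> 1 : R^o))
  (sumo : (fun n => \sum_(j < n)
        Num.min (r n j ^+ 2 / n%:R)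
          (r n j ^+ 4 / (n%:R `^ (3 / 2)) * opnorm (Sigma n))
        * opnorm (B n) * opnorm (Sigma n) : R^o)
     =o_\oo (fun=> 1 : R^o)) :
  let S n (w : T n) := sample_cov (r n) (fun j => X n j w) in
  ((fun n =>
      'E_(P n)[(fun w =>
         quad (invmx (S n w + A n) *m B n *m invmx (S n w + A n)) (v n))%R] -
      'E_(P n)[(fun w =>
         let g := gamma (r n) (Sigma n) (S n w) (A n) in
         let x := xi (r n) (Sigma n) (S n w) (A n) (B n) in
         quad (invmx (A n + g *: Sigma n) *m (B n + x *: Sigma n)
               *m invmx (A n + g *: Sigma n)) (v n))%R])%E
   @ \oo --> 0%E).
Proof.
move=> S.
have [C1 [_ trC]] : exists C1 : R, 0 < C1 /\ \forall n \near \oo,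
    \sum_(j < n) r n j ^+ 2 / n%:R * opnorm (Sigma n) <= C1.
  move/eqO_exP: trO => [C1 C10 H]; exists C1; split=> //.
  apply: filterS H => n /=; rewrite normr1 mulr1; exact: le_trans (ler_norm _).
have [C2 [_ pC]] : exists C2 : R, 0 < C2 /\ \forall n \near \oo,
    (p n)%:R / n%:R <= C2.
  move/eqO_exP: p_n => [C2 C20 H]; exists C2; split=> //.
  apply: filterS H => n /=; rewrite normr1 mulr1; exact: le_trans (ler_norm _).
pose f n := \sum_(j < n)
      Num.min (r n j ^+ 2 / n%:R)
        (r n j ^+ 4 / (n%:R `^ (3 / 2)) * opnorm (Sigma n))
        * opnorm (B n) * opnorm (Sigma n).
pose F n := ('E_(P n)[(fun w => quad (invmx (S n w + A n) *m B n *m invmx (S n w + A n)) (v n))%R] -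
    'E_(P n)[(fun w =>
       let g := gamma (r n) (Sigma n) (S n w) (A n) in
       let x := xi (r n) (Sigma n) (S n w) (A n) (B n) in
       quad (invmx (A n + g *: Sigma n) *m (B n + x *: Sigma n) *m
         invmx (A n + g *: Sigma n)) (v n))%R])%E.
have bound : \forall n \near \oo, exists D : R,
    F n = D%:E /\ `|D| <= equiv_const t C1 C2 * f n.
  near=> n.
  have n0 : (0 < n)%N by near: n; exact: nbhs_infty_gt.
  have := @deterministic_equivalent R n (p n) _ _ (P n) (X n) (Sigma n)
    (r n) t (A n) (B n) (v n) C1 C2 n0 (XG n) (Xmean n) (Xcov n) (Xind n) t_gt0
    (loewner_pos_ge (At n n0)) (Bpsd n n0) (v1 n n0).
  apply.
    by near: n.
  rewrite -ler_pdivrMr ?ltr0n//; by near: n.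
apply/fine_cvgP; split.
  apply: filterS bound => n [D [e _]].
  by have : F n \is a fin_num by rewrite e.
apply/cvgrPdist_le => e e0.
pose K := `|equiv_const t C1 C2| + 1.
have K0 : 0 < K by rewrite ltr_wpDl.
have small := (eqoP _ _ _).1 sumo _ (divr_gt0 e0 K0).
near=> n; rewrite sub0r normrN.
suff : `|fine (F n)| <= e by [].
have [D [-> Dle]] : exists D : R, F n = D%:E /\ `|D| <= equiv_const t C1 C2 * f n.
  by near: n; exact: bound.
have fn : `|f n| <= e / K.
  have : `|f n| <= e / K * `|1 : R^o| by near: n; exact: small.
  by rewrite normr1 mulr1.
apply: (le_trans Dle); apply: (le_trans (ler_norm _)); rewrite normrM.
apply: (@le_trans _ _ (K * (e / K))).
  by apply: ler_pM => //; rewrite lerDl.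
by rewrite mulrCA divff ?mulr1// gt_eqF.
Unshelve. all: by end_near.
Qed.
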